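(* Let $g$ and $v$ be three times continuously differentiable and $f$ twice continuously differentiable. Let $(x^k)_{k\ge0}$ be constructed according to Algorithm quADAPT (described in the context), and assume that for every $k\ge 1$ the point $x^k$ is a stationary (KKT) point of $\overline{\mathrm{SIP}}^{k-1}(Y^k)$ and that $\overline I^k=I$ for every $k$. Assume there is a strongly stable stationary point $x^*\in M$ of $\mathrm{SIP}$ with $\lim_{k\to\infty}x^k=x^*$ such that: EMFCQ is satisfied at $x^*$; the Reduction Ansatz holds at $x^*$; and for every $i\in I$ the global solution $y^{i,*}$ of the lower-level problem $Q_i(x^* )$ is unique and satisfies $g_i(x^*,y^{i,*})=0$. Then there is a constant $L$ such that, for all sufficiently large $k$, $$\|x^{k+1}-x^*\|\le L\,\|x^k-x^*\|^2 .$$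
   Context: **Problem.** Let $I,J$ be finite index sets, $f:\mathbb R^n\to\mathbb R$, $g=(g_i)_{i\in I}:\mathbb R^n\times\mathbb R^m\to\mathbb R^{|I|}$, $v=(v_j)_{j\in J}:\mathbb R^m\to\mathbb R^{|J|}$. Let $Y=\{y\in\mathbb R^m: v_j(y)\le 0\ \forall j\in J\}$, assumed compact. $\mathrm{SIP}$ is the problem of minimizing $f(x)$ over $x\in\mathbb R^n$ subject to $g_i(x,y)\le 0$ for all $i\in I$, $y\in Y$; its feasible set is $M$. For $i\in I$, $x\in\mathbb R^n$, the lower-level problem $Q_i(x)$ is to maximize $g_i(x,y)$ over $y\in Y$. Its Lagrange function is $\mathcal L_i(x,y,\mu)=g_i(x,y)-\sum_{j\in J}\mu_j v_j(y)$. $D_1,D_2$ denote derivatives with respect to the first and second (vector) argument; $\|\cdot\|$ is the Euclidean norm; $B_\varepsilon(x)$ is the open ball. Active indices: $Y_0^i(x)=\{y\in Y: g_i(x,y)=0\}$. **Regularity of lower-level points.** A point $y\in Y$ satisfies LICQ if the gradients $Dv_j(y)$, $j\in J$ with $v_j(y)=0$, are linearly independent. It satisfies LICQ, strict complementary slackness and the second-order sufficient condition for $Q_i(x)$ if LICQ holds and there is a (then unique) $\mu\in\mathbb R^{|J|}$ with $D_2\mathcal L_i(x,y,\mu)=0$, $\mu_j\ge0$, $\mu_jv_j(y)=0$ for all $j\in J$, such that for each $j$ exactly one of $\mu_j$, $v_j(y)$ is zero, and $d^\top D_2^2\mathcal L_i(x,y,\mu)d<0$ for all $d\in\mathbb R^m\setminus\{0\}$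 with $Dv_j(y)d=0$ for all $j$ with $\mu_j>0$. The Reduction Ansatz holds at $x$ if, for every $i\in I$, every $y\in Y_0^i(x)$ satisfies LICQ, strict complementary slackness and the second-order sufficient condition for $Q_i(x)$. **Algorithm quADAPT.** Input: $x^0\in\mathbb R^n$ and a finite set $Y^0\subseteq Y$. In iteration $k=0,1,2,\dots$: for each $i\in I$ compute a global solution $y^{i,k}$ of $Q_i(x^k)$ with Lagrange multipliers $\mu^{i,k}$ satisfying the KKT conditions. Let $\overline I^k$ be the set of $i\in I$ for which $y^{i,k}$ satisfies LICQ, strict complementary slackness and the second-order sufficient condition for $Q_i(x^k)$. For $i\in\overline I^k$ the implicit function theorem gives, near $x^k$, continuously differentiable functions $y^i(\cdot),\mu^i(\cdot)$ with $y^i(x^k)=y^{i,k}$, $\mu^i(x^k)=\mu^{i,k}$, such that $y^i(x)$ is the locally unique stationary (KKT) point of $Q_i(x)$ near $y^{i,k}$ and $\mu^i(x)$ is its multiplier vector. Put $\overline y^{i,k}(x)=y^{i,k}+Dy^i(x^k)(x-x^k)$, $\overline\mu^{i,k}(x)=\mu^{i,k}+D\mu^i(x^k)(x-x^k)$ and $\overline g_i^k(x)=\mathcal L_i(x,\overline y^{i,k}(x),\overline\mu^{i,k}(x))$. Set $Y^{k+1}=Y^k\cup\bigcup_{i\in I}\{y^{i,k}\}$ and let $x^{k+1}$ be a solution (here: KKT point) of the finite problem $\overline{\mathrm{SIP}}^k(Y^{k+1})$: minimize $f(x)$ over $x\in\mathbb R^n$ subject to $g_i(x,y)\le0$ for all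 $i\in I$, $y\in Y^{k+1}$, and $\overline g_i^k(x)\le 0$ for all $i\in\overline I^k$. A KKT point is feasible and admits nonnegative Lagrange multipliers satisfying the usual stationarity and complementarity conditions. **EMFCQ** at $x$: there is $\xi\in\mathbb R^n$ with $D_1g_i(x,y)\xi\le-1$ for every $i\in I$, $y\in Y_0^i(x)$. **Stationary point of SIP.** A feasible point $x\in M$ at which the Reduction Ansatz holds (then each $Y_0^i(x)$ is finite) is a stationary point of $\mathrm{SIP}$ if there are $\lambda_{i,y}\ge 0$ ($i\in I$, $y\in Y_0^i(x)$) with $0=Df(x)+\sum_{i\in I}\sum_{y\in Y_0^i(x)}\lambda_{i,y}D_1g_i(x,y)$. **Strong stability.** For a bounded open $U\subseteq\mathbb R^n$ and twice continuously differentiable $\tilde f:\mathbb R^n\to\mathbb R$, $\tilde g:\mathbb R^n\times\mathbb R^m\to\mathbb R^{|I|}$, let $\mathrm{norm}(\tilde f,\tilde g,U)$ be the maximum of $\sup_{x\in U}\max\{|\tilde f(x)|,\|D\tilde f(x)\|,\|D^2\tilde f(x)\|\}$ and $\max_{i\in I}\sup_{x\in U}\max_{y\in Y}\max\{|\tilde g_i(x,y)|,\|D\tilde g_i(x,y)\|,\|D^2\tilde g_i(x,y)\|\}$. Let $\mathcal F_\delta(U)$ be the set of all such pairs $(\tilde f,\tilde g)$ with $\mathrm{norm}(\tilde f,\tilde g,U)<\delta$. $\mathrm{SIP}(\tilde f,\tilde g)$ is the problem of minimizing $f(x)+\tilde f(x)$ subject to $g_i(x,y)+\tilde g_i(x,y)\le0$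 for all $i\in I$, $y\in Y$; its stationary points are defined as for $\mathrm{SIP}$ with $f,g$ replaced by $f+\tilde f,g+\tilde g$. A stationary point $x^*$ of $\mathrm{SIP}$ is strongly stable if there is $\varepsilon^*>0$ such that for every $\varepsilon\in(0,\varepsilon^*]$ there is $\delta>0$ such that for every $(\tilde f,\tilde g)\in\mathcal F_\delta(B_{\varepsilon^*}(x^* ))$ the problem $\mathrm{SIP}(\tilde f,\tilde g)$ has, within $B_{\varepsilon^*}(x^* )$, a unique stationary point $x(\tilde f,\tilde g)$, and $\|x^*-x(\tilde f,\tilde g)\|<\varepsilon$. *)

(* Defs.v *)
From HB Require Import structures.
From mathcomp Require Import all_boot all_order all_algebra.
From mathcomp Require Import all_classical all_reals all_analysis.

Set Implicit Arguments.
Unset Strict Implicit.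
Unset Printing Implicit Defensive.

Import Order.TTheory GRing.Theory Num.Theory.
Import numFieldNormedType.Exports.

Local Open Scope classical_set_scope.
Local Open Scope ring_scope.

Section Calculus.
Context {R : realType}.

Definition dot (p : nat) (a b : 'rV[R]_p) : R := (a *m b^T) 0 0.

(* The library norm on matrices is the sup norm; this is the Euclidean norm of
   vectors, and on Hessians the Euclidean norm of the entries (Frobenius). *)
Definition enorm (p q : nat) (A : 'M[R]_(p, q)) : R :=
  Num.sqrt (\sum_i \sum_j A i j ^+ 2).

Definition eball (p : nat) (a : 'rV[R]_p) (e : R) : set 'rV[R]_p :=
  [set z | enorm (z - a) < e].

Definition grad (p : nat) (h : 'rV[R]_p -> R) (x : 'rV[R]_p) : 'rV[R]_p :=
  \row_j 'D_(delta_mx 0 j) h x.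

Definition hess (p : nat) (h : 'rV[R]_p -> R) (x : 'rV[R]_p) : 'M[R]_p :=
  \matrix_(i, j) 'D_(delta_mx 0 i) ('D_(delta_mx 0 j) h) x.

(* C^k on the whole space, by recursion on first-order partial derivatives. *)
Fixpoint Ck (k p : nat) (h : 'rV[R]_p -> R) : Prop :=
  if k is k'.+1 then
    (forall x, differentiable h x) /\
    (forall j, Ck k' ('D_(delta_mx 0 j) h))
  else continuous h.

Definition C1_near (p : nat) (W : normedModType R) (F : 'rV[R]_p -> W)
    (a : 'rV[R]_p) : Prop :=
  \forall x \near a, differentiable F x /\
    forall j, {for x, continuous ('D_(delta_mx 0 j) F)}.

(* Functions of (x, y) are curried; [joint] is the same function on R^(n+m),
   so that its smoothness, gradient and Hessian are the joint ones. *)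
Definition joint (n m : nat) (h : 'rV[R]_n -> 'rV[R]_m -> R)
    (z : 'rV[R]_(n + m)) : R := h (lsubmx z) (rsubmx z).

End Calculus.

Section LowerLevel.
Context {R : realType} {n m : nat} {J : finType}.
Implicit Types (v : J -> 'rV[R]_m -> R) (gi : 'rV[R]_n -> 'rV[R]_m -> R).
Implicit Types (x : 'rV[R]_n) (y : 'rV[R]_m) (mu : J -> R).

Definition Yset v : set 'rV[R]_m := [set y | forall j, v j y <= 0].

Definition lower_sol gi v x y : Prop :=
  Yset v y /\ forall z, Yset v z -> gi x z <= gi x y.

Definition Lagr gi v x y mu : R := gi x y - \sum_j mu j * v j y.

Definition lower_KKT gi v x y mu : Prop :=
  [/\ Yset v y,
      grad (fun z => Lagr gi v x z mu) y = 0,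
      forall j, 0 <= mu j
    & forall j, mu j * v j y = 0].

Definition LICQ v y : bool :=
  free [seq grad (v j) y | j <- enum J & v j y == 0].

Definition strict_compl v y mu : Prop :=
  forall j, (mu j == 0) (+) (v j y == 0).

Definition SOSC gi v x y mu : Prop :=
  forall d : 'rV[R]_m, d != 0 ->
    (forall j, 0 < mu j -> dot (grad (v j) y) d = 0) ->
    dot (d *m hess (fun z => Lagr gi v x z mu) y) d < 0.

Definition regular gi v x y : Prop :=
  LICQ v y /\
  exists mu, [/\ lower_KKT gi v x y mu, strict_compl v y mu
               & SOSC gi v x y mu].

(* y(.) and mu(.) are the functions given near xk by the implicit function
   theorem at the KKT pair (yk, muk) of the lower-level problem at xk. *)
Definition implicit_KKT gi v (xk : 'rV[R]_n) (yk : 'rV[R]_m) (muk : J -> R)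
    (yf : 'rV[R]_n -> 'rV[R]_m) (muf : J -> 'rV[R]_n -> R) : Prop :=
  [/\ yf xk = yk /\ (forall j, muf j xk = muk j),
      C1_near yf xk /\ (forall j, C1_near (muf j) xk),
      \forall x \near xk, lower_KKT gi v x (yf x) (fun j => muf j x)
    & exists2 V : set 'rV[R]_m, nbhs yk V &
        \forall x \near xk, forall z nu,
          V z -> lower_KKT gi v x z nu -> z = yf x].

Definition gbar gi v (xk : 'rV[R]_n) (yk : 'rV[R]_m) (muk : J -> R)
    (yf : 'rV[R]_n -> 'rV[R]_m) (muf : J -> 'rV[R]_n -> R) x : R :=
  Lagr gi v x (yk + 'd yf xk (x - xk))
    (fun j => muk j + 'd (muf j) xk (x - xk)).

End LowerLevel.

Section SemiInfinite.
Context {R : realType} {n m : nat} {I J : finType}.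
Implicit Types (f : 'rV[R]_n -> R) (g : I -> 'rV[R]_n -> 'rV[R]_m -> R).
Implicit Types (v : J -> 'rV[R]_m -> R) (x : 'rV[R]_n).

Definition feasible g v : set 'rV[R]_n :=
  [set x | forall i y, Yset v y -> g i x y <= 0].

Definition Y0 g v (i : I) x : set 'rV[R]_m :=
  [set y | Yset v y /\ g i x y = 0].

Definition reduction_ansatz g v x : Prop :=
  forall i y, Y0 g v i x y -> regular (g i) v x y.

Definition EMFCQ g v x : Prop :=
  exists xi : 'rV[R]_n, forall i y, Y0 g v i x y ->
    dot (grad (g i ^~ y) x) xi <= -1.

(* The sums over the active sets are finite sums: under the reduction ansatz
   the active points are isolated in a compact set. *)
Definition stationary f g v x : Prop :=
  [/\ feasible g v x, reduction_ansatz g v x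
    & exists lam : I -> 'rV[R]_m -> R,
        (forall i y, Y0 g v i x y -> 0 <= lam i y) /\
        grad f x +
          \sum_i \sum_(y \in Y0 g v i x) lam i y *: grad (g i ^~ y) x = 0].

(* Extended-real valued, as the suprema need not be finite. *)
Definition pert_norm v f g (U : set 'rV[R]_n) : \bar R :=
  Order.max
    (ereal_sup [set (Num.max `|f x|
        (Num.max (enorm (grad f x)) (enorm (hess f x))))%:E | x in U])
    (\big[Order.max/-oo%E]_(i : I)
       ereal_sup [set ereal_sup [set (Num.max `|g i x y|
           (Num.max (enorm (grad (joint (g i)) (row_mx x y)))
                    (enorm (hess (joint (g i)) (row_mx x y)))))%:E
         | y in Yset v] | x in U]).

Definition small_pert v (delta : R) (U : set 'rV[R]_n) f g : Prop :=
  [/\ Ck 2 f, forall i, Ck 2 (joint (g i)) & (pert_norm v f g U < delta%:E)%E].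

Definition strongly_stable f g v (xs : 'rV[R]_n) : Prop :=
  stationary f g v xs /\
  exists2 es : R, 0 < es & forall e : R, 0 < e <= es ->
    exists2 delta : R, 0 < delta & forall ft gt,
      small_pert v delta (eball xs es) ft gt ->
      let st := stationary (fun x => f x + ft x)
                           (fun i x y => g i x y + gt i x y) v in
      exists xt : 'rV[R]_n,
        [/\ eball xs es xt, st xt,
            forall z, eball xs es z -> st z -> z = xt
          & enorm (xs - xt) < e].

(* KKT point of: minimize f subject to g_i(., y) <= 0 for i in I and y in the
   finite set Yk, and gb_i <= 0 for i in Ib. *)
Definition approx_KKT f g (Yk : set 'rV[R]_m) (Ib : set I)
    (gb : I -> 'rV[R]_n -> R) x : Prop :=
  [/\ forall i y, Yk y -> g i x y <= 0,
      forall i, Ib i -> gb i x <= 0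
    & exists (lam : I -> 'rV[R]_m -> R) (nu : I -> R),
      [/\ forall i y, Yk y -> 0 <= lam i y /\ lam i y * g i x y = 0,
          forall i, Ib i -> 0 <= nu i /\ nu i * gb i x = 0
        & grad f x
          + \sum_i \sum_(y \in Yk) lam i y *: grad (g i ^~ y) x
          + \sum_(i \in Ib) nu i *: grad (gb i) x = 0]].

Definition Ibar g v x (yk : I -> 'rV[R]_m) : set I :=
  [set i | regular (g i) v x (yk i)].

(* The data x^k, Y^k, y^{i,k}, mu^{i,k}, y^i(.), mu^i(.) of a run; yf k i and
   muf k i are constrained only when i is in Ibar^k. *)
Record quADAPT f g v (x : nat -> 'rV[R]_n) (Yk : nat -> set 'rV[R]_m)
    (y : nat -> I -> 'rV[R]_m) (mu : nat -> I -> J -> R)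
    (yf : nat -> I -> 'rV[R]_n -> 'rV[R]_m)
    (muf : nat -> I -> J -> 'rV[R]_n -> R) : Prop := {
  quADAPT_Y0 : finite_set (Yk 0%N) /\ Yk 0%N `<=` Yset v;
  quADAPT_lower : forall k i, lower_sol (g i) v (x k) (y k i) /\
    lower_KKT (g i) v (x k) (y k i) (mu k i);
  quADAPT_implicit : forall k i, Ibar g v (x k) (y k) i ->
    implicit_KKT (g i) v (x k) (y k i) (mu k i) (yf k i) (muf k i);
  quADAPT_YS : forall k, Yk k.+1 = Yk k `|` range (y k);
  quADAPT_next : forall k,
    approx_KKT f g (Yk k.+1) (Ibar g v (x k) (y k))
      (fun i => gbar (g i) v (x k) (y k i) (mu k i) (yf k i) (muf k i))
      (x k.+1)
}.

End SemiInfinite.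

(* Main.v *)
Require Import Defs.
From HB Require Import structures.
From mathcomp Require Import all_boot all_order all_algebra.
From mathcomp Require Import all_classical all_reals all_analysis.
From mathcomp Require Import ring lra.
Set Implicit Arguments.
Unset Strict Implicit.
Unset Printing Implicit Defensive.
Import Order.TTheory GRing.Theory Num.Theory.
Import numFieldNormedType.Exports.
Local Open Scope classical_set_scope.
Local Open Scope ring_scope.

(** Let z be the new iterate, x0 the old one, and let eta_i be the maximiser
    of Q_i(z). The proof has two halves: z is a KKT point of SIP up to a
    defect of order |z - x0|^2, and strong stability forces the distance of
    such a point to xs to be of the order of the defect. Together |z - xs| <=
    C |z - x0|^2 <= 2C (|z - xs|^2 + |x0 - xs|^2), and as z tends to xs the
    first term on the right is absorbed by the left-hand side.

    Defect. By strict complementarity the active set of the lower-level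
    solution is locally constant, so near xs the lower-level KKT system is the
    critical point equation in w = (y, nu) of one function, the Lagrangian
    [LagrA] with the multipliers of the active constraints only. LICQ and the
    second-order condition make its Hessian in w injective ([LagrA_hess_inj]),
    hence w-gradients control distances uniformly near the limit
    ([wgrad_expansive]). The linear prediction of w made at x0 leaves a
    w-gradient of order |z - x0|^2 at z, so it misses the critical point by
    O(|z - x0|^2). Since the w-gradient vanishes at the critical point, the
    approximate constraint has error O(|z - x0|^4) in value and O(|z - x0|^2)
    in gradient ([predictor_accuracy]). A cut y that is active at z need not
    be a maximiser of Q_i(z), but uniform quadratic growth of the lower-level
    problem ([quadratic_growth]) and the bound on g_i(z, eta_i) just obtained
    give |y - eta_i| = O(|z - x0|^2). Replacing the gradient of each active
    constraint by that of g_i(., eta_i), and bounding the multipliers with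
    EMFCQ, gives [approx_KKT_defect].

    Stability ([stable_calm]). If z is different from xs and its defect is
    small relative to |z - xs|, two explicit quadratic perturbations centred
    at xs, of f and of each g_i as a function of x only, make z an exact
    stationary point. They vanish to first order at xs, so xs stays
    stationary, and they are C^2 small: a quadratic form takes a gradient of
    size e at distance r with a Hessian of size e/r, and a value of size e
    with a Hessian of size e/r^2. The perturbed problem then has two
    stationary points near xs, against the uniqueness in strong stability.
    Values may thus be off by a small multiple of |z - xs|^2 only, which is
    why the fourth-order accuracy of the approximate constraints is needed. *)

(** * Functions of class C^k on row vectors *)

Section Calculus.
Context {R : realType}.

(** The two difference quotients are the same function.  Every chain rule with
    an affine inner function is taken from here. *)
Lemma derive_along (U V W : normedModType R) (F : V -> W) (phi : U -> V)
    (x u : U) (w : V) :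
  (forall h : R, phi (h *: u + x) = h *: w + phi x) ->
  'D_u (F \o phi) x = 'D_w F (phi x).
Proof.
move=> E; rewrite /derive.
under [X in lim (X @ _)]eq_fun => h do rewrite /= E.
by [].
Qed.

Lemma derive_addc (U V : normedModType R) (F : U -> V) (c : V) (x u : U) :
  'D_u (fun z => F z + c) x = 'D_u F x.
Proof.
rewrite /derive.
under [X in lim (X @ _)]eq_fun => h do rewrite /= opprD addrACA subrr addr0.
by [].
Qed.

Lemma coord_le_norm (p : nat) (u : 'rV[R]_p) j : `|u 0 j| <= `|u|.
Proof.
rewrite [leRHS]/Num.norm /= mx_normrE.
by apply/bigmax_geP; right; exists (0, j).
Qed.

Lemma norm_le_coord (p : nat) (u : 'rV[R]_p) c :
  0 <= c -> (forall j, `|u 0 j| <= c) -> `|u| <= c.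
Proof.
move=> c0 uc; rewrite [leLHS]/Num.norm /= mx_normrE.
by apply: bigmax_le => //= -[i j] _ /=; rewrite ord1.
Qed.

Lemma linear_rV_continuous (p : nat) (W : normedModType R)
  (l : {linear 'rV[R]_p -> W}) : continuous l.
Proof.
have -> : (l : 'rV[R]_p -> W) = fun x => \sum_j x 0 j *: l 'e_j.
  apply/funext => x; rewrite {1}[x]row_sum_delta linear_sum.
  by apply: eq_bigr => j _; rewrite linearZ.
apply: continuous_big => [|j _ x]; first exact: add_continuous.
apply: cvgZr_tmp; [exact: (nbhs_filter x)|exact: coord_continuous].
Qed.

Lemma derive_sum_coord (p : nat) (W : normedModType R) (h : 'rV[R]_p -> W) x u :
  differentiable h x -> 'D_u h x = \sum_j u 0 j *: 'D_('e_j) h x.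
Proof.
move=> dh; rewrite deriveE // {1}[u]row_sum_delta linear_sum.
by apply: eq_bigr => j _; rewrite linearZ deriveE.
Qed.

Lemma deriveD_dir (p : nat) (W : normedModType R) (h : 'rV[R]_p -> W) x u w :
  differentiable h x -> 'D_(u + w) h x = 'D_u h x + 'D_w h x.
Proof. by move=> dh; rewrite !deriveE // linearD. Qed.

Lemma deriveZ_dir (p : nat) (W : normedModType R) (h : 'rV[R]_p -> W) x c u :
  differentiable h x -> 'D_(c *: u) h x = c *: 'D_u h x.
Proof. by move=> dh; rewrite !deriveE // linearZ. Qed.

Lemma Ck_diff k p (h : 'rV[R]_p -> R) x : Ck k.+1 h -> differentiable h x.
Proof. by case=> + _; apply. Qed.

Lemma CkW k p (h : 'rV[R]_p -> R) : Ck k.+1 h -> Ck k h.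
Proof.
elim: k h => [|k IH] h [dh ch]; first by move=> x; exact/differentiable_continuous/dh.
by split=> // j; apply: IH.
Qed.

Lemma Ck_continuous k p (h : 'rV[R]_p -> R) : Ck k h -> continuous h.
Proof. by elim: k h => [//|k IH] h Ch; exact/IH/CkW. Qed.

Lemma Ck_cst k p (c : R) : @Ck R k p (cst c).
Proof.
elim: k c => [|k IH] c /=; first exact: cst_continuous.
split=> // j; rewrite (_ : 'D_('e_j) _ = cst 0) //.
by apply/funext => x; rewrite derive_cst.
Qed.

Lemma CkD k p (h1 h2 : 'rV[R]_p -> R) :
  Ck k h1 -> Ck k h2 -> Ck k (fun x => h1 x + h2 x).
Proof.
elim: k h1 h2 => [|k IH] h1 h2 /=; first by move=> c1 c2 x; exact: (continuousD (c1 x) (c2 x)).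
move=> [d1 c1] [d2 c2]; split=> [x|j]; first exact: differentiableD.
rewrite (_ : 'D_('e_j) _ = fun x => 'D_('e_j) h1 x + 'D_('e_j) h2 x).
  exact: IH.
by apply/funext => x; rewrite deriveD //; exact: diff_derivable.
Qed.

Lemma CkM k p (h1 h2 : 'rV[R]_p -> R) :
  Ck k h1 -> Ck k h2 -> Ck k (fun x => h1 x * h2 x).
Proof.
elim: k h1 h2 => [|k IH] h1 h2; first by move=> c1 c2 x; exact: (continuousM (c1 x) (c2 x)).
move=> C1 C2; have [d1 c1] := C1; have [d2 c2] := C2.
split=> [x|j]; first exact: differentiableM.
rewrite (_ : 'D_('e_j) _ = fun x => h1 x * 'D_('e_j) h2 x + h2 x * 'D_('e_j) h1 x).
  exact: CkD (IH _ _ (CkW C1) (c2 j)) (IH _ _ (CkW C2) (c1 j)).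
by apply/funext => x; rewrite deriveM //; exact: diff_derivable.
Qed.

Lemma Ck_sum k p (I : Type) (r : seq I) (P : pred I) (h : I -> 'rV[R]_p -> R) :
  (forall i, Ck k (h i)) -> Ck k (fun x => \sum_(i <- r | P i) h i x).
Proof.
move=> hC; elim: r => [|i r IH].
  rewrite (_ : (fun x => _) = cst 0); first exact: Ck_cst.
  by apply/funext => x; rewrite big_nil.
rewrite (_ : (fun x => _) =
    fun x => (if P i then h i x else 0) + \sum_(j <- r | P j) h j x).
  by apply: CkD => //; case: (P i) => //; exact: Ck_cst.
by apply/funext => x; rewrite big_cons; case: (P i); rewrite ?add0r.
Qed.

Lemma Ck_derive k p (h : 'rV[R]_p -> R) u : Ck k.+1 h -> Ck k ('D_u h).
Proof.
move=> [dh ch]; rewrite (_ : 'D_u h = fun x => \sum_j u 0 j * 'D_('e_j) h x).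
  by apply: Ck_sum => j; exact: (CkM (@Ck_cst k p (u 0 j)) (ch j)).
by apply/funext => x; rewrite derive_sum_coord.
Qed.

Lemma Ck_comp_affine k p q (l : {linear 'rV[R]_p -> 'rV[R]_q}) c
  (h : 'rV[R]_q -> R) : Ck k h -> Ck k (fun x => h (c + l x)).
Proof.
have dl x : differentiable (fun x => c + l x) x.
  apply: differentiableD; first exact: differentiable_cst.
  by apply: linear_differentiable; exact: linear_rV_continuous.
elim: k h => [|k IH] h.
  move=> ch x; have := differentiable_continuous (dl x).
  by move=> cl; apply: (continuous_comp cl); exact: ch.
move=> Ch; have [dh ch] := Ch; split=> [x|j]; first exact: (differentiable_comp (dl x)).
rewrite (_ : 'D_('e_j) _ = fun x => 'D_(l 'e_j) h (c + l x)).
  exact: (IH _ (Ck_derive (l 'e_j) Ch)).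
apply/funext => x; apply: (@derive_along _ _ _ h (fun x => c + l x)) => t.
by rewrite linearD linearZ /= addrCA.
Qed.

Lemma Ck_comp_linear k p q (l : {linear 'rV[R]_p -> 'rV[R]_q})
  (h : 'rV[R]_q -> R) : Ck k h -> Ck k (h \o l).
Proof.
move=> Ch; rewrite (_ : h \o l = fun x => h (0 + l x)); first exact: Ck_comp_affine.
by apply/funext => x; rewrite add0r.
Qed.

Lemma mean_value p (h : 'rV[R]_p -> R) x y : (forall z, differentiable h z) ->
  exists2 t : R, 0 <= t <= 1 & h y - h x = 'D_(y - x) h (x + t *: (y - x)).
Proof.
move=> dh; pose G (t : R) := h (x + t *: (y - x)).
have dG t : is_derive t (1 : R) G ('D_(y - x) h (x + t *: (y - x))).
  have E : forall s : R, x + (s *: (1 : R) + t) *: (y - x) =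
      s *: (y - x) + (x + t *: (y - x)).
    by move=> s; rewrite addrCA -scalerDl [s *: _]mulr1.
  split; last exact: (@derive_along _ _ _ h (fun s : R => x + s *: (y - x)) t 1 (y - x) E).
  have := @diff_derivable _ _ _ h (x + t *: (y - x)) (y - x) (dh _).
  rewrite /derivable; suff -> : (fun s : R => s^-1 *:
      ((h \o shift (x + t *: (y - x))) (s *: (y - x)) - h (x + t *: (y - x)))) =
    (fun s : R => s^-1 *: ((G \o shift t) (s *: (1:R)) - G t)) by [].
  by apply/funext => s /=; rewrite /G -E.
have [|c c01] := @MVT_segment R G _ 0 1 ler01 (fun s _ => dG s).
  apply: continuous_subspaceT => s.
  apply: differentiable_continuous; rewrite -derivable1_diffP; exact: ex_derive.
have -> : G 1 = h y by rewrite /G scale1r [x + _]addrC subrK.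
have -> : G 0 = h x by rewrite /G scale0r addr0.
rewrite subr0 mulr1 => ->; by exists c.
Qed.

Lemma segment_ball p (a x y : 'rV[R]_p) d t : 0 <= t <= 1 ->
  `|x - a| < d -> `|y - a| < d -> `|x + t *: (y - x) - a| < d.
Proof.
move=> /andP[t0 t1] xa ya.
have -> : x + t *: (y - x) - a = (1 - t) *: (x - a) + t *: (y - a).
  by apply/rowP => j; rewrite !mxE; ring.
apply: le_lt_trans (ler_normD _ _) _; rewrite !normrZ ger0_norm ?subr_ge0 // ger0_norm //.
have [->|tn0] := eqVneq t 0; first by rewrite subr0 mul1r mul0r addr0.
have tp : 0 < t by rewrite lt_def tn0.
have : (1 - t) * `|x - a| <= (1 - t) * d by rewrite ler_wpM2l ?subr_ge0 // ltW.
have : t * `|y - a| < t * d by rewrite ltr_pM2l.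
lra.
Qed.

(** The differential is a finite combination of partial derivatives, which are
    continuous at a. *)
Lemma derive_near p (h : 'rV[R]_p -> R) a : Ck 1 h -> forall e : R, 0 < e ->
  exists2 d, 0 < d & forall x u, `|x - a| < d ->
    `|'D_u h x - 'D_u h a| <= e * `|u|.
Proof.
move=> [dh ch] e e0; pose e' := e / p.+1%:R.
have e'0 : 0 < e' by rewrite divr_gt0.
have : \forall x \near a, forall j, `|'D_('e_j) h a - 'D_('e_j) h x| < e'.
  apply: (@filter_forall _ 'I_p
    (fun j x => `|'D_('e_j) h a - 'D_('e_j) h x| < e') (nbhs a)) => j.
  have cj : continuous ('D_('e_j) h) := ch j.
  have /cvgrPdist_lt := cj a; exact.
move/nbhs_normP => [d d0 H]; exists d => // x u xa.
rewrite (derive_sum_coord _ (dh x)) (derive_sum_coord _ (dh a)) -sumrB.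
apply: le_trans (ler_norm_sum _ _ _) _.
apply: (@le_trans _ _ (\sum_(j < p) e' * `|u|)).
  apply: ler_sum => j _; rewrite -scalerBr normrZ mulrC ler_pM //.
    by rewrite distrC ltW //; apply: H; rewrite /= distrC.
  exact: coord_le_norm.
rewrite sumr_const card_ord -mulr_natl mulrA ler_wpM2r //.
by rewrite /e' mulrCA ger_pMr // ler_pdivrMr // mul1r ler_nat.
Qed.

Lemma strict_derive p (h : 'rV[R]_p -> R) a : Ck 1 h -> forall e : R, 0 < e ->
  exists2 d, 0 < d & forall x y, `|x - a| < d -> `|y - a| < d ->
    `|h y - h x - 'D_(y - x) h a| <= e * `|y - x|.
Proof.
move=> Ch e e0; have [d d0 H] := derive_near a Ch e0.
exists d => // x y xa ya.
have [t t01 ->] := mean_value x y (fun z => Ck_diff z Ch).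
exact/H/segment_ball.
Qed.

Lemma derive_bound p (h : 'rV[R]_p -> R) a : differentiable h a ->
  exists2 C, 0 <= C & forall u, `|'D_u h a| <= C * `|u|.
Proof.
move=> dh; exists (\sum_j `|'D_('e_j) h a|); first exact: sumr_ge0.
move=> u; rewrite derive_sum_coord // mulr_suml.
apply: le_trans (ler_norm_sum _ _ _) _; apply: ler_sum => j _.
by rewrite normrZ mulrC ler_wpM2l // coord_le_norm.
Qed.

Lemma derive_bound_near p (h : 'rV[R]_p -> R) a : Ck 1 h ->
  exists C d, [/\ 0 <= C, 0 < d & forall x u, `|x - a| < d ->
    `|'D_u h x| <= C * `|u|].
Proof.
move=> Ch; have [d d0 H] := derive_near a Ch ltr01.
have [C C0 HC] := derive_bound (Ck_diff a Ch).
exists (C + 1), d; split => [|//|x u xa]; first by rewrite addr_ge0.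
have := H x u xa; have := HC u.
have := ler_normD ('D_u h x - 'D_u h a) ('D_u h a); rewrite subrK; lra.
Qed.

Lemma lipschitz_near p (h : 'rV[R]_p -> R) a : Ck 1 h ->
  exists C d, [/\ 0 <= C, 0 < d & forall x y, `|x - a| < d -> `|y - a| < d ->
    `|h y - h x| <= C * `|y - x|].
Proof.
move=> Ch; have [C [d [C0 d0 H]]] := derive_bound_near a Ch.
exists C, d; split => // x y xa ya.
have [t t01 ->] := mean_value x y (fun z => Ck_diff z Ch).
exact/H/segment_ball.
Qed.

Lemma derive2_sum_coord p (h : 'rV[R]_p -> R) a u w : Ck 2 h ->
  'D_w ('D_u h) a = \sum_j u 0 j *: 'D_w ('D_('e_j) h) a.
Proof.
move=> [dh ch]; rewrite (_ : 'D_u h = \sum_j (u 0 j \*: 'D_('e_j) h)).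
  rewrite derive_sum => [|j].
    by apply: eq_bigr => j _; rewrite deriveZ //; apply: diff_derivable; case: (ch j).
  by apply: derivableZ; apply: diff_derivable; case: (ch j).
by apply/funext => z; rewrite derive_sum_coord // fct_sumE.
Qed.

(** Strict differentiability of x |-> 'D_u h x, with an error linear in u so
    that it holds for all directions at once. *)
Lemma strict_derive2 p (h : 'rV[R]_p -> R) a : Ck 2 h -> forall e : R, 0 < e ->
  exists2 d, 0 < d & forall x y u, `|x - a| < d -> `|y - a| < d ->
    `|'D_u h y - 'D_u h x - 'D_(y - x) ('D_u h) a| <= e * `|u| * `|y - x|.
Proof.
move=> Ch e e0; pose e' := e / p.+1%:R.
have e'0 : 0 < e' by rewrite divr_gt0.
have [dh ch] := Ch.
have : \forall d \near 0^'+, forall j x y, `|x - a| < d -> `|y - a| < d ->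
    `|'D_('e_j) h y - 'D_('e_j) h x - 'D_(y - x) ('D_('e_j) h) a| <= e' * `|y - x|.
  apply: filter_forall => j; have [d d0 H] := strict_derive a (ch j) e'0.
  near=> s => x y xa ya; apply: H; [apply: lt_le_trans xa _|apply: lt_le_trans ya _];
  by near: s; exact: nbhs_right_le.
move=> H; have [d [d0 {}H]] := @filter_ex _ _ (at_right_proper_filter _) _
  (filterI (nbhs_right_gt (0 : R)) H).
exists d => // x y u xa ya.
have E z : 'D_u h z = \sum_j u 0 j *: 'D_('e_j) h z by rewrite derive_sum_coord.
rewrite (derive2_sum_coord a u (y - x) Ch).
rewrite !E -!sumrB; apply: le_trans (ler_norm_sum _ _ _) _.
apply: (@le_trans _ _ (\sum_(j < p) `|u| * (e' * `|y - x|))).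
  apply: ler_sum => j _; rewrite -!scalerBr normrZ ler_pM //.
    exact: coord_le_norm.
  exact: H.
rewrite sumr_const card_ord -mulr_natl [e * _]mulrC -[leRHS]mulrA mulrCA ler_wpM2l //.
rewrite mulrA ler_wpM2r // /e' mulrCA ger_pMr // ler_pdivrMr // mul1r.
by rewrite ler_nat.
Unshelve. all: by end_near. Qed.

Lemma derive_lipschitz_near p (h : 'rV[R]_p -> R) a : Ck 2 h ->
  exists C d, [/\ 0 <= C, 0 < d & forall x y u, `|x - a| < d -> `|y - a| < d ->
    `|'D_u h y - 'D_u h x| <= C * `|u| * `|y - x|].
Proof.
move=> Ch; have [d1 d10 H1] := strict_derive2 a Ch ltr01; have [dh ch] := Ch.
have /choice [B HB] : forall j, exists B, 0 <= B /\
    forall w, `|'D_w ('D_('e_j) h) a| <= B * `|w|.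
  move=> j; have [B B0 HB] := derive_bound (@Ck_diff 0 p _ a (ch j)).
  by exists B.
pose C := 1 + \sum_j B j.
have B0 j : 0 <= B j by have [] := HB j.
exists C, d1; split => //; first by rewrite addr_ge0 // sumr_ge0.
move=> x y u xa ya; have := H1 x y u xa ya; rewrite mul1r => {}H1.
have E : 'D_(y - x) ('D_u h) a = \sum_j u 0 j *: 'D_(y - x) ('D_('e_j) h) a.
  exact: derive2_sum_coord.
have : `|'D_(y - x) ('D_u h) a| <= (\sum_j B j) * `|u| * `|y - x|.
  rewrite E -mulrA mulr_suml; apply: le_trans (ler_norm_sum _ _ _) _.
  apply: ler_sum => j _; rewrite normrZ mulrCA ler_pM ?coord_le_norm //.
  by have [_] := HB j; exact.
have := ler_normD ('D_u h y - 'D_u h x - 'D_(y - x) ('D_u h) a) ('D_(y - x) ('D_u h) a).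
rewrite subrK /C !mulrDl mul1r; lra.
Qed.

(** The Hessian is frozen at a while the base point x varies.  With the
    second-order term subtracted, the derivative along the segment is bounded
    by e |u|^2 at every point of it; an estimate by a single mean value would
    lose the factor 1/2. *)
Lemma taylor2 p (h : 'rV[R]_p -> R) a : Ck 2 h -> forall e : R, 0 < e ->
  exists2 d, 0 < d & forall x u, `|x - a| < d -> `|x + u - a| < d ->
    `|h (x + u) - h x - 'D_u h x - 2^-1 * 'D_u ('D_u h) a| <= e * `|u| ^+ 2.
Proof.
move=> Ch e e0; have [d d0 H] := strict_derive2 a Ch e0.
exists d => // x u xa ya.
set Q := 'D_u ('D_u h) a; set D := 'D_u h x.
pose G (s : R) := h (x + s *: u) - s * D - 2^-1 * s ^+ 2 * Q.
have dh z : differentiable h z := Ck_diff z Ch.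
have dG t : is_derive t (1 : R) G ('D_u h (x + t *: u) - D - t * Q).
  have E : forall s : R, x + (s *: (1 : R) + t) *: u = s *: u + (x + t *: u).
    by move=> s; rewrite addrCA -scalerDl [s *: _]mulr1.
  have d1 : is_derive t (1 : R) (fun s : R => h (x + s *: u)) ('D_u h (x + t *: u)).
    split; last exact: (@derive_along _ _ _ h (fun s : R => x + s *: u) t 1 u E).
    have := @diff_derivable _ _ _ h (x + t *: u) u (dh _).
    rewrite /derivable; suff -> : (fun s : R => s^-1 *:
        ((h \o shift (x + t *: u)) (s *: u) - h (x + t *: u))) =
      (fun s : R => s^-1 *: (((fun s : R => h (x + s *: u)) \o shift t) (s *: (1:R))
         - h (x + t *: u))) by [].
    by apply/funext => s /=; rewrite -E.
  rewrite /G; apply: is_derive_eq.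
  have sE (b c : R) : b *: c = b * c by [].
  rewrite !scaler0 !sE; lra.
have [|c c01] := @MVT_segment R G _ 0 1 ler01 (fun s _ => dG s).
  apply: continuous_subspaceT => s.
  apply: differentiable_continuous; rewrite -derivable1_diffP; exact: ex_derive.
rewrite subr0 mulr1 /G scale1r scale0r addr0 mul0r expr0n /= mulr0 mul0r !subr0.
rewrite mul1r expr1n mulr1 => E.
have -> : h (x + u) - h x - D - 2^-1 * Q = 'D_u h (x + c *: u) - D - c * Q.
  by rewrite -E; ring.
move: c01; rewrite in_itv /= => /andP [c0 c1].
have := H x (x + c *: u) u xa.
rewrite [x + _ - x]addrAC subrr add0r deriveZ_dir; last first.
  exact: (Ck_diff a (Ck_derive u Ch)).
rewrite normrZ (ger0_norm c0) => /(_ _)/le_trans; apply.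
  have := @segment_ball _ a x (x + u) d c _ xa ya.
  by rewrite [x + u - x]addrAC subrr add0r; apply; rewrite c0.
by rewrite -mulrA ler_pM2l // mulrCA -expr2 ler_piMl.
Qed.

End Calculus.

(** * Accuracy of a linear prediction along an implicit branch *)

Section SecondOrder.
Context {R : realType}.

Lemma second_order_near p (h : 'rV[R]_p -> R) a : Ck 2 h ->
  exists C d, [/\ 0 <= C, 0 < d & forall x u, `|x - a| < d -> `|x + u - a| < d ->
    `|h (x + u) - h x - 'D_u h x| <= C * `|u| ^+ 2].
Proof.
move=> Ch; have [C [d [C0 d0 H]]] := derive_lipschitz_near a Ch.
exists C, d; split => // x u xa ya.
have [t t01] := mean_value x (x + u) (fun z => Ck_diff z Ch).
have -> : x + u - x = u by rewrite addrAC subrr add0r.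
move=> ->; have := @segment_ball _ _ a x (x + u) d t t01 xa ya.
have -> : x + u - x = u by rewrite addrAC subrr add0r.
move=> xta; apply: le_trans (H _ _ u xa xta) _.
have -> : x + t *: u - x = t *: u by rewrite addrAC subrr add0r.
move: t01 => /andP[t0 t1]; rewrite normrZ ger0_norm // -mulrA ler_wpM2l //.
by rewrite mulrCA -expr2 ler_piMl.
Qed.

(** Applied to each partial derivative and summed, since the constant has to
    be uniform in u. *)
Lemma derive_second_order_near p (h : 'rV[R]_p -> R) a : Ck 3 h ->
  exists C d, [/\ 0 <= C, 0 < d & forall x u w, `|x - a| < d -> `|x + w - a| < d ->
    `|'D_u h (x + w) - 'D_u h x - 'D_w ('D_u h) x| <= C * `|u| * `|w| ^+ 2].
Proof.
move=> Ch; have [dh ch] := Ch.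
have : \forall d \near 0^'+, forall j, exists C, 0 <= C /\ forall x w,
    `|x - a| < d -> `|x + w - a| < d ->
    `|'D_('e_j) h (x + w) - 'D_('e_j) h x - 'D_w ('D_('e_j) h) x| <= C * `|w| ^+ 2.
  apply: filter_forall => j; have [C [d [C0 d0 H]]] := second_order_near a (ch j).
  near=> s; exists C; split=> // x w xa ya.
  apply: H; [apply: lt_le_trans xa _|apply: lt_le_trans ya _];
  by near: s; exact: nbhs_right_le.
move=> H; have [d [d0 {H} /choice [C HC]]] := @filter_ex _ _ (at_right_proper_filter _) _
  (filterI (nbhs_right_gt (0 : R)) H).
have C0 j : 0 <= C j by have [] := HC j.
exists (\sum_j C j), d; split; [exact: sumr_ge0|by []|].
move=> x u w xa ya; rewrite (derive2_sum_coord x u w (CkW Ch)).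
rewrite !(derive_sum_coord u (dh _)) -!sumrB !mulr_suml.
apply: le_trans (ler_norm_sum _ _ _) _; apply: ler_sum => j _.
rewrite -!scalerBr normrZ [C j * _]mulrC -mulrA ler_pM ?coord_le_norm //.
by have [_] := HC j; exact.
Unshelve. all: by end_near. Qed.

End SecondOrder.

Section RowBlocks.
Context {R : realType} {n q : nat}.

Lemma norm_row_mx_le (a : 'rV[R]_n) (b : 'rV[R]_q) c :
  `|a| <= c -> `|b| <= c -> `|row_mx a b| <= c.
Proof.
move=> ac bc; apply: norm_le_coord; first exact: le_trans ac.
move=> j; rewrite mxE; case: splitP => k _.
  exact: le_trans (coord_le_norm _ _) ac.
exact: le_trans (coord_le_norm _ _) bc.
Qed.

Lemma norm_row_mx_lt (a : 'rV[R]_n) (b : 'rV[R]_q) c :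
  `|a| < c -> `|b| < c -> `|row_mx a b| < c.
Proof.
move=> ac bc; apply: (@le_lt_trans _ _ (Num.max `|a| `|b|)).
  by apply: norm_row_mx_le; rewrite le_max lexx ?orbT.
by rewrite gt_max ac.
Qed.

Lemma row_mxB (a c : 'rV[R]_n) (b d : 'rV[R]_q) :
  row_mx a b - row_mx c d = row_mx (a - c) (b - d).
Proof. by rewrite opp_row_mx add_row_mx. Qed.

Lemma norm_row0 (b : 'rV[R]_q) : `|row_mx (0 : 'rV[R]_n) b| = `|b|.
Proof.
apply/eqP; rewrite eq_le norm_row_mx_le ?normr0 //=.
apply: norm_le_coord => // j.
by have := coord_le_norm (row_mx (0 : 'rV[R]_n) b) (rshift n j); rewrite row_mxEr.
Qed.

Lemma norm_row0r (a : 'rV[R]_n) : `|row_mx a (0 : 'rV[R]_q)| = `|a|.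
Proof.
apply/eqP; rewrite eq_le norm_row_mx_le ?normr0 //=.
apply: norm_le_coord => // j.
by have := coord_le_norm (row_mx a (0 : 'rV[R]_q)) (lshift q j); rewrite row_mxEl.
Qed.

Lemma row0_sum (b : 'rV[R]_q) :
  row_mx (0 : 'rV[R]_n) b = \sum_j b 0 j *: row_mx 0 'e_j.
Proof.
rewrite -[RHS]hsubmxK; congr row_mx; apply/rowP => i; rewrite !(mxE, summxE).
  by rewrite big1 // => j _; rewrite !mxE (unsplitK (inl _)) mxE mulr0.
rewrite (bigD1 i) //= big1 ?addr0 => [|j ji]; rewrite !mxE (unsplitK (inr _)) !mxE eqxx.
  by rewrite eqxx mulr1.
by rewrite eq_sym (negPf ji) mulr0.
Qed.

End RowBlocks.

Section ImplicitBranch.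
Context {R : realType} {n q : nat}.
Implicit Types (LL : 'rV[R]_(n + q) -> R) (x z : 'rV[R]_n) (w : 'rV[R]_q).

Definition wgrad0 LL x w := forall u : 'rV[R]_q,
  'D_(row_mx 0 u) LL (row_mx x w) = 0.

(** Directional and with explicit remainder, so that it is checked block by
    block for a function with values in a product. *)
Definition tangent (wf : 'rV[R]_n -> 'rV[R]_q) x w (M : 'M[R]_(n, q)) :=
  forall u (e : R), 0 < e -> \forall s \near (0 : R),
    `|wf (x + s *: u) - w - s *: (u *m M)| <= e * `|s|.

Lemma norm_mulmx_le p r (M : 'M[R]_(p, r)) :
  exists2 C, 0 <= C & forall u : 'rV[R]_p, `|u *m M| <= C * `|u|.
Proof.
exists (\sum_i \sum_j `|M i j|); first by apply: sumr_ge0 => i _; apply: sumr_ge0.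
move=> u; apply: norm_le_coord => [|j].
  by rewrite mulr_ge0 //; apply: sumr_ge0 => i _; apply: sumr_ge0.
rewrite mxE; apply: le_trans (ler_norm_sum _ _ _) _.
rewrite mulr_suml; apply: ler_sum => i _; rewrite normrM mulrC ler_pM ?coord_le_norm //.
by rewrite (bigD1 j) //= lerDl sumr_ge0.
Qed.

(** An injective square matrix is invertible, and the norm of its inverse
    gives the constant. *)
Lemma hess_lower_bound LL (a : 'rV[R]_(n + q)) : Ck 2 LL ->
  (forall u : 'rV[R]_q, (forall w : 'rV[R]_q,
     'D_(row_mx 0 u) ('D_(row_mx 0 w) LL) a = 0) -> u = 0) ->
  exists2 K, 0 < K & forall (u : 'rV[R]_q) t,
    (forall b, `|'D_(row_mx 0 u) ('D_(row_mx 0 'e_b) LL) a| <= t) -> 0 <= t ->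
    `|u| <= K * t.
Proof.
move=> C2 inj.
pose H : 'M[R]_q := \matrix_(c, b) 'D_(row_mx 0 'e_c) ('D_(row_mx 0 'e_b) LL) a.
have uH (u : 'rV[R]_q) b : (u *m H) 0 b = 'D_(row_mx 0 u) ('D_(row_mx 0 'e_b) LL) a.
  have df := Ck_diff a (Ck_derive (row_mx 0 'e_b) C2).
  rewrite (deriveE _ df) (row0_sum u) linear_sum mxE; apply: eq_bigr => c _.
  by rewrite linearZ -(deriveE _ df) mxE.
have Hu : H \in unitmx.
  rewrite -row_free_unit; apply: inj_row_free => u uH0.
  apply: inj => w; have -> : 'D_(row_mx 0 w) LL =
      \sum_b (w 0 b \*: 'D_(row_mx 0 'e_b) LL).
    apply/funext => p; rewrite (deriveE _ (Ck_diff p C2)) (row0_sum w) linear_sum fct_sumE.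
    by apply: eq_bigr => c _; rewrite linearZ -(deriveE _ (Ck_diff p C2)).
  have df b := Ck_diff a (Ck_derive (row_mx 0 'e_b) C2).
  rewrite derive_sum => [|b]; last by apply/derivableZ/diff_derivable/df.
  rewrite big1 // => b _; rewrite deriveZ; last exact/diff_derivable/df.
  by rewrite -uH uH0 mxE scaler0.
have [C C0 HC] := norm_mulmx_le (invmx H).
exists (C + 1); first by rewrite ltr_wpDl.
move=> u t ut t0; rewrite -[u](mulmxK Hu) mulrDl mul1r.
apply: le_trans (HC _) _; apply: ler_wpDr => //; rewrite ler_wpM2l //.
by apply: norm_le_coord => // b; rewrite uH.
Qed.

(** Quantitative injectivity part of the inverse function theorem: the
    difference of the w-gradients is the Hessian at (xs, ws) applied to w' - w
    up to a small multiple of |w' - w|, and that Hessian is bounded below. *)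
Lemma wgrad_expansive LL (xs : 'rV[R]_n) (ws : 'rV[R]_q) : Ck 2 LL ->
  (forall u : 'rV[R]_q, (forall w : 'rV[R]_q,
     'D_(row_mx 0 u) ('D_(row_mx 0 w) LL) (row_mx xs ws) = 0) -> u = 0) ->
  exists K d, [/\ 0 < K, 0 < d & forall x w w' t,
    `|x - xs| < d -> `|w - ws| < d -> `|w' - ws| < d -> 0 <= t ->
    (forall u, `|'D_(row_mx 0 u) LL (row_mx x w') - 'D_(row_mx 0 u) LL (row_mx x w)|
                <= t * `|u|) ->
    `|w' - w| <= K * t].
Proof.
move=> C2 /(hess_lower_bound C2) [K K0 HK].
have e0 : 0 < (2 * K)^-1 by rewrite invr_gt0 mulr_gt0.
have [d d0 H] := strict_derive2 (row_mx xs ws) C2 e0.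
exists (2 * K), d; split => //; first by rewrite mulr_gt0.
move=> x w w' t xd wd wd' t0 Ht.
have e1 (b : 'I_q) : `|('e_b : 'rV[R]_q)| <= 1.
  by apply: norm_le_coord => // j; rewrite mxE; case: (_ && _); rewrite ?normr1 ?normr0.
suff : `|w' - w| <= K * (t + (2 * K)^-1 * `|w' - w|).
  have -> : K * (t + (2 * K)^-1 * `|w' - w|) = K * t + 2^-1 * `|w' - w|.
    by field; rewrite gt_eqF.
  lra.
apply: HK => [b|]; last by rewrite addr_ge0 // mulr_ge0 // ltW.
have := H (row_mx x w) (row_mx x w') (row_mx 0 'e_b).
rewrite !row_mxB subrr => /(_ (norm_row_mx_lt xd wd) (norm_row_mx_lt xd wd')).
rewrite !norm_row0; set A := 'D_(row_mx 0 (w' - w)) _ _; move=> {}H.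
have {}Ht := le_trans (Ht 'e_b) (ler_piMr t0 (e1 b)).
have : (2 * K)^-1 * `|'e_b : 'rV[R]_q| * `|w' - w| <= (2 * K)^-1 * `|w' - w|.
  by rewrite ler_wpM2r // ler_piMr // ltW.
move: H Ht; set B := 'D_ _ _ _; set B' := 'D_ _ _ _.
have := ler_normB (B - B') (B - B' - A); rewrite opprB addrC subrK; lra.
Qed.

End ImplicitBranch.

Section BranchAccuracy.
Context {R : realType} {n q : nat}.
Implicit Types (LL : 'rV[R]_(n + q) -> R) (x z : 'rV[R]_n) (w : 'rV[R]_q).

Record implicit_branch LL x w (wf : 'rV[R]_n -> 'rV[R]_q) (M : 'M[R]_(n, q)) : Prop := {
  branch_val : wf x = w;
  branch_tangent : tangent wf x w M;
  branch_grad : \forall x' \near x, wgrad0 LL x' (wf x')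
}.

Lemma near_line (T : normedModType R) (x u : T) (P : T -> Prop) :
  (\forall x' \near x, P x') -> \forall s \near (0 : R), P (x + s *: u).
Proof.
move=> xP; have : (fun s : R => x + s *: u) @ 0 --> x.
  rewrite -[X in _ --> X]addr0 -(scale0r u).
  by apply: cvgD; [exact: cvg_cst|apply: cvgZr_tmp].
by apply.
Qed.

Lemma near0_pos (Q : R -> Prop) : (\forall s \near (0 : R), Q s) ->
  exists2 s, 0 < s & Q s.
Proof.
move=> /nbhs_normP [d d0 H]; exists (d / 2); first by rewrite divr_gt0.
apply: H; rewrite /= sub0r normrN gtr0_norm ?divr_gt0 //.
by rewrite ltr_pdivrMr // ltr_pMr // ltr1n.
Qed.

Lemma branch_near LL x w wf M u (e r : R) (xs : 'rV[R]_n) (ws : 'rV[R]_q) :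
  implicit_branch LL x w wf M -> 0 < e -> `|x - xs| < r -> `|w - ws| < r ->
  \forall s \near (0 : R),
    [/\ `|wf (x + s *: u) - w - s *: (u *m M)| <= e * `|s|,
        wgrad0 LL (x + s *: u) (wf (x + s *: u)),
        `|x + s *: u - xs| < r, `|wf (x + s *: u) - ws| < r &
        `|w + s *: (u *m M) - ws| < r].
Proof.
move=> B e0 xr wr; have t1 := branch_tangent B u e0.
have g1 := near_line u (branch_grad B).
have x1 : \forall s \near (0 : R), `|x + s *: u - xs| < r.
  apply: (@near_line _ x u (fun x' => `|x' - xs| < r)).
  have r0 : 0 < r - `|x - xs| by rewrite subr_gt0.
  apply/nbhs_normP; exists (r - `|x - xs|) => // x' /=; rewrite (distrC x x') => H.
  have := ler_normD (x' - x) (x - xs); rewrite addrA subrK; lra.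
pose r' := (r - `|w - ws|) / 2.
have r'0 : 0 < r' by rewrite divr_gt0 // subr_gt0.
have w1 : \forall s \near (0 : R), `|s *: (u *m M)| < r'.
  have : \forall s \near (0 : R), `|0 + s *: (u *m M)| < r'.
    apply: (@near_line _ 0 (u *m M) (fun y => `|y| < r')).
    by apply/nbhs_normP; exists r' => // y /=; rewrite sub0r normrN.
  by apply: filterS => s; rewrite add0r.
have e1 : \forall s \near (0 : R), e * `|s| < r'.
  apply/nbhs_normP; exists (r' / e); first by rewrite /= divr_gt0.
  by move=> s; rewrite /= sub0r normrN ltr_pdivlMr // mulrC.
near=> s.
have T1 : `|wf (x + s *: u) - w - s *: (u *m M)| <= e * `|s| by near: s.
have W1 : `|s *: (u *m M)| < r' by near: s.
have E1 : e * `|s| < r' by near: s.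
have R1 : `|w - ws| + r' + r' = r by rewrite /r'; field.
split => //; [by near: s|by near: s| |].
  have -> : wf (x + s *: u) - ws =
    (wf (x + s *: u) - w - s *: (u *m M)) + s *: (u *m M) + (w - ws).
    by rewrite subrK addrA subrK.
  apply: le_lt_trans (ler_normD _ _) _.
  have := ler_normD (wf (x + s *: u) - w - s *: (u *m M)) (s *: (u *m M)); lra.
rewrite addrAC; apply: le_lt_trans (ler_normD _ _) _.
lra.
Unshelve. all: by end_near. Qed.

(** Both (x + s u, wf (x + s u)) and (x, w) are critical, so the w-gradient at
    (x + s u, w) is O(s |u|); by expansiveness wf moves at most that far. *)
Lemma branch_slope_le LL xs ws (K d L : R) :
  (forall x w w' t,
    `|x - xs| < d -> `|w - ws| < d -> `|w' - ws| < d -> 0 <= t ->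
    (forall u : 'rV[R]_q, `|'D_(row_mx 0 u) LL (row_mx x w') - 'D_(row_mx 0 u) LL (row_mx x w)|
                <= t * `|u|) ->
    `|w' - w| <= K * t) ->
  (forall p p' u, `|p - row_mx xs ws| < d -> `|p' - row_mx xs ws| < d ->
    `|'D_u LL p' - 'D_u LL p| <= L * `|u| * `|p' - p|) ->
  0 <= L ->
  forall x w wf M, implicit_branch LL x w wf M ->
  `|x - xs| < d -> `|w - ws| < d ->
  forall u : 'rV[R]_n, `|u *m M| <= K * L * `|u|.
Proof.
move=> HK HL L0 x w wf M B xd wd u.
apply/ler_addgt0Pr => e e0.
have [s s0 [Ts Gs xs1 ws1 _]] := near0_pos (branch_near u B e0 xd wd).
have Gw : wgrad0 LL x w by have := nbhs_singleton (branch_grad B); rewrite (branch_val B).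
have L1 : `|wf (x + s *: u) - w| <= K * (L * `|s *: u|).
  apply: (HK (x + s *: u)) => // [|v]; first by rewrite mulr_ge0.
  rewrite Gs sub0r normrN -[X in `|X|]subr0 -(Gw v) -mulrA mulrCA mulrC.
  have := HL (row_mx x w) (row_mx (x + s *: u) w) (row_mx 0 v).
  rewrite !row_mxB subrr norm_row0 norm_row0r.
  have -> : x + s *: u - x = s *: u by rewrite addrAC subrr add0r.
  by rewrite -mulrA; apply; exact: norm_row_mx_lt.
have L2 : s * `|u *m M| <= s * (K * L * `|u| + e).
  have -> : s * `|u *m M| = `|s *: (u *m M)| by rewrite normrZ gtr0_norm.
  have := ler_normB (wf (x + s *: u) - w) (wf (x + s *: u) - w - s *: (u *m M)).
  rewrite opprB addrC subrK; move: Ts L1; rewrite normrZ gtr0_norm //; lra.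
by rewrite -(ler_pM2l s0).
Qed.

(** Differentiating the w-gradient along the branch, where it vanishes
    identically: replacing the branch by its tangent changes the w-gradient by
    o(s), by the Lipschitz bound. *)
Lemma branch_derive LL xs ws (d L : R) : Ck 2 LL -> 0 <= L ->
  (forall p p' u, `|p - row_mx xs ws| < d -> `|p' - row_mx xs ws| < d ->
    `|'D_u LL p' - 'D_u LL p| <= L * `|u| * `|p' - p|) ->
  forall x w wf M, implicit_branch LL x w wf M ->
  `|x - xs| < d -> `|w - ws| < d ->
  forall (u : 'rV[R]_n) (v : 'rV[R]_q),
    'D_(row_mx u (u *m M)) ('D_(row_mx 0 v) LL) (row_mx x w) = 0.
Proof.
move=> C2 L0 HL x w wf M B xd wd u v.
have Gw : wgrad0 LL x w by have := nbhs_singleton (branch_grad B); rewrite (branch_val B).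
apply: (@cvg_lim R); first exact: Rhausdorff.
apply/cvgr0Pnorm_le => e e0.
pose e1 := e / (L * `|v| + 1).
have Lv0 : 0 < L * `|v| + 1 by rewrite ltr_wpDl // mulr_ge0.
have e10 : 0 < e1 by rewrite divr_gt0.
have H := branch_near u B e10 xd wd.
rewrite near_withinE; near=> s => s0.
have [Ts Gs xs1 ws1 ws2] : [/\ `|wf (x + s *: u) - w - s *: (u *m M)| <= e1 * `|s|,
        wgrad0 LL (x + s *: u) (wf (x + s *: u)),
        `|x + s *: u - xs| < d, `|wf (x + s *: u) - ws| < d &
        `|w + s *: (u *m M) - ws| < d] by near: s.
rewrite /= (Gw v) subr0 normrZ normfV ler_pdivrMl ?normr_gt0 //.
have -> : s *: row_mx u (u *m M) + row_mx x w = row_mx (x + s *: u) (w + s *: (u *m M)).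
  by rewrite scale_row_mx add_row_mx addrC [_ + w]addrC.
rewrite -[X in `|X|]subr0 -(Gs v).
apply: le_trans (HL _ _ _ _ _) _.
- by rewrite row_mxB; exact: norm_row_mx_lt.
- by rewrite row_mxB; exact: norm_row_mx_lt.
rewrite row_mxB subrr !norm_row0 distrC opprD addrA.
apply: le_trans (ler_wpM2l _ Ts) _; first by rewrite mulr_ge0.
rewrite mulrA [leRHS]mulrC ler_wpM2r // /e1 mulrA ler_pdivrMr // mulrC ler_pM2l //.
by rewrite lerDl.
Unshelve. all: by end_near. Qed.

(** At the predicted point the w-gradient is O(|z - x|^2), because it vanishes
    to first order along the tangent; hence the prediction is within O(|z -
    x|^2) of the critical point w.  The value error is quadratic in that
    distance, since LL is critical in w at (z, w). *)
Lemma predictor_accuracy LL (xs : 'rV[R]_n) (ws : 'rV[R]_q) : Ck 3 LL ->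
  (forall u : 'rV[R]_q, (forall w : 'rV[R]_q,
     'D_(row_mx 0 u) ('D_(row_mx 0 w) LL) (row_mx xs ws) = 0) -> u = 0) ->
  exists C d, [/\ 0 <= C, 0 < d & forall x z w0 w wf M,
    `|x - xs| < d -> `|z - xs| < d -> `|w0 - ws| < d -> `|w - ws| < d ->
    implicit_branch LL x w0 wf M -> wgrad0 LL z w ->
    let gb := fun x' => LL (row_mx x' (w0 + (x' - x) *m M)) in
    `|gb z - LL (row_mx z w)| <= C * `|z - x| ^+ 4 /\
    forall u, `|'D_u gb z - 'D_(row_mx u 0) LL (row_mx z w)| <= C * `|u| * `|z - x| ^+ 2].
Proof.
move=> C3 inj; have C2 := CkW C3.
have [K [d1 [K0 d10 HK]]] := wgrad_expansive C2 inj.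
have [L [d2 [L0 d20 HL]]] := derive_lipschitz_near (row_mx xs ws) C2.
have [T [d3 [T0 d30 HT]]] := derive_second_order_near (row_mx xs ws) C3.
have [S [d4 [S0 d40 HS]]] := second_order_near (row_mx xs ws) C2.
pose r := Num.min (Num.min d1 d2) (Num.min d3 d4).
have r0 : 0 < r by rewrite !lt_min d10 d20 d30.
have [r1 r2 r3 r4] : [/\ r <= d1, r <= d2, r <= d3 & r <= d4].
  by rewrite !ge_min !lexx ?orbT.
pose m := K * L; have m0 : 0 <= m by rewrite mulr_ge0 // ltW.
pose K2 := K * T * (1 + m) ^+ 2.
have K20 : 0 <= K2 by rewrite !mulr_ge0 ?exprn_ge0 ?addr_ge0 // ltW.
(* the predicted point is within d (1 + 2 m) of ws, hence stays in the ball of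
   radius r *)
pose d := r / (3 * (1 + m)).
have m1 : 0 < 1 + m by rewrite ltr_pwDl.
have d0 : 0 < d by rewrite divr_gt0 // mulr_gt0.
have dr : d * (3 * (1 + m)) = r by rewrite divfK // gt_eqF // mulr_gt0.
have dlr : d <= r by rewrite -dr ler_peMr ?ltW //; lra.
exists (S * K2 ^+ 2 + L * K2 * (1 + m)), d; split => //.
  by rewrite addr_ge0 ?mulr_ge0 ?exprn_ge0 // ltW.
move=> x z w0 w wf M xd zd w0d wd B Gz gb.
have HLr : forall p p' u, `|p - row_mx xs ws| < r -> `|p' - row_mx xs ws| < r ->
    `|'D_u LL p' - 'D_u LL p| <= L * `|u| * `|p' - p|.
  by move=> p p' u a b; apply: HL; exact: lt_le_trans r2.
have HKr : forall x w w' t,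
    `|x - xs| < r -> `|w - ws| < r -> `|w' - ws| < r -> 0 <= t ->
    (forall u : 'rV[R]_q, `|'D_(row_mx 0 u) LL (row_mx x w') - 'D_(row_mx 0 u) LL (row_mx x w)|
                <= t * `|u|) -> `|w' - w| <= K * t.
  by move=> x' w1 w1' t a b c; apply: HK; exact: lt_le_trans r1.
have Mb (u : 'rV[R]_n) : `|u *m M| <= m * `|u|.
  exact: (branch_slope_le HKr HLr L0 B (lt_le_trans xd dlr) (lt_le_trans w0d dlr)).
have D0 (u : 'rV[R]_n) (v : 'rV[R]_q) :
    'D_(row_mx u (u *m M)) ('D_(row_mx 0 v) LL) (row_mx x w0) = 0.
  exact: (branch_derive C2 L0 HLr B (lt_le_trans xd dlr) (lt_le_trans w0d dlr)).
pose h := z - x; pose wb := w0 + h *m M.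
have hd : `|h| < 2 * d.
  have := ler_normB (z - xs) (x - xs).
  rewrite opprB addrA subrK /h; lra.
have hM : `|h *m M| <= m * `|h| := Mb h.
have wbr : `|wb - ws| < r.
  rewrite /wb addrAC; have := ler_normD (w0 - ws) (h *m M).
  have : m * `|h| <= m * (2 * d) by rewrite ler_wpM2l // ltW.
  rewrite -dr; move: (mulr_ge0 m0 (ltW d0)); lra.
have wr : `|w - ws| < r by exact: lt_le_trans dlr.
have zr : `|z - xs| < r by exact: lt_le_trans dlr.
have step : `|row_mx h (h *m M)| <= (1 + m) * `|h|.
  apply: norm_row_mx_le; last by move: (normr_ge0 h); lra.
  by rewrite ler_peMl //; lra.
have p0r : `|row_mx x w0 - row_mx xs ws| < r.
  by rewrite row_mxB; apply: norm_row_mx_lt; exact: lt_le_trans dlr.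
have pbr : `|row_mx z wb - row_mx xs ws| < r by rewrite row_mxB norm_row_mx_lt.
have pwr : `|row_mx z w - row_mx xs ws| < r by rewrite row_mxB norm_row_mx_lt.
have Gw0 : wgrad0 LL x w0 by have := nbhs_singleton (branch_grad B); rewrite (branch_val B).
have F1 v : `|'D_(row_mx 0 v) LL (row_mx z wb)| <= T * (1 + m) ^+ 2 * `|h| ^+ 2 * `|v|.
  have := HT (row_mx x w0) (row_mx 0 v) (row_mx h (h *m M)) (lt_le_trans p0r r3).
  have -> : row_mx x w0 + row_mx h (h *m M) = row_mx z wb.
    by rewrite add_row_mx /h addrC subrK.
  move/(_ (lt_le_trans pbr r3)); rewrite D0 Gw0 !subr0 norm_row0 => H.
  apply: le_trans H _.
  have -> : T * (1 + m) ^+ 2 * `|h| ^+ 2 * `|v| = T * `|v| * ((1 + m) * `|h|) ^+ 2 by ring.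
  by rewrite ler_wpM2l ?mulr_ge0 // ler_sqr ?nnegrE // mulr_ge0 // ltW.
have wbw : `|wb - w| <= K2 * `|h| ^+ 2.
  have -> : K2 * `|h| ^+ 2 = K * (T * (1 + m) ^+ 2 * `|h| ^+ 2) by rewrite /K2 !mulrA.
  apply: (HK z w wb); try exact: lt_le_trans r1.
    by rewrite !mulr_ge0 ?exprn_ge0 // ltW.
  by move=> v; rewrite Gz subr0; exact: F1.
have gbz : gb z = LL (row_mx z wb) by [].
have Dpw : row_mx z wb = row_mx z w + row_mx 0 (wb - w).
  by rewrite add_row_mx addr0 [w + _]addrC subrK.
have C20 : 0 <= L * K2 * (1 + m) by rewrite !mulr_ge0 // ltW.
have C10 : 0 <= S * K2 ^+ 2 by rewrite mulr_ge0 // exprn_ge0.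
split.
  rewrite gbz; have := HS (row_mx z w) (row_mx 0 (wb - w)) (lt_le_trans pwr r4).
  rewrite -Dpw => /(_ (lt_le_trans pbr r4)); rewrite Gz subr0 norm_row0 => H.
  apply: le_trans H _; rewrite mulrDl; apply: ler_wpDr; first by rewrite mulr_ge0 // exprn_ge0.
  have -> : S * K2 ^+ 2 * `|z - x| ^+ 4 = S * (K2 * `|h| ^+ 2) ^+ 2 by rewrite /h; ring.
  by rewrite ler_wpM2l // ler_sqr ?nnegrE // mulr_ge0 // exprn_ge0.
move=> u.
have -> : 'D_u gb z = 'D_(row_mx u (u *m M)) LL (row_mx z wb).
  apply: (@derive_along _ _ _ _ LL (fun x' => row_mx x' (w0 + (x' - x) *m M))) => t.
  rewrite scale_row_mx add_row_mx; congr row_mx.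
  by rewrite -addrA mulmxDl -scalemxAl addrCA.
have -> : row_mx u (u *m M) = row_mx u 0 + row_mx 0 (u *m M).
  by rewrite add_row_mx addr0 add0r.
rewrite (deriveD_dir _ _ (Ck_diff _ C2)) addrAC.
apply: le_trans (ler_normD _ _) _.
have := HL (row_mx z w) (row_mx z wb) (row_mx u 0) (lt_le_trans pwr r2) (lt_le_trans pbr r2).
rewrite row_mxB subrr norm_row0 norm_row0r => H1.
have := HL (row_mx z w) (row_mx z wb) (row_mx 0 (u *m M)) (lt_le_trans pwr r2) (lt_le_trans pbr r2).
rewrite row_mxB subrr !norm_row0 Gz subr0 => H2.
have H1' : L * `|u| * `|wb - w| <= L * `|u| * (K2 * `|h| ^+ 2).
  by rewrite ler_wpM2l // mulr_ge0.
have H2' : L * `|u *m M| * `|wb - w| <= L * (m * `|u|) * (K2 * `|h| ^+ 2).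
  by rewrite ler_pM // ?mulr_ge0 // ler_wpM2l // Mb.
have C1p : 0 <= S * K2 ^+ 2 * `|u| * `|h| ^+ 2 by rewrite mulr_ge0 ?exprn_ge0 // mulr_ge0.
have -> : (S * K2 ^+ 2 + L * K2 * (1 + m)) * `|u| * `|z - x| ^+ 2 =
  S * K2 ^+ 2 * `|u| * `|h| ^+ 2 + (L * `|u| * (K2 * `|h| ^+ 2)
    + L * (m * `|u|) * (K2 * `|h| ^+ 2)) by rewrite /h; ring.
rewrite ler_wpDl //; apply: lerD; [exact: le_trans H1 H1'|exact: le_trans H2 H2'].
Qed.

End BranchAccuracy.

(** * Finsler's lemma *)

Section Finsler.
Context {R : realType}.

Lemma Ck_coord k p (a : 'I_p) : Ck k (fun u : 'rV[R]_p => u 0 a).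
Proof.
elim: k => [|k IH]; first exact: coord_continuous.
split=> [u|j]; first exact: differentiable_coord.
rewrite (_ : 'D_('e_j) _ = cst (('e_j : 'rV[R]_p) 0 a)); first exact: Ck_cst.
apply/funext => u.
rewrite (@derive_along _ _ _ _ id (fun u : 'rV[R]_p => u 0 a) u 'e_j (('e_j : 'rV[R]_p) 0 a)).
  by rewrite derive_id.
by move=> h; rewrite !mxE.
Qed.

Lemma compact_sphere m : compact [set d : 'rV[R]_m | `|d| = 1].
Proof.
apply: bounded_closed_compact.
  by exists 1; split => // r r1 d /= ->; exact: ltW.
rewrite (_ : [set _ | _] = Num.norm @^-1` [set 1 : R]) //.
by apply: closed_comp => [d _|]; [exact: norm_continuous|exact: closed_eq].
Qed.

(** On the compact part of the unit sphere where Q is nonnegative, B is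
    bounded below by a positive number, so a large multiple of B beats the
    maximum of Q there; elsewhere Q itself is negative. *)
Lemma finsler m (Q B : 'rV[R]_m -> R) : continuous Q -> continuous B ->
  (forall s d, Q (s *: d) = s ^+ 2 * Q d) ->
  (forall s d, B (s *: d) = s ^+ 2 * B d) ->
  (forall d, 0 <= B d) -> (forall d, d != 0 -> B d = 0 -> Q d < 0) ->
  exists c rho, [/\ 0 < c, 0 < rho & forall d, Q d <= - c * `|d| ^+ 2 + rho * B d].
Proof.
move=> cQ cB hQ hB B0 neg; pose S := [set d : 'rV[R]_m | `|d| = 1].
have Sc : compact S by exact: compact_sphere.
have Sn0 d : S d -> d != 0 by move=> /= d1; rewrite -normr_gt0 d1.
suff [c [rho [c0 rho0 H]]] : exists c rho, [/\ 0 < c, 0 < rho &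
    forall d, S d -> Q d - rho * B d <= - c].
  exists c, rho; split => // d; have [->|dn0] := eqVneq d 0.
    have -> : Q 0 = 0 by have := hQ 0 0; rewrite scale0r expr0n mul0r.
    have -> : B 0 = 0 by have := hB 0 0; rewrite scale0r expr0n mul0r.
    by rewrite normr0 expr0n !mulr0 addr0.
  have nd0 : 0 < `|d| by rewrite normr_gt0.
  have dE : d = `|d| *: (`|d|^-1 *: d) by rewrite scalerA divff ?scale1r // gt_eqF.
  have Sd : S (`|d|^-1 *: d) by rewrite /S /= normrZ normfV normr_id mulVf // gt_eqF.
  have := H _ Sd; rewrite -(ler_pM2l (exprn_gt0 2 nd0)) => {}H.
  rewrite {1 3}dE hQ hB; lra.
have [S0|SN] := eqVneq S set0.
  by exists 1, 1; split => // d; rewrite S0.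
have {}SN : S !=set0 by apply/set0P.
pose K := [set d | S d /\ 0 <= Q d].
have Kc : compact K.
  rewrite (_ : K = S `&` (Q @^-1` [set t | 0 <= t])) //.
  apply: compact_closedI => //; apply: closed_comp => [d _|]; first exact: cQ.
  exact: closed_ge.
have [al al0 Hal] : exists2 al, 0 <= al & forall d, S d -> Q d <= al.
  have [d0 Sd0 Hd0] := EVT_max_rV SN Sc (continuous_subspaceT cQ).
  exists (Num.max 0 (Q d0)); first by rewrite le_max lexx.
  by move=> d Sd; rewrite le_max Hd0 ?orbT // inE.
have [be be0 Hbe] : exists2 be, 0 < be & forall d, K d -> be <= B d.
  have [K0|KN] := eqVneq K set0; first by exists 1 => // d; rewrite K0.
  have {}KN : K !=set0 by apply/set0P.
  have [d0 + Hd0] := EVT_min_rV KN Kc (continuous_subspaceT cB).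
  rewrite inE => -[Sd0 Qd0]; exists (B d0) => [|d Kd]; last by apply: Hd0; rewrite inE.
  rewrite lt_def B0 andbT; apply/eqP => Bd0.
  by have := neg _ (Sn0 _ Sd0) Bd0; rewrite ltNge Qd0.
pose rho := (al + 1) / be.
have rho0 : 0 < rho by rewrite divr_gt0 // ltr_wpDl.
have lt0 d : S d -> Q d - rho * B d < 0.
  move=> Sd; have [Qd|Qd] := leP 0 (Q d).
    have Bd : be <= B d by apply: Hbe.
    have : rho * be <= rho * B d by rewrite ler_pM2l.
    rewrite {1}/rho divfK ?gt_eqF //; have := Hal d Sd; lra.
  by have := mulr_ge0 (ltW rho0) (B0 d); lra.
have cF : continuous (fun d => Q d - rho * B d).
  move=> d; have cr : {for d, continuous (cst rho : 'rV[R]_m -> R)} by exact: cst_continuous.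
  exact: (continuousB (cQ d) (continuousM cr (cB d))).
have [d0 Sd0 Hd0] := EVT_max_rV SN Sc (continuous_subspaceT cF).
exists (- (Q d0 - rho * B d0)), rho; split => //.
  by rewrite oppr_gt0; apply: lt0; move: Sd0; rewrite inE.
by move=> d Sd; rewrite opprK; apply: Hd0; rewrite inE.
Qed.

End Finsler.

(** * The Lagrangian of the active constraints *)

Section Slices.
Context {R : realType} {n m : nat}.

Definition incl_r (y : 'rV[R]_m) : 'rV[R]_(n + m) := row_mx 0 y.
Fact incl_r_linear : linear incl_r.
Proof. by move=> a y z; rewrite /incl_r scale_row_mx add_row_mx scaler0 addr0. Qed.
HB.instance Definition _ := GRing.isLinear.Build R _ _ _ incl_r incl_r_linear.

Definition incl_l (x : 'rV[R]_n) : 'rV[R]_(n + m) := row_mx x 0.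
Fact incl_l_linear : linear incl_l.
Proof. by move=> a y z; rewrite /incl_l scale_row_mx add_row_mx scaler0 addr0. Qed.
HB.instance Definition _ := GRing.isLinear.Build R _ _ _ incl_l incl_l_linear.

Lemma Ck_slice_r k (h : 'rV[R]_(n + m) -> R) x :
  Ck k h -> Ck k (fun y => h (row_mx x y)).
Proof.
move=> Ch; rewrite (_ : (fun y => _) = fun y => h (row_mx x 0 + incl_r y)).
  exact: Ck_comp_affine.
by apply/funext => y; rewrite add_row_mx addr0 add0r.
Qed.

Lemma Ck_slice_l k (h : 'rV[R]_(n + m) -> R) y :
  Ck k h -> Ck k (fun x => h (row_mx x y)).
Proof.
move=> Ch; rewrite (_ : (fun y => _) = fun x => h (row_mx 0 y + incl_l x)).
  exact: Ck_comp_affine.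
by apply/funext => x; rewrite add_row_mx addr0 add0r.
Qed.

Lemma joint_row (h : 'rV[R]_n -> 'rV[R]_m -> R) x y : joint h (row_mx x y) = h x y.
Proof. by rewrite /joint row_mxKl row_mxKr. Qed.

Lemma Ck_joint_r k (h : 'rV[R]_n -> 'rV[R]_m -> R) x :
  Ck k (joint h) -> Ck k (h x).
Proof.
move=> /(Ck_slice_r x); congr (Ck k _).
by apply/funext => y; rewrite joint_row.
Qed.

Lemma Ck_joint_l k (h : 'rV[R]_n -> 'rV[R]_m -> R) y :
  Ck k (joint h) -> Ck k (h ^~ y).
Proof.
move=> /(Ck_slice_l y); congr (Ck k _).
by apply/funext => x; rewrite joint_row.
Qed.

End Slices.

Section ActiveLagrangian.
Context {R : realType} {n m : nat} {J : finType}.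
Variables (gi : 'rV[R]_n -> 'rV[R]_m -> R) (v : J -> 'rV[R]_m -> R) (A : {set J}).
Hypotheses (gC3 : Ck 3 (joint gi)) (vC3 : forall j, Ck 3 (v j)).
Implicit Types (x : 'rV[R]_n) (y d : 'rV[R]_m) (nu k : 'rV[R]_#|A|).

(** Active constraints and their multipliers are indexed by ordinals, to make
    the pair (y, nu) a row vector. *)
Definition va (a : 'I_#|A|) : 'rV[R]_m -> R := v (enum_val a).

Definition xy_part (p : 'rV[R]_(n + (m + #|A|))) : 'rV[R]_(n + m) :=
  row_mx (lsubmx p) (lsubmx (rsubmx p)).
Definition y_part (p : 'rV[R]_(n + (m + #|A|))) : 'rV[R]_m := lsubmx (rsubmx p).
Definition nu_part (p : 'rV[R]_(n + (m + #|A|))) : 'rV[R]_#|A| := rsubmx (rsubmx p).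

Fact xy_part_linear : linear xy_part.
Proof. by move=> a p p'; rewrite /xy_part !linearP /= scale_row_mx add_row_mx. Qed.
HB.instance Definition _ := GRing.isLinear.Build R _ _ _ xy_part xy_part_linear.
Fact y_part_linear : linear y_part.
Proof. by move=> a p p'; rewrite /y_part !linearP. Qed.
HB.instance Definition _ := GRing.isLinear.Build R _ _ _ y_part y_part_linear.
Fact nu_part_linear : linear nu_part.
Proof. by move=> a p p'; rewrite /nu_part !linearP. Qed.
HB.instance Definition _ := GRing.isLinear.Build R _ _ _ nu_part nu_part_linear.

(** Its critical points in (y, nu) are the solutions of the equations of the
    lower-level KKT system with active set A. *)
Definition LagrA (p : 'rV[R]_(n + (m + #|A|))) : R :=
  joint gi (xy_part p) - \sum_a nu_part p 0 a * va a (y_part p).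

Definition pt x y nu : 'rV[R]_(n + (m + #|A|)) := row_mx x (row_mx y nu).

Lemma LagrAE x y nu : LagrA (pt x y nu) = gi x y - \sum_a nu 0 a * va a y.
Proof.
by rewrite /LagrA /joint /xy_part /y_part /nu_part /pt !(row_mxKl, row_mxKr).
Qed.

Lemma LagrA_C3 : Ck 3 LagrA.
Proof.
rewrite (_ : LagrA = fun p => (joint gi \o xy_part) p +
    \sum_a -1 * (nu_part p 0 a * va a (y_part p))).
  apply: CkD; first exact: Ck_comp_linear.
  apply: Ck_sum => a; apply: (CkM (Ck_cst 3 _ (-1))).
  apply: CkM; last by apply: (@Ck_comp_linear _ 3 _ _ y_part (va a)); exact: vC3.
  by apply: (@Ck_comp_linear _ 3 _ _ nu_part (fun u => u 0 a)); exact: Ck_coord.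
by apply/funext => p; rewrite /LagrA -mulr_sumr mulN1r.
Qed.

Lemma derive_LagrA_y x y nu d :
  'D_(row_mx 0 (row_mx d 0)) LagrA (pt x y nu) = 'D_d (fun z => LagrA (pt x z nu)) y.
Proof.
symmetry; apply: (@derive_along _ _ _ _ LagrA (fun z => pt x z nu)) => t.
by rewrite /pt !scale_row_mx !add_row_mx !scaler0 !add0r.
Qed.

Lemma derive_affine (U : normedModType R) (h : U -> R) (x u : U) (c : R) :
  (forall t, h (t *: u + x) = t *: c + h x) -> 'D_u h x = c.
Proof.
by move=> H; rewrite (@derive_along _ _ _ _ id h x u c H) derive_id.
Qed.

Lemma derive_LagrA_nu x y nu k :
  'D_(row_mx 0 (row_mx 0 k)) LagrA (pt x y nu) = - \sum_a k 0 a * va a y.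
Proof.
apply: derive_affine => t.
rewrite /pt !scale_row_mx !add_row_mx !scaler0 !add0r !LagrAE.
rewrite addrCA scalerN scaler_sumr -opprD -big_split /=; congr (_ - _).
by apply: eq_bigr => a _; rewrite !mxE mulrDl scalerAl.
Qed.

Lemma row_y_nu d k : row_mx (0 : 'rV[R]_n) (row_mx d k) =
  row_mx 0 (row_mx d 0) + row_mx 0 (row_mx 0 k).
Proof. by rewrite !add_row_mx !addr0 add0r. Qed.

Lemma wgrad0_LagrA x y nu :
  (forall d, 'D_d (fun z => LagrA (pt x z nu)) y = 0) -> (forall a, va a y = 0) ->
  wgrad0 LagrA x (row_mx y nu).
Proof.
move=> Hy Hv u; rewrite -[u]hsubmxK row_y_nu.
rewrite (deriveD_dir _ _ (Ck_diff _ LagrA_C3)) derive_LagrA_y derive_LagrA_nu Hy.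
by rewrite big1 ?subr0 // => a _; rewrite Hv mulr0.
Qed.

Lemma wgrad0_va x y nu a : wgrad0 LagrA x (row_mx y nu) -> va a y = 0.
Proof.
move=> /(_ (row_mx 0 'e_a)); rewrite derive_LagrA_nu (bigD1 a) //= big1.
  by rewrite !mxE !eqxx mul1r addr0 => /eqP; rewrite oppr_eq0 => /eqP.
by move=> b /negPf ba; rewrite mxE ba andbF mul0r.
Qed.

Lemma LagrA_sliceE x nu :
  (fun z => LagrA (pt x z nu)) = gi x - \sum_a (nu 0 a \*: va a).
Proof. by apply/funext => z; rewrite LagrAE !fctE fct_sumE. Qed.

Lemma LagrA_slice_C3 x nu : Ck 3 (fun z => LagrA (pt x z nu)).
Proof.
rewrite (_ : (fun z => _) = fun z => gi x z + \sum_a (- nu 0 a) * va a z).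
  apply: CkD; first exact: (Ck_joint_r x gC3).
  by apply: Ck_sum => a; exact: (CkM (Ck_cst 3 m (- nu 0 a)) (vC3 _)).
apply/funext => z; rewrite LagrAE -sumrN; congr (_ + _).
by apply: eq_bigr => a _; rewrite mulNr.
Qed.

Lemma derive_LagrA_yE x y nu d :
  'D_d (fun z => LagrA (pt x z nu)) y = 'D_d (gi x) y - \sum_a nu 0 a * 'D_d (va a) y.
Proof.
have dg z : differentiable (gi x) z := Ck_diff z (Ck_joint_r x gC3).
have dv a z : differentiable (va a) z := Ck_diff z (vC3 _).
rewrite LagrA_sliceE.
have dZ a : derivable (nu 0 a \*: va a) y d by apply/derivableZ/diff_derivable/dv.
rewrite deriveB; [|exact/diff_derivable/dg|exact: derivable_sum].
rewrite derive_sum //; congr (_ - _); apply: eq_bigr => a _.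
by rewrite deriveZ //; exact/diff_derivable/dv.
Qed.

Lemma derive_LagrA_nu_y x y nu d k :
  'D_(row_mx 0 (row_mx 0 k)) ('D_(row_mx 0 (row_mx d 0)) LagrA) (pt x y nu) =
  - \sum_a k 0 a * 'D_d (va a) y.
Proof.
have E nu' : 'D_(row_mx 0 (row_mx d 0)) LagrA (pt x y nu') =
   'D_d (gi x) y - \sum_a nu' 0 a * 'D_d (va a) y.
  by rewrite derive_LagrA_y derive_LagrA_yE.
apply: derive_affine => t.
rewrite /pt !scale_row_mx !add_row_mx !scaler0 !add0r !E.
rewrite addrCA scalerN scaler_sumr -opprD -big_split /=; congr (_ - _).
by apply: eq_bigr => a _; rewrite !mxE mulrDl scalerAl.
Qed.

Lemma derive_LagrA_y_nu x y nu d k k' :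
  'D_(row_mx 0 (row_mx d k')) ('D_(row_mx 0 (row_mx 0 k)) LagrA) (pt x y nu) =
  - \sum_a k 0 a * 'D_d (va a) y.
Proof.
have E : 'D_(row_mx 0 (row_mx 0 k)) LagrA = fun p => - \sum_a k 0 a * va a (y_part p).
  apply/funext => p; rewrite -{1}[p]hsubmxK -{1}[rsubmx p]hsubmxK.
  by rewrite -/(pt _ _ _) derive_LagrA_nu.
have dv a z : differentiable (va a) z := Ck_diff z (vC3 _).
have -> : 'D_(row_mx 0 (row_mx 0 k)) LagrA = (- \sum_a (k 0 a \*: va a)) \o y_part.
  by rewrite E; apply/funext => p; rewrite /= !fctE fct_sumE.
rewrite (@derive_along _ _ _ _ (- \sum_a (k 0 a \*: va a)) y_part _ _ d).
  have dZ a : derivable (k 0 a \*: va a) (y_part (pt x y nu)) d.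
    by apply/derivableZ/diff_derivable/dv.
  rewrite deriveN; last exact: derivable_sum.
  rewrite derive_sum // /y_part /pt row_mxKr row_mxKl; congr (- _).
  by apply: eq_bigr => a _; rewrite deriveZ //; exact/diff_derivable/dv.
move=> t; rewrite /y_part /pt scale_row_mx add_row_mx !row_mxKr.
by rewrite scale_row_mx add_row_mx !row_mxKl.
Qed.

(** Pairing the kernel equation with the multiplier directions puts d in the
    critical subspace; pairing it with (d, 0) annihilates the second-order
    form on d, so d = 0; what is left is a linear relation between the active
    gradients. *)
Lemma LagrA_hess_inj x y nu :
  (forall k, (forall d, \sum_a k 0 a * 'D_d (va a) y = 0) -> k = 0) ->
  (forall d, d != 0 -> (forall a, 'D_d (va a) y = 0) ->
    'D_(row_mx 0 (row_mx d 0)) ('D_(row_mx 0 (row_mx d 0)) LagrA) (pt x y nu) < 0) ->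
  forall u : 'rV[R]_(m + #|A|), (forall w : 'rV[R]_(m + #|A|),
     'D_(row_mx 0 u) ('D_(row_mx 0 w) LagrA) (pt x y nu) = 0) -> u = 0.
Proof.
move=> licq sosc u; rewrite -[u]hsubmxK; set d := lsubmx u; set k := rsubmx u => H.
have dv0 a : 'D_d (va a) y = 0.
  have := H (row_mx 0 'e_a); rewrite derive_LagrA_y_nu (bigD1 a) //= big1.
    by rewrite !mxE !eqxx mul1r addr0 => /eqP; rewrite oppr_eq0 => /eqP.
  by move=> b /negPf ba; rewrite mxE ba andbF mul0r.
have H2 d' : 'D_(row_mx 0 (row_mx d 0)) ('D_(row_mx 0 (row_mx d' 0)) LagrA) (pt x y nu)
    - \sum_a k 0 a * 'D_d' (va a) y = 0.
  rewrite -(derive_LagrA_nu_y x y nu) -(deriveD_dir _ _ (Ck_diff _ (Ck_derive _ LagrA_C3))).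
  by rewrite -row_y_nu.
have d0 : d = 0.
  apply/eqP; apply: contraT => dn0; have := sosc d dn0 dv0.
  have := H2 d; rewrite big1 ?subr0 => [->|a _]; first by rewrite ltxx.
  by rewrite dv0 mulr0.
have -> : k = 0.
  apply: licq => d'; have := H2 d'; rewrite d0 row_mx0 row_mx0.
  by rewrite derive0 sub0r => /eqP; rewrite oppr_eq0 => /eqP.
by rewrite d0 row_mx0.
Qed.

End ActiveLagrangian.

(** * Quadratic growth of the lower-level problem *)

(** The penalty of Finsler's lemma is paid for by the slack of the multiplier
    term: w stands for a constraint value, nu for its multiplier and D for the
    derivative of the constraint. *)
Fact growth_arith (R : realFieldType) (rho w nu D E : R) : 0 <= rho ->
  D ^+ 2 <= 2 * w ^+ 2 + 2 * E -> nu * w + rho * w ^+ 2 <= 0 ->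
  2^-1 * (rho * D ^+ 2) + nu * w <= rho * E.
Proof. by move=> r0 /(ler_wpM2l r0); lra. Qed.

Section Growth.
Context {R : realType} {n m : nat} {J : finType}.
Variables (gi : 'rV[R]_n -> 'rV[R]_m -> R) (v : J -> 'rV[R]_m -> R) (A : {set J}).
Hypotheses (gC3 : Ck 3 (joint gi)) (vC3 : forall j, Ck 3 (v j)).
Variables (xs : 'rV[R]_n) (ys : 'rV[R]_m) (nus : 'rV[R]_#|A|).
Hypothesis va_ys : forall a : 'I_#|A|, va v a ys = 0.
Hypothesis nus_gt0 : forall a, 0 < nus 0 a.
Local Notation LL := (LagrA gi v (A := A)).
Hypothesis sosc : forall d, d != 0 -> (forall a : 'I_#|A|, 'D_d (va v a) ys = 0) ->
  'D_(row_mx 0 (row_mx d 0)) ('D_(row_mx 0 (row_mx d 0)) LL) (pt xs ys nus) < 0.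

(** The second-order condition only speaks of critical directions; Finsler's
    lemma extends it to all directions at the price of a penalty on the
    derivatives of the active constraints. *)
Lemma critical_cone_bound : exists c rho, [/\ 0 < c, 0 < rho & forall d,
  'D_(row_mx 0 (row_mx d 0)) ('D_(row_mx 0 (row_mx d 0)) LL) (pt xs ys nus)
    <= - c * `|d| ^+ 2 + rho * \sum_(a < #|A|) ('D_d (va v a) ys) ^+ 2].
Proof.
have C3 : Ck 3 LL := LagrA_C3 A gC3 vC3.
have dv (a : 'I_#|A|) : differentiable (va v a) ys := Ck_diff ys (vC3 _).
have in_lin s d : row_mx (0 : 'rV[R]_n) (row_mx (s *: d) (0 : 'rV[R]_#|A|)) =
    s *: row_mx 0 (row_mx d 0) by rewrite !scale_row_mx !scaler0.
pose E (d : 'rV[R]_m) := row_mx (0 : 'rV[R]_n) (row_mx d (0 : 'rV[R]_#|A|)).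
have Esum d : E d = \sum_i d 0 i *: E 'e_i.
  rewrite {1}[d]row_sum_delta /E.
  elim/big_rec2 : _ => [|i u w _ <-]; first by rewrite !row_mx0.
  by rewrite -in_lin !add_row_mx !addr0.
have dLL i p : differentiable ('D_(E 'e_i) LL) p := Ck_diff p (Ck_derive _ C3).
have DE d : 'D_(E d) LL = \sum_i (d 0 i \*: 'D_(E 'e_i) LL).
  apply/funext => p; rewrite (deriveE _ (Ck_diff p C3)) Esum linear_sum fct_sumE.
  by apply: eq_bigr => i _; rewrite linearZ -(deriveE _ (Ck_diff p C3)).
have QE d : 'D_(E d) ('D_(E d) LL) (pt xs ys nus) =
    \sum_i d 0 i * \sum_j d 0 j * 'D_(E 'e_j) ('D_(E 'e_i) LL) (pt xs ys nus).
  rewrite (DE d) derive_sum => [|i]; last exact/derivableZ/diff_derivable/dLL.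
  apply: eq_bigr => i _; rewrite deriveZ; last exact/diff_derivable/dLL.
  congr (_ * _); rewrite (deriveE _ (dLL i _)) (Esum d) linear_sum.
  by apply: eq_bigr => j _; rewrite linearZ -(deriveE _ (dLL i _)).
have QE' d : 'D_(row_mx 0 (row_mx d 0)) ('D_(row_mx 0 (row_mx d 0)) LL) (pt xs ys nus) =
    \sum_i d 0 i * \sum_j d 0 j * 'D_(E 'e_j) ('D_(E 'e_i) LL) (pt xs ys nus) := QE d.
have cc c : @Ck R 0 m (cst c) := @Ck_cst R 0 m c.
apply: finsler.
- rewrite (_ : (fun d : 'rV[R]_m => _) = fun d => \sum_i d 0 i * \sum_j d 0 j *
      'D_(E 'e_j) ('D_(E 'e_i) LL) (pt xs ys nus)); last exact/funext.
  apply: (@Ck_continuous _ 0); apply: Ck_sum => i; apply: CkM; first exact: Ck_coord.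
  apply: Ck_sum => j; exact: (CkM (@Ck_coord _ 0 m j) (cc _)).
- rewrite (_ : (fun d : 'rV[R]_m => _) = fun d => \sum_(a < #|A|)
      (\sum_j d 0 j * 'D_('e_j) (va v a) ys) *
      (\sum_j d 0 j * 'D_('e_j) (va v a) ys)); last first.
    apply/funext => d; apply: eq_bigr => a _; rewrite expr2 (derive_sum_coord _ (dv a)).
    by [].
  apply: (@Ck_continuous _ 0); apply: Ck_sum => a; apply: CkM;
  by apply: Ck_sum => j; exact: (CkM (@Ck_coord _ 0 m j) (cc _)).
- move=> s d; rewrite (QE' (s *: d)) (QE' d) mulr_sumr; apply: eq_bigr => i _.
  rewrite mxE mulrA -mulrA -[_ * d 0 i]mulrC !mulr_sumr.
  by apply: eq_bigr => j _; rewrite mxE; ring.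
- move=> s d; rewrite mulr_sumr; apply: eq_bigr => a _.
  by rewrite (deriveZ_dir _ _ (dv a)) exprMn.
- by move=> d; apply: sumr_ge0 => a _; exact: sqr_ge0.
move=> d dn0 /eqP; rewrite psumr_eq0 => [/allP H|a _]; last exact: sqr_ge0.
apply: sosc => // a; apply/eqP; rewrite -sqrf_eq0.
by have := H a; rewrite mem_index_enum => /(_ isT).
Qed.

(** Expand the Lagrangian at eta, where its y-gradient vanishes.  The
    second-order term is bounded by critical_cone_bound; the penalty it
    contains is quadratic in the values of the active constraints up to a
    small multiple of |y - eta|^2, and is dominated by the terms nu_a v_a(y),
    which are linear in these values and nonpositive. *)
Lemma quadratic_growth : exists c r, [/\ 0 < c, 0 < r & forall x y eta nu,
  `|x - xs| < r -> `|y - ys| < r -> `|eta - ys| < r -> `|nu - nus| < r ->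
  wgrad0 LL x (row_mx eta nu) -> (forall a : 'I_#|A|, va v a y <= 0) ->
  gi x y <= gi x eta - c * `|y - eta| ^+ 2].
Proof.
have C3 : Ck 3 LL := LagrA_C3 A gC3 vC3.
have [c [rho [c0 rho0 HQ]]] := critical_cone_bound.
have e0 : 0 < c / 8 by rewrite divr_gt0.
have [r1 r10 H1] := taylor2 (pt xs ys nus) (CkW C3) e0.
pose q := #|A|%:R : R.
(* e' <= 1 and e' <= c / (8 rho (q + 1)) together give rho q e'^2 <= c / 8 *)
pose e' := Num.min 1 (c / (8 * rho * (q + 1))).
have q0 : 0 <= q by rewrite ler0n.
have q1 : 0 < q + 1 by rewrite ltr_wpDl.
have e'0 : 0 < e' by rewrite lt_min ltr01 divr_gt0 // !mulr_gt0.
have e'2 : rho * (q * e' ^+ 2) <= c / 8.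
  have : e' <= 1 by rewrite ge_min lexx.
  have : e' <= c / (8 * rho * (q + 1)) by rewrite ge_min lexx orbT.
  rewrite ler_pdivlMr ?mulr_gt0 // => a1 a2.
  have : q * e' ^+ 2 <= (q + 1) * e'.
    by rewrite expr2 ler_pM // ?mulr_ge0 ?lerDl // ?(ltW e'0) // ler_piMl // ltW.
  move=> /(ler_wpM2l (ltW rho0)) a3; apply: le_trans a3 _.
  have -> : rho * ((q + 1) * e') = e' * (8 * rho * (q + 1)) / 8 by field.
  by rewrite ler_pM2r.
have : \forall r \near 0^'+, forall a : 'I_#|A|,
   (forall y eta, `|y - ys| < r -> `|eta - ys| < r ->
     `|va v a y - va v a eta - 'D_(y - eta) (va v a) ys| <= e' * `|y - eta|) /\
   (forall y nu, `|y - ys| < r -> `|nu - nus| < r -> rho * `|va v a y| <= nu 0 a).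
  apply: filter_forall => a.
  have Ca : Ck 1 (va v a) := CkW (CkW (vC3 _)).
  have [d1 d10 Ha] := strict_derive ys Ca e'0.
  have [C [d2 [C0 d20 Hb]]] := lipschitz_near ys Ca.
  have na0 := nus_gt0 a.
  have d30 : 0 < nus 0 a / (2 * (rho * C + 1)).
    by rewrite divr_gt0 // mulr_gt0 // ltr_wpDl // mulr_ge0 // ltW.
  near=> r; split => [y eta yr er|y nu yr nr].
    by apply: Ha; [apply: lt_le_trans er _|apply: lt_le_trans yr _];
      near: r; exact: nbhs_right_le.
  have r2 : r <= d2 by near: r; exact: nbhs_right_le.
  have r3 : r <= nus 0 a / (2 * (rho * C + 1)) by near: r; exact: nbhs_right_le.
  have : `|va v a y| <= C * `|y - ys|.
    rewrite -[va v a y]subr0 -(va_ys a); apply: Hb; first by rewrite subrr normr0.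
    exact: lt_le_trans r2.
  have : `|nu 0 a - nus 0 a| <= `|nu - nus|.
    by have := coord_le_norm (nu - nus) a; rewrite !mxE.
  rewrite ler_norml => /andP[n1 _] v1.
  have : rho * `|va v a y| <= rho * C * r.
    rewrite -mulrA ler_wpM2l ?(ltW rho0) //; apply: le_trans v1 _.
    by rewrite ler_wpM2l // ltW.
  move: r3; rewrite ler_pdivlMr; last by rewrite mulr_gt0 // ltr_wpDl // mulr_ge0 // ltW.
  lra.
move=> H2; have [r2 [r20 {}H2]] := @filter_ex _ _ (at_right_proper_filter _) _
  (filterI (nbhs_right_gt (0 : R)) H2).
exists (c / 4), (Num.min r1 r2); split; first by rewrite divr_gt0.
  by rewrite lt_min r10.
move=> x y eta nu; rewrite !lt_min.
move=> /andP[x1 x2] /andP[y1 y2] /andP[t1 t2] /andP[n1 n2] G vy.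
have vt (a : 'I_#|A|) : va v a eta = 0 by exact: (wgrad0_va a G).
set u := y - eta.
have := H1 (pt x eta nu) (row_mx 0 (row_mx u 0)).
have -> : pt x eta nu + row_mx 0 (row_mx u 0) = pt x y nu.
  by rewrite /pt !add_row_mx !addr0 /u [eta + _]addrC subrK.
rewrite {1 2}/pt !row_mxB G subr0 !norm_row0 norm_row0r.
have pn z (z1 : `|z - ys| < r1) : `|row_mx (x - xs) (row_mx (z - ys) (nu - nus))| < r1.
  by apply: norm_row_mx_lt => //; apply: norm_row_mx_lt.
move=> /(_ (pn _ t1) (pn _ y1)); rewrite !LagrAE.
rewrite [X in gi x eta - X]big1 ?subr0 => [|a _]; last by rewrite vt mulr0.
have := HQ u; set Q := 'D_ _ _ _; set S2 := \sum_(a < _) _ ^+ 2; set S1 := \sum_a _.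
move=> HQu; rewrite ler_norml => /andP[_ Hup].
have SS : 2^-1 * (rho * S2) + S1 <= rho * (q * e' ^+ 2) * `|u| ^+ 2.
  have -> : rho * (q * e' ^+ 2) * `|u| ^+ 2 = \sum_(a < #|A|) rho * (e' ^+ 2 * `|u| ^+ 2).
    by rewrite sumr_const card_ord -mulr_natl -/q; ring.
  rewrite /S2 /S1 !mulr_sumr -big_split /=; apply: ler_sum => a _.
  have [Ha Hb] := H2 a; have := Ha y eta y2 t2; rewrite vt subr0 -/u.
  have := Hb y nu y2 n2; have := vy a; set w := va v a y; set D := 'D_u _ _.
  move=> w0; rewrite ler0_norm // => nw wD.
  have D2 : D ^+ 2 <= 2 * w ^+ 2 + 2 * (e' ^+ 2 * `|u| ^+ 2).
    have : (w - D) ^+ 2 <= (e' * `|u|) ^+ 2.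
      by rewrite -(real_normK (num_real (w - D))) ler_sqr ?nnegrE // mulr_ge0 // ltW.
    rewrite exprMn; have := sqr_ge0 (2 * w - D); nra.
  have N : nu 0 a * w + rho * w ^+ 2 <= 0.
    have -> : nu 0 a * w + rho * w ^+ 2 = (nu 0 a - rho * - w) * w by ring.
    by rewrite mulr_ge0_le0 // subr_ge0.
  exact: (growth_arith (ltW rho0) D2 N).
have : rho * (q * e' ^+ 2) * `|u| ^+ 2 <= c / 8 * `|u| ^+ 2.
  by rewrite ler_wpM2r // exprn_ge0.
lra.
Unshelve. all: by end_near. Qed.

End Growth.

(** * Lower-level solutions and multipliers near the limit *)

Section LocalData.
Context {R : realType} {n m : nat} {J : finType}.
Implicit Types (gi : 'rV[R]_n -> 'rV[R]_m -> R) (v : J -> 'rV[R]_m -> R).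

Definition active v (y : 'rV[R]_m) : {set J} := [set j | v j y == 0].

Lemma LICQ_free v (y : 'rV[R]_m) : LICQ v y ->
  forall k : 'rV[R]_#|active v y|,
    \sum_a k 0 a *: grad (va v a) y = 0 -> k = 0.
Proof.
rewrite /LICQ => fr k k0.
pose X := map_tuple (fun j => grad (v j) y) (enum_tuple (active v y)).
have : free X.
  move: fr; congr (is_true (free _)); rewrite /= /enum_tuple /=.
  congr map; rewrite /enum_mem -filter_predI; apply: eq_filter => j.
  by rewrite /= [RHS]inE andbT.
move=> frX; have k00 : \sum_(a < #|active v y|) k 0 a *: X`_a = 0.
  rewrite -[RHS]k0; apply: eq_bigr => b _; congr (_ *: _).
  by rewrite -(tnth_nth 0 X b) tnth_map /va (tnth_nth (enum_val b)) /= -enum_val_nth.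
by apply/rowP => a; rewrite mxE; exact: (freeP frX (fun a => k 0 a) k00 a).
Qed.

Lemma derive_grad p (h : 'rV[R]_p -> R) x u : differentiable h x ->
  'D_u h x = dot (grad h x) u.
Proof.
move=> dh; rewrite derive_sum_coord // /dot mxE; apply: eq_bigr => j _.
by rewrite !mxE mulrC.
Qed.

Lemma licq_derive v (y : 'rV[R]_m) : (forall j, Ck 3 (v j)) -> LICQ v y ->
  forall k : 'rV[R]_#|active v y|,
    (forall d, \sum_a k 0 a * 'D_d (va v a) y = 0) -> k = 0.
Proof.
move=> vC3 L k H; apply: (LICQ_free L); apply/rowP => j.
rewrite summxE [RHS]mxE -[RHS](H 'e_j); apply: eq_bigr => a _.
by rewrite !mxE.
Qed.

(** The matrix of active gradients has a right inverse. *)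
Lemma licq_bound v (y : 'rV[R]_m) : LICQ v y ->
  exists2 K, 0 <= K & forall (k : 'rV[R]_#|active v y|) t, 0 <= t ->
    (forall i, `|\sum_a k 0 a * 'D_('e_i) (va v a) y| <= t) -> `|k| <= K * t.
Proof.
move=> L; pose G := \matrix_(a < #|active v y|, i < m) 'D_('e_i) (va v a) y.
have kG (k : 'rV[R]_#|active v y|) i :
    (k *m G) 0 i = \sum_a k 0 a * 'D_('e_i) (va v a) y.
  by rewrite mxE; apply: eq_bigr => a _; rewrite mxE.
have /row_freeP [B GB] : row_free G.
  apply: inj_row_free => k k0; apply: (LICQ_free L); apply/rowP => i.
  rewrite summxE [RHS]mxE.
  have := kG k i; rewrite k0 mxE => E; rewrite [RHS]E; apply: eq_bigr => a _.
  by rewrite !mxE.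
have [K K0 HK] := norm_mulmx_le B.
exists K => // k t t0 H; rewrite -[k]mulmx1 -GB mulmxA.
apply: le_trans (HK _) _; rewrite ler_wpM2l //.
by apply: norm_le_coord => // i; rewrite kG.
Qed.

Lemma nbhs_norm_lt (T : normedModType R) (a : T) (d : R) : 0 < d ->
  nbhs a [set z | `|z - a| < d].
Proof.
move=> d0; have : \forall z \near a, `|z - a| < d; last exact.
by apply/nbhs_normP; exists d => // z; rewrite /= distrC.
Qed.

(** On the compact part of Y outside a ball around ys, g(xs, .) is below its
    maximum 0; this strict inequality persists for x near xs.  The two
    alternatives cover the active cuts and the maximisers. *)
Lemma solutions_near gi v xs ys : compact (Yset v) -> Ck 0 (joint gi) ->
  gi xs ys = 0 -> lower_sol gi v xs ys ->
  (forall z, lower_sol gi v xs z -> z = ys) ->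
  forall r, 0 < r -> exists2 d, 0 < d & forall x, `|x - xs| < d ->
    forall y, Yset v y -> (0 <= gi x y) \/ (gi x ys <= gi x y) -> `|y - ys| < r.
Proof.
move=> Yc gc g0 [Yys ysmax] uniq r r0.
pose K := [set y | Yset v y /\ r <= `|y - ys|].
have Kc : compact K.
  rewrite (_ : K = Yset v `&` ((fun y => `|y - ys|) @^-1` [set t | r <= t])) //.
  have cn : continuous (fun y : 'rV[R]_m => `|y - ys|).
    move=> y; have c1 : {for y, continuous (fun y : 'rV[R]_m => y - ys)}.
      by apply: differentiable_continuous; apply: differentiableD.
    exact: (continuous_comp c1 (@norm_continuous _ _ _)).
  apply: compact_closedI => //; apply: closed_comp => [y _|]; last exact: closed_ge.
  exact: cn.
have gcont (x : 'rV[R]_n) (y : 'rV[R]_m) : forall e : R, 0 < e -> exists2 d, 0 < d & forall x' y',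
    `|x' - x| < d -> `|y' - y| < d -> `|gi x' y' - gi x y| < e.
  move=> e e0; have /cvgrPdist_lt/(_ e e0)/nbhs_normP [d d0 H] := gc (row_mx x y).
  exists d => // x' y' xd yd.
  have HB : ball_ Num.norm (row_mx x y) d (row_mx x' y').
    by rewrite /= distrC row_mxB; exact: norm_row_mx_lt.
  by have := H _ HB; rewrite /= !joint_row distrC.
have : \forall x \near xs, K `<=` (fun y => gi x y < 0 /\ gi x y < gi x ys).
  apply: ((compact_near_coveringP K).1 Kc _ (nbhs xs)
    (fun x y => gi x y < 0 /\ gi x y < gi x ys)) => y [Yy ry].
  have gneg : gi xs y < 0.
    rewrite lt_neqAle -{2}g0 ysmax // andbT; apply/eqP => gy.
    have : y = ys by apply: uniq; split => // z Yz; rewrite gy -g0; exact: ysmax.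
    by move=> E; move: ry; rewrite E subrr normr0 leNgt r0.
  have e0 : 0 < - gi xs y / 2 by rewrite divr_gt0 // oppr_gt0.
  have [d1 d10 H1] := gcont xs y _ e0.
  have [d2 d20 H2] := gcont xs ys _ e0.
  exists ([set y' | `|y' - y| < d1], [set x | `|x - xs| < Num.min d1 d2]) => /=.
    by split; apply: nbhs_norm_lt; rewrite ?lt_min ?d10.
  case=> y' x /= [yd]; rewrite lt_min => /andP[xd1 xd2].
  have := H1 x y' xd1 yd; have := H2 x ys xd2; rewrite subrr normr0 g0 subr0.
  move=> /(_ d20); rewrite !ltr_norml => /andP[a1 _] /andP[_ a2]; split; lra.
move=> /nbhs_normP [d /= d0 H]; exists d => // x xd y Yy.
have Hx : ball_ Num.norm xs d x by rewrite /= distrC.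
case: (ltP `|y - ys| r) => // ry [g1|g1].
  by have [+ _] := H x Hx y (conj Yy ry); rewrite ltNge g1.
by have [_] := H x Hx y (conj Yy ry); rewrite ltNge g1.
Qed.

End LocalData.

Section LocalModel.
Context {R : realType} {n m : nat} {J : finType}.
Variables (gi : 'rV[R]_n -> 'rV[R]_m -> R) (v : J -> 'rV[R]_m -> R).
Hypotheses (gC3 : Ck 3 (joint gi)) (vC3 : forall j, Ck 3 (v j)).
Implicit Types (x : 'rV[R]_n) (y : 'rV[R]_m) (mu : J -> R) (A : {set J}).

Definition rowA A mu : 'rV[R]_#|A| := \row_a mu (enum_val a).

Lemma sum_active A mu (F : J -> R) : (forall j, j \notin A -> mu j = 0) ->
  \sum_j mu j * F j = \sum_(a < #|A|) mu (enum_val a) * F (enum_val a).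
Proof.
move=> mu0; rewrite (bigID (mem A)) /= [X in _ + X]big1 ?addr0 => [|j /mu0 ->].
  by rewrite big_enum_val.
by rewrite mul0r.
Qed.

Lemma Lagr_LagrA A x y mu : (forall j, j \notin A -> mu j = 0) ->
  Lagr gi v x y mu = LagrA gi v (pt x y (rowA A mu)).
Proof.
move=> mu0; rewrite /Lagr LagrAE (sum_active _ mu0); congr (_ - _).
by apply: eq_bigr => a _; rewrite mxE.
Qed.

Lemma KKT_derive A x y mu d : (forall j, j \notin A -> mu j = 0) ->
  lower_KKT gi v x y mu -> 'D_d (fun z => LagrA gi v (pt x z (rowA A mu))) y = 0.
Proof.
move=> mu0 [_ + _ _]; rewrite (_ : (fun z => _) = fun z => LagrA gi v (pt x z (rowA A mu))).
  move=> G; rewrite derive_grad ?G; last exact: (Ck_diff y (LagrA_slice_C3 gC3 vC3 _ _)).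
  by rewrite /dot mul0mx mxE.
by apply/funext => z; exact: Lagr_LagrA.
Qed.

Lemma KKT_wgrad0 A x y mu : (forall j, j \notin A -> mu j = 0) ->
  (forall j, j \in A -> v j y = 0) -> lower_KKT gi v x y mu ->
  wgrad0 (LagrA gi v (A := A)) x (row_mx y (rowA A mu)).
Proof.
move=> mu0 vA K; apply: (wgrad0_LagrA gC3 vC3) => [d|a]; first exact: KKT_derive.
by apply: vA; exact: enum_valP.
Qed.

(** The positive multipliers are exactly those indexed by A, so that the
    critical subspace is the kernel of the gradients of these constraints. *)
Lemma SOSC_LagrA A x y mu : (forall j, j \notin A -> mu j = 0) ->
  (forall j, j \in A -> 0 < mu j) -> SOSC gi v x y mu ->
  forall d, d != 0 -> (forall a : 'I_#|A|, 'D_d (va v a) y = 0) ->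
  'D_(row_mx 0 (row_mx d 0)) ('D_(row_mx 0 (row_mx d 0)) (LagrA gi v (A := A)))
    (pt x y (rowA A mu)) < 0.
Proof.
move=> mu0 muA S d dn0 dv.
pose h z := LagrA gi v (pt x z (rowA A mu)).
have Ch : Ck 3 h := LagrA_slice_C3 gC3 vC3 _ _.
have hE : (fun z => Lagr gi v x z mu) = h by apply/funext => z; exact: Lagr_LagrA.
have := S d dn0; rewrite hE => {}S.
have -> : 'D_(row_mx 0 (row_mx d 0)) ('D_(row_mx 0 (row_mx d 0)) (LagrA gi v (A := A)))
    (pt x y (rowA A mu)) = 'D_d ('D_d h) y.
  rewrite (_ : 'D_d h = 'D_(row_mx 0 (row_mx d 0)) (LagrA gi v (A := A)) \o
      (fun z => pt x z (rowA A mu))).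
    symmetry; apply: derive_along => t.
    by rewrite /pt !scale_row_mx !add_row_mx !scaler0 !add0r.
  by apply/funext => z; rewrite /= derive_LagrA_y.
have -> : 'D_d ('D_d h) y = dot (d *m hess h y) d.
  rewrite (derive2_sum_coord y d d (CkW Ch)) /dot mxE; apply: eq_bigr => i _.
  rewrite !mxE mulrC; congr (_ * _).
  rewrite (derive_sum_coord _ (Ck_diff y (Ck_derive 'e_i Ch))).
  by apply: eq_bigr => k _; rewrite mxE.
apply: S => j muj.
have jA : j \in A by apply: contraT => /mu0 m0; rewrite m0 ltxx in muj.
rewrite -derive_grad; last exact: (Ck_diff y (vC3 j)).
by have := dv (enum_rank_in jA j); rewrite /va enum_rankK_in.
Qed.

Lemma derive_joint_r x y d : 'D_d (gi x) y = 'D_(row_mx 0 d) (joint gi) (row_mx x y).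
Proof.
symmetry.
rewrite -(@derive_along _ _ _ _ (joint gi) (row_mx x) y d (row_mx 0 d)) => [|t].
  by congr ('D_d _ y); apply/funext => z; rewrite /= joint_row.
by rewrite scale_row_mx add_row_mx scaler0 add0r.
Qed.

Lemma derive_joint_l x y u : 'D_u (gi ^~ y) x = 'D_(row_mx u 0) (joint gi) (row_mx x y).
Proof.
symmetry.
rewrite -(@derive_along _ _ _ _ (joint gi) (fun x => row_mx x y) x u (row_mx u 0)) => [|t].
  by congr ('D_u _ x); apply/funext => z; rewrite /= joint_row.
by rewrite scale_row_mx add_row_mx scaler0 add0r.
Qed.

Lemma derive_LagrA_x A x y nu u :
  'D_(row_mx u 0) (LagrA gi v (A := A)) (row_mx x (row_mx y nu)) = 'D_u (gi ^~ y) x.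
Proof.
rewrite -(@derive_along _ _ _ _ (LagrA gi v (A := A)) (fun x => pt x y nu) x u (row_mx u 0)).
  rewrite (_ : _ \o _ = fun x => gi x y + - \sum_a nu 0 a * va v a y); first exact: derive_addc.
  by apply/funext => z; rewrite /= LagrAE.
by move=> t; rewrite /pt !scale_row_mx !add_row_mx !scaler0 !add0r.
Qed.

Section AtSolution.
Variables (xs : 'rV[R]_n) (ys : 'rV[R]_m) (mus : J -> R).
Local Notation A := (active v ys).
Hypotheses (licq : LICQ v ys) (kkts : lower_KKT gi v xs ys mus).

Lemma inactive_mult j : j \notin A -> mus j = 0.
Proof.
rewrite inE => vj; have [_ _ _ /(_ j)/eqP] := kkts.
by rewrite mulf_eq0 (negPf vj) orbF => /eqP.
Qed.

(** Off the active set complementarity kills the multipliers.  On it, the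
    difference of the two stationarity equations bounds a combination of the
    active gradients at ys with coefficients nu - nus, and LICQ turns this
    into a bound of the coefficients. *)
Lemma multipliers_near (e : R) : 0 < e -> exists2 d, 0 < d & forall x y mu,
  `|x - xs| < d -> `|y - ys| < d -> lower_KKT gi v x y mu ->
  (forall j, j \notin A -> v j y < 0 /\ mu j = 0) /\
  `|rowA A mu - rowA A mus| < e.
Proof.
move=> e0; have [Yys _ _ _] := kkts.
have [K K0 HK] := licq_bound licq.
pose q := #|A|%:R : R; have q0 : 0 <= q by rewrite ler0n.
pose N := `|rowA A mus|; have N0 : 0 <= N := normr_ge0 _.
(* the first bound absorbs the contribution of nu - nus, the second makes the
   rest smaller than e *)
pose e1 := Num.min (2 * (K * q + 1))^-1 (e / (4 * (K * (q * N + 1) + 1))).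
have p1 : 0 < 2 * (K * q + 1) by rewrite mulr_gt0 // ltr_wpDl // mulr_ge0.
have p2 : 0 < 4 * (K * (q * N + 1) + 1).
  by rewrite mulr_gt0 // ltr_wpDl // !mulr_ge0 // addr_ge0 // mulr_ge0.
have e10 : 0 < e1 by rewrite lt_min invr_gt0 p1 divr_gt0.
have [d1 d10 H1] := derive_near (row_mx xs ys) (CkW (CkW gC3)) e10.
have : \forall d \near 0^'+,
    (forall a : 'I_#|A|, forall y u, `|y - ys| < d ->
      `|'D_u (va v a) y - 'D_u (va v a) ys| <= e1 * `|u|)
    /\ (forall j, j \notin A -> forall y, `|y - ys| < d -> v j y < 0).
  apply: filterS2 (_ : \forall d \near 0^'+, forall a : 'I_#|A|, forall y u,
    `|y - ys| < d -> `|'D_u (va v a) y - 'D_u (va v a) ys| <= e1 * `|u|) (_ : \forall d \near 0^'+,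
    forall j, j \notin A -> forall y, `|y - ys| < d -> v j y < 0) => [//||].
    apply: filter_forall => a.
    have [d d0 H] := derive_near ys (CkW (CkW (vC3 (enum_val a)))) e10.
    near=> s => y u ysd; apply: H; apply: lt_le_trans ysd _.
    by near: s; exact: nbhs_right_le.
  apply: filter_forall => j; have [jA|jA] := boolP (j \in A); first by near=> s.
  have vj : 0 < - v j ys.
    by rewrite oppr_gt0 lt_neqAle (Yys j) andbT; move: jA; rewrite inE.
  have /cvgrPdist_lt/(_ _ vj)/nbhs_normP [d d0 H] := Ck_continuous (vC3 j) (x := ys).
  near=> s => _ y ysd.
  have : ball_ Num.norm ys d y.
    rewrite /= distrC; apply: lt_le_trans ysd _.
    by near: s; exact: nbhs_right_le.
  by move/H; rewrite /= ltr_norml => /andP[+ _]; lra.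
move=> H2; have [d2 [d20 [Hv Hj]]] := @filter_ex _ _ (at_right_proper_filter _) _
  (filterI (nbhs_right_gt (0 : R)) H2).
exists (Num.min d1 d2); first by rewrite lt_min d10.
move=> x y mu; rewrite !lt_min => /andP[x1 x2] /andP[y1 y2] kkt.
have Hoff j : j \notin A -> v j y < 0 /\ mu j = 0.
  move=> jA; have vj := Hj j jA y y2; split => //.
  have [_ _ _ /(_ j)/eqP] := kkt.
  by rewrite mulf_eq0 (lt_eqF vj) orbF => /eqP.
split => //; set k := _ - _.
have e11 (p : nat) (i : 'I_p) : `|'e_i : 'rV[R]_p| <= 1.
  by apply: norm_le_coord => // j; rewrite mxE; case: (_ && _); rewrite ?normr1 ?normr0.
have Hk : `|k| <= K * (e1 * (q * (`|k| + N) + 1)).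
  apply: HK => [|i].
    by rewrite mulr_ge0 ?(ltW e10) // addr_ge0 // mulr_ge0 // addr_ge0.
  have S1 := KKT_derive 'e_i (fun j jA => (Hoff j jA).2) kkt.
  have S2 := KKT_derive 'e_i inactive_mult kkts.
  move: S1 S2; rewrite !(derive_LagrA_yE gC3 vC3) => /eqP; rewrite subr_eq0 => /eqP S1.
  move=> /eqP; rewrite subr_eq0 => /eqP S2.
  have -> : \sum_a k 0 a * 'D_('e_i) (va v a) ys =
     \sum_a rowA A mu 0 a * ('D_('e_i) (va v a) ys - 'D_('e_i) (va v a) y) +
     ('D_('e_i) (gi x) y - 'D_('e_i) (gi xs) ys).
    rewrite S1 S2 -sumrB -big_split /=; apply: eq_bigr => a _.
    by rewrite !mxE; ring.
  have -> : e1 * (q * (`|k| + N) + 1) = \sum_(a < #|A|) (`|k| + N) * e1 + e1.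
    by rewrite sumr_const card_ord -mulr_natl -/q; ring.
  apply: le_trans (ler_normD _ _) _; apply: lerD.
    apply: le_trans (ler_norm_sum _ _ _) _; apply: ler_sum => a _.
    rewrite normrM ler_pM //.
      apply: le_trans (coord_le_norm _ _) _.
      by rewrite -[rowA A mu](subrK (rowA A mus)); exact: ler_normD.
    rewrite distrC; apply: le_trans (Hv _ _ _ y2) _.
    exact: ler_piMr (ltW e10) (e11 _ _).
  rewrite !derive_joint_r; apply: le_trans (H1 _ _ _) _.
    by rewrite row_mxB norm_row_mx_lt.
  by rewrite norm_row0; exact: ler_piMr (ltW e10) (e11 _ _).
have b1 : e1 * (2 * (K * q + 1)) <= 1.
  by rewrite -ler_pdivlMr // div1r ge_min lexx.
have b2 : e1 * (4 * (K * (q * N + 1) + 1)) <= e.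
  by rewrite -ler_pdivlMr // ge_min lexx orbT.
have k0 : 0 <= `|k| := normr_ge0 _.
have c1 : K * (e1 * q) * `|k| <= 2^-1 * `|k|.
  by rewrite ler_wpM2r //; move: b1 e10; lra.
move: Hk c1 b2 e10 e0; lra.
Unshelve. all: by end_near. Qed.

End AtSolution.
End LocalModel.

(** * The implicit KKT functions of the algorithm *)

Section ImplicitKKT.
Context {R : realType} {n m : nat} {J : finType}.
Variables (gi : 'rV[R]_n -> 'rV[R]_m -> R) (v : J -> 'rV[R]_m -> R).
Hypotheses (gC3 : Ck 3 (joint gi)) (vC3 : forall j, Ck 3 (v j)).
Implicit Types (x : 'rV[R]_n) (y : 'rV[R]_m) (mu : J -> R) (A : {set J}).

Lemma diff_tangent (W : normedModType R) (h : 'rV[R]_n -> W) x u (e : R) :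
  differentiable h x -> 0 < e -> \forall s \near (0 : R),
    `|h (x + s *: u) - h x - s *: 'd h x u| <= e * `|s|.
Proof.
move=> dh e0; have := @diff_derivable _ _ _ h x u dh.
rewrite /derivable => /cvg_ex [l Hl].
have lE : 'd h x u = l by rewrite -deriveE //; apply: cvg_lim.
move: Hl => /cvgrPdist_le /(_ e e0); rewrite near_withinE -lE.
apply: filterS => s H; have [->|s0] := eqVneq s 0.
  by rewrite !scale0r addr0 subrr subr0 normr0 normr0 mulr0.
have := H s0; rewrite /= -(ler_pM2r (_ : 0 < `|s|)) ?normr_gt0 //; apply: le_trans.
rewrite mulrC -normrZ scalerBr scalerA divff // scale1r distrC [s *: u + x]addrC.
exact: lexx.
Qed.

Definition branch_slope A (x0 : 'rV[R]_n) (yf : 'rV[R]_n -> 'rV[R]_m)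
    (muf : J -> 'rV[R]_n -> R) : 'M[R]_(n, m + #|A|) :=
  row_mx (lin1_mx ('d yf x0)) (\matrix_(i, a) 'd (muf (enum_val a)) x0 'e_i).

Definition branch_fun A (yf : 'rV[R]_n -> 'rV[R]_m) (muf : J -> 'rV[R]_n -> R) x :
  'rV[R]_(m + #|A|) := row_mx (yf x) (\row_a muf (enum_val a) x).

Lemma branch_slopeE A x0 yf muf u :
  (forall j, differentiable (muf j) x0) ->
  u *m branch_slope A x0 yf muf =
  row_mx ('d yf x0 u) (\row_a 'd (muf (enum_val a)) x0 u).
Proof.
move=> dmu; rewrite mul_mx_row mul_rV_lin1; congr row_mx; apply/rowP => a.
rewrite !mxE {2}[u]row_sum_delta linear_sum; apply: eq_bigr => i _.
by rewrite mxE linearZ.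
Qed.

Variables (A : {set J}) (x0 : 'rV[R]_n) (y0 : 'rV[R]_m) (mu0 : J -> R)
  (yf : 'rV[R]_n -> 'rV[R]_m) (muf : J -> 'rV[R]_n -> R).
Hypothesis imp : implicit_KKT gi v x0 y0 mu0 yf muf.
Hypothesis mu0_gt0 : forall j, j \in A -> 0 < mu0 j.
Hypothesis v_lt0 : forall j, j \notin A -> v j y0 < 0.

Lemma implicit_diff : differentiable yf x0 /\ forall j, differentiable (muf j) x0.
Proof.
have [_ [dy dmu] _ _] := imp; split; first by have [] := nbhs_singleton dy.
by move=> j; have [] := nbhs_singleton (dmu j).
Qed.

(** Strict complementarity at x0 is an open condition, and complementarity
    along the branch turns it into equations. *)
Lemma implicit_active : \forall x \near x0,
  (forall j, j \in A -> v j (yf x) = 0) /\ (forall j, j \notin A -> muf j x = 0).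
Proof.
have [[yf0 muf0] _ kkt _] := imp; have [dy dmu] := implicit_diff.
have H j : \forall x \near x0, (j \in A -> 0 < muf j x) /\ (j \notin A -> v j (yf x) < 0).
  have [jA|jA] := boolP (j \in A).
    have /cvgrPdist_lt/(_ _ (mu0_gt0 jA)) := differentiable_continuous (dmu j).
    rewrite muf0; apply: filterS => x; rewrite ltr_norml => /andP[_ h].
    by split => // _; lra.
  have vj : 0 < - v j y0 by rewrite oppr_gt0 v_lt0.
  have cv : {for x0, continuous (v j \o yf)}.
    apply: continuous_comp; first exact: differentiable_continuous.
    exact: (Ck_continuous (vC3 j)).
  move: cv => /cvgrPdist_lt/(_ _ vj) /=.
  rewrite yf0; apply: filterS => x; rewrite ltr_norml => /andP[h _].
  by split => // _; lra.
have := @filter_forall _ _ _ _ (nbhs_filter x0) H.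
apply: filterS2 kkt => x [_ _ mu_ge0 compl] {}H; split => j jA.
  have [/(_ jA) mj _] := H j; have /eqP := compl j.
  by rewrite mulf_eq0 (gt_eqF mj) => /eqP.
have [_ /(_ jA) vj] := H j; have /eqP := compl j.
by rewrite mulf_eq0 (lt_eqF vj) orbF => /eqP.
Qed.

(** The branch stays critical for LagrA because the active set is frozen along
    it. *)
Lemma implicit_is_branch : implicit_branch (LagrA gi v (A := A)) x0
  (row_mx y0 (rowA A mu0)) (branch_fun A yf muf) (branch_slope A x0 yf muf).
Proof.
have [[yf0 muf0] _ kkt _] := imp; have [dy dmu] := implicit_diff.
split.
- rewrite /branch_fun yf0; congr row_mx; apply/rowP => a; by rewrite !mxE muf0.
- move=> u e e0; have Hy := diff_tangent u dy e0.
  have Hmu : \forall s \near (0 : R), forall a : 'I_#|A|,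
    `|muf (enum_val a) (x0 + s *: u) - muf (enum_val a) x0
      - s *: 'd (muf (enum_val a)) x0 u| <= e * `|s|.
    apply: (@filter_forall _ 'I_#|A| (fun a s => `|muf (enum_val a) (x0 + s *: u)
      - muf (enum_val a) x0 - s *: 'd (muf (enum_val a)) x0 u| <= e * `|s|) (nbhs (0 : R))) => a.
    exact: diff_tangent.
  apply: filterS2 Hy Hmu => s Hy Hmu.
  rewrite branch_slopeE // scale_row_mx !row_mxB -yf0.
  apply: norm_row_mx_le => //; apply: norm_le_coord => [|a].
    by rewrite mulr_ge0 // ltW.
  by have := Hmu a; rewrite !mxE muf0.
apply: filterS2 kkt implicit_active => x K [vA mA].
have -> : branch_fun A yf muf x = row_mx (yf x) (rowA A (fun j => muf j x)) by [].
exact: (KKT_wgrad0 gC3 vC3).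
Qed.

(** The multipliers of inactive constraints vanish near x0, and so do their
    linear predictions. *)
Lemma gbar_LagrA x : (forall j, j \notin A -> mu0 j = 0) ->
  gbar gi v x0 y0 mu0 yf muf x =
  LagrA gi v (row_mx x (row_mx y0 (rowA A mu0) + (x - x0) *m branch_slope A x0 yf muf)).
Proof.
move=> mu00; have [dy dmu] := implicit_diff.
have d0 j : j \notin A -> 'd (muf j) x0 (x - x0) = 0.
  move=> jA; rewrite -deriveE // (near_eq_derive _ (g := cst 0)) ?derive_cst //.
  by apply: filterS implicit_active => z [_ ->].
rewrite /gbar (@Lagr_LagrA _ _ _ _ _ _ A) => [|j jA]; last by rewrite mu00 // d0 // addr0.
congr (LagrA gi v _); rewrite branch_slopeE // add_row_mx /pt; congr (row_mx _ (row_mx _ _)).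
by apply/rowP => a; rewrite !mxE.
Qed.

End ImplicitKKT.

(** * Uniform accuracy of the approximate constraints *)

Section LocalModelTheorem.
Context {R : realType} {n m : nat} {J : finType}.
Implicit Types (x z xi : 'rV[R]_n) (y ys eta : 'rV[R]_m) (mu : J -> R).

Lemma nbhs0_right_le (a : R) : 0 < a -> \forall r \near 0^'+, r <= a.
Proof. by move=> a0; near=> r; near: r; exact: nbhs_right_le. Unshelve. all: by end_near. Qed.

Lemma diff_comp_row (q : nat) (LL : 'rV[R]_(n + q) -> R) (w0 : 'rV[R]_q) x0 (M : 'M[R]_(n, q)) z :
  Ck 3 LL -> differentiable (fun x => LL (row_mx x (w0 + (x - x0) *m M))) z.
Proof.
move=> C3; rewrite (_ : (fun x => _) =
    fun x => LL (row_mx 0 (w0 - x0 *m M) + mulmxr (row_mx 1%:M M) x)).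
  exact: (Ck_diff z (Ck_comp_affine _ _ C3)).
apply/funext => x; congr LL.
rewrite /= mul_mx_row mulmx1 add_row_mx add0r; congr row_mx.
by rewrite mulmxBl -!addrA; congr (_ + _); rewrite addrC.
Qed.

(** What one step needs to know about index i at the new iterate z: gb is the
    approximate constraint built at distance h from z, and eta is the
    maximiser of Q_i(z).  The last clause is about the cuts y active at z.
    The two bounds by -1/2 are what remains of EMFCQ in direction xi. *)
Definition model_accurate (gi : 'rV[R]_n -> 'rV[R]_m -> R) (v : J -> 'rV[R]_m -> R)
    xi z (gb : 'rV[R]_n -> R) eta (C h : R) : Prop :=
  [/\ differentiable gb z,
      `|gb z - gi z eta| <= C * h ^+ 4 /\
        (forall u, `|'D_u gb z - 'D_u (gi ^~ eta) z| <= C * `|u| * h ^+ 2),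
      'D_xi gb z <= - 2^-1,
      forall y, Yset v y -> gi z y = gi z eta -> y = eta &
      forall y, Yset v y -> gi z y = 0 ->
        [/\ `|y - eta| ^+ 2 <= C * gi z eta,
            forall u, `|'D_u (gi ^~ y) z - 'D_u (gi ^~ eta) z| <= C * `|u| * `|y - eta|
          & 'D_xi (gi ^~ y) z <= - 2^-1]].

Lemma model_accurateW gi v xi z gb eta (C C' h : R) :
  C <= C' -> 0 <= h -> lower_sol gi v z eta ->
  model_accurate gi v xi z gb eta C h -> model_accurate gi v xi z gb eta C' h.
Proof.
move=> CC h0 [_ max] [dgb [v1 v2] xgb uniq cut]; split => //.
  split; first by apply: le_trans v1 _; rewrite ler_wpM2r // exprn_ge0.
  by move=> u; apply: le_trans (v2 u) _; rewrite ler_wpM2r ?exprn_ge0 // ler_wpM2r.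
move=> y Yy gy; have [c1 c2 c3] := cut y Yy gy; split => //.
  by apply: le_trans c1 _; rewrite ler_wpM2r // -gy max.
by move=> u; apply: le_trans (c2 u) _; rewrite ler_wpM2r // ler_wpM2r.
Qed.

(** All constants and neighbourhoods depend on the limit data only, so that
    one pair (C, d) serves every iteration.  Pairs (x, y) formed from a
    lower-level solution at x near xs, with its multipliers, are first shown
    to have the active set of ys and multipliers near mus; predictor_accuracy
    and quadratic_growth then apply. *)
Lemma local_model (gi : 'rV[R]_n -> 'rV[R]_m -> R) (v : J -> 'rV[R]_m -> R) (xs xi : 'rV[R]_n)
    (ys : 'rV[R]_m) :
  Ck 3 (joint gi) -> (forall j, Ck 3 (v j)) -> compact (Yset v) ->
  gi xs ys = 0 -> lower_sol gi v xs ys ->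
  (forall y, lower_sol gi v xs y -> y = ys) -> regular gi v xs ys ->
  'D_xi (gi ^~ ys) xs <= -1 ->
  exists C d, [/\ 0 <= C, 0 < d & forall x0 z y0 mu0 yf muf eta sig,
    `|x0 - xs| < d -> `|z - xs| < d ->
    lower_sol gi v x0 y0 -> lower_KKT gi v x0 y0 mu0 ->
    implicit_KKT gi v x0 y0 mu0 yf muf ->
    lower_sol gi v z eta -> lower_KKT gi v z eta sig ->
    model_accurate gi v xi z (gbar gi v x0 y0 mu0 yf muf) eta C `|z - x0|].
Proof.
move=> gC3 vC3 Yc g0 sol uniq [licq [mus [kkts sc sosc]]] Dxi.
pose A := active v ys; pose nus := rowA A mus.
have off j : j \notin A -> mus j = 0 by exact: (inactive_mult kkts).
have vs j : j \in A -> v j ys = 0 by rewrite inE => /eqP.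
have on j : j \in A -> 0 < mus j.
  move=> jA; have [_ _ mu_ge0 _] := kkts.
  rewrite lt_def mu_ge0 andbT; have := sc j.
  by rewrite vs // eqxx addbT.
have va0 (a : 'I_#|A|) : va v a ys = 0 by apply: vs; exact: enum_valP.
have nus0 (a : 'I_#|A|) : 0 < nus 0 a by rewrite mxE; apply: on; exact: enum_valP.
have S2 := SOSC_LagrA gC3 vC3 off on sosc.
have inj := LagrA_hess_inj gC3 vC3 (licq_derive vC3 licq) S2.
have [CP [dP [CP0 dP0 HP]]] := predictor_accuracy (LagrA_C3 A gC3 vC3) inj.
have [c [rG [c0 rG0 HG]]] := quadratic_growth gC3 vC3 va0 nus0 S2.
have [Lg [dL [Lg0 dL0 HL]]] := derive_lipschitz_near (row_mx xs ys) (CkW gC3).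
have : \forall e \near 0^'+, [/\ e <= dP, e <= rG & forall a : 'I_#|A|, e <= nus 0 a].
  near=> e; split; [near: e; exact: nbhs0_right_le|near: e; exact: nbhs0_right_le|].
  by near: e; apply: filter_forall => a; exact: nbhs0_right_le.
move=> He; have [e [e0 [eP eG eN]]] := @filter_ex _ _ (at_right_proper_filter _) _
  (filterI (nbhs_right_gt (0 : R)) He).
have [dM dM0 HM] := multipliers_near gC3 vC3 licq kkts e0.
(* r <= k1 changes the derivative in direction xi by at most 1/4; r <= k2 does
   the same for the gradient error of the approximate constraint, as |z - x0|
   < 2 r and r <= 1 *)
pose k1 := (4 * (Lg * `|xi| + 1))^-1; pose k2 := (16 * (CP * `|xi| + 1))^-1.
have p1 : 0 < 4 * (Lg * `|xi| + 1) by rewrite mulr_gt0 // ltr_wpDl // mulr_ge0.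
have p2 : 0 < 16 * (CP * `|xi| + 1) by rewrite mulr_gt0 // ltr_wpDl // mulr_ge0.
have : \forall r \near 0^'+,
    [/\ [/\ r <= dP, r <= rG & r <= dL], r <= dM, r <= k1, r <= k2 & r <= 1].
  near=> r; split; [split| | | |]; near: r; apply: nbhs0_right_le => //;
  by rewrite invr_gt0.
move=> Hr; have [r [r0 [[rP rGr rL] rM rk1 rk2 r1]]] :=
  @filter_ex _ _ (at_right_proper_filter _) _ (filterI (nbhs_right_gt (0 : R)) Hr).
have [dS dS0 HS] := solutions_near Yc (CkW (CkW (CkW gC3))) g0 sol uniq r0.
pose d := Num.min r dS.
have d0 : 0 < d by rewrite lt_min r0.
have dr : d <= r by rewrite ge_min lexx.
have dS' : d <= dS by rewrite ge_min lexx orbT.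
have Yys : Yset v ys by have [] := sol.
have good x y mu : `|x - xs| < d -> lower_sol gi v x y -> lower_KKT gi v x y mu ->
   [/\ `|y - ys| < r, forall j, j \notin A -> v j y < 0 /\ mu j = 0,
       forall j, j \in A -> 0 < mu j /\ v j y = 0, `|rowA A mu - nus| < e &
       wgrad0 (LagrA gi v (A := A)) x (row_mx y (rowA A mu))].
  move=> xd [Yy ymax] kkt.
  have yr : `|y - ys| < r.
    by apply: (HS x (lt_le_trans xd dS')) => //; right; exact: ymax.
  have [Hoff nue] := HM x y mu (lt_le_trans (lt_le_trans xd dr) rM) (lt_le_trans yr rM) kkt.
  have Hon j : j \in A -> 0 < mu j /\ v j y = 0.
    move=> jA; have mj : 0 < mu j.
      have := le_lt_trans (coord_le_norm _ (enum_rank_in jA j)) nue.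
      have := eN (enum_rank_in jA j).
      rewrite !mxE enum_rankK_in // ltr_norml => h /andP[+ _]; lra.
    split => //; have [_ _ _ /(_ j)/eqP] := kkt.
    by rewrite mulf_eq0 (gt_eqF mj) => /eqP.
  split => //; apply: (KKT_wgrad0 gC3 vC3) => // j jA.
    by have [] := Hoff j jA.
  by have [] := Hon j jA.
have Dxi_near x y : `|x - xs| < d -> `|y - ys| < r -> 'D_xi (gi ^~ y) x <= - (3 / 4).
  move=> xd yr; have := HL (row_mx xs ys) (row_mx x y) (row_mx xi 0).
  rewrite subrr normr0 row_mxB norm_row0r => /(_ dL0) H.
  have xr : `|x - xs| < r by exact: lt_le_trans dr.
  have B := ltW (norm_row_mx_lt xr yr).
  have {}H := H (norm_row_mx_lt (lt_le_trans xr rL) (lt_le_trans yr rL)).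
  have {}H : `|'D_xi (gi ^~ y) x - 'D_xi (gi ^~ ys) xs| <= Lg * `|xi| * r.
    rewrite !derive_joint_l; apply: le_trans H _.
    by rewrite ler_wpM2l // mulr_ge0.
  have : r * (4 * (Lg * `|xi| + 1)) <= 1 by rewrite -ler_pdivlMr // div1r.
  move: H; rewrite ler_norml => /andP[_ h]; lra.
exists (CP + Lg + c^-1), d; split => //.
  by rewrite !addr_ge0 // invr_ge0 ltW.
move=> x0 z y0 mu0 yf muf eta sig x0d zd sol0 kkt0 imp solz kktz.
pose gb := gbar gi v x0 y0 mu0 yf muf; rewrite -/gb.
have [y0r off0 on0 nu0e G0] := good _ _ _ x0d sol0 kkt0.
have [er offz onz nuze Gz] := good _ _ _ zd solz kktz.
have Br := implicit_is_branch gC3 vC3 imp (fun j jA => (on0 j jA).1) (fun j jA => (off0 j jA).1).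
have gbE : gb = fun x => LagrA gi v (row_mx x (row_mx y0 (rowA A mu0) +
    (x - x0) *m branch_slope A x0 yf muf)).
  apply/funext => x; apply: gbar_LagrA => //.
  - by move=> j jA; have [] := on0 j jA.
  - by move=> j jA; have [] := off0 j jA.
  by move=> j jA; have [] := off0 j jA.
have wd y mu : `|y - ys| < r -> `|rowA A mu - nus| < e ->
    `|row_mx y (rowA A mu) - row_mx ys nus| < dP.
  move=> a b; rewrite row_mxB; apply: norm_row_mx_lt.
    exact: lt_le_trans rP.
  exact: lt_le_trans eP.
have := HP x0 z _ _ _ _ (lt_le_trans (lt_le_trans x0d dr) rP) (lt_le_trans (lt_le_trans zd dr) rP)
  (wd _ _ y0r nu0e) (wd _ _ er nuze) Br Gz.
have gbz : gb z = LagrA gi v (row_mx z (row_mx y0 (rowA A mu0) +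
    (z - x0) *m branch_slope A x0 yf muf)) by rewrite gbE.
rewrite /= -gbz -gbE => -[P1 P2].
have LAz : LagrA gi v (row_mx z (row_mx eta (rowA A sig))) = gi z eta.
  rewrite -/(pt _ _ _) LagrAE big1 ?subr0 // => a _.
  by have [_] := onz _ (enum_valP a); rewrite /va => ->; rewrite mulr0.
rewrite LAz in P1.
have {}P2 u : `|'D_u gb z - 'D_u (gi ^~ eta) z| <= CP * `|u| * `|z - x0| ^+ 2.
  by have := P2 u; rewrite derive_LagrA_x.
have C1 : CP <= CP + Lg + c^-1 by rewrite -addrA lerDl addr_ge0 // invr_ge0 ltW.
have C2 : Lg <= CP + Lg + c^-1 by rewrite addrAC lerDr addr_ge0 // invr_ge0 ltW.
have C3 : c^-1 <= CP + Lg + c^-1 by rewrite lerDr addr_ge0.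
have etar : `|eta - ys| < rG by exact: lt_le_trans rGr.
have zr : `|z - xs| < rG by apply: lt_le_trans rGr; exact: lt_le_trans dr.
have nur : `|rowA A sig - nus| < rG by exact: lt_le_trans eG.
have grow y : Yset v y -> `|y - ys| < r -> gi z y <= gi z eta - c * `|y - eta| ^+ 2.
  move=> Yy yr; apply: (HG z y eta _ zr _ etar nur Gz); first exact: lt_le_trans rGr.
  by move=> a; exact: Yy.
split.
- by rewrite gbE; apply: diff_comp_row; exact: LagrA_C3.
- split; first by apply: le_trans P1 _; rewrite ler_wpM2r // exprn_ge0.
  move=> u; apply: le_trans (P2 u) _; rewrite -2!mulrA; apply: ler_wpM2r C1.
  by rewrite mulr_ge0 // exprn_ge0.
- have h : `|z - x0| < 2 * r.
    have := ler_normB (z - xs) (x0 - xs); rewrite opprB addrA subrK.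
    by have := lt_le_trans zd dr; have := lt_le_trans x0d dr; lra.
  have h2 : `|z - x0| ^+ 2 <= 4 * r.
    apply: (@le_trans _ _ ((2 * r) ^+ 2)).
      by rewrite ler_sqr ?nnegrE ?mulr_ge0 // ltW.
    rewrite exprMn (_ : (2 : R) ^+ 2 = 4); last by ring.
    by rewrite ler_pM2l // expr2 ler_piMl // ltW.
  have : CP * `|xi| * `|z - x0| ^+ 2 <= CP * `|xi| * (4 * r) by rewrite ler_wpM2l // mulr_ge0.
  have : r * (16 * (CP * `|xi| + 1)) <= 1 by rewrite -ler_pdivlMr // div1r.
  have := P2 xi; rewrite ler_norml => /andP[_].
  have := Dxi_near z eta zd er; lra.
- move=> y Yy gy; have yr : `|y - ys| < r.
    apply: (HS z (lt_le_trans zd dS')) => //; right; rewrite gy.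
    by have [_] := solz; exact.
  have := grow y Yy yr; rewrite gy => H.
  have : c * `|y - eta| ^+ 2 <= 0 by lra.
  rewrite pmulr_rle0 // => H2; have : `|y - eta| ^+ 2 == 0 by rewrite eq_le H2 exprn_ge0.
  by rewrite sqrf_eq0 normr_eq0 subr_eq0 => /eqP.
move=> y Yy gy; have yr : `|y - ys| < r.
  by apply: (HS z (lt_le_trans zd dS')) => //; left; rewrite gy.
have gz0 : 0 <= gi z eta by rewrite -gy; have [_] := solz; exact.
split.
- apply: (@le_trans _ _ (c^-1 * gi z eta)); last by rewrite ler_wpM2r.
  by rewrite ler_pdivlMl //; have := grow y Yy yr; rewrite gy; lra.
- move=> u; have := HL (row_mx z eta) (row_mx z y) (row_mx u 0).
  have zL : `|z - xs| < dL by apply: lt_le_trans rL; exact: lt_le_trans dr.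
  rewrite !row_mxB subrr norm_row0r norm_row0 !derive_joint_l.
  move=> /(_ (norm_row_mx_lt zL (lt_le_trans er rL)) (norm_row_mx_lt zL (lt_le_trans yr rL))) H.
  by apply: le_trans H _; rewrite -2!mulrA; apply: ler_wpM2r C2; rewrite mulr_ge0.
by have := Dxi_near z y zd yr; lra.
Unshelve. all: by end_near. Qed.

End LocalModelTheorem.

(** * Small quadratic perturbations *)

Section Quadratic.
Context {R : realType} {n : nat}.
Implicit Types (A : 'M[R]_n) (c e h u w x : 'rV[R]_n).

Definition bform A e h : R := \sum_i \sum_j A i j * (e 0 i * h 0 j).
Definition quad A c x : R := bform A (x - c) (x - c).

Lemma bform_bound A e h k : 0 <= k -> (forall i j, `|A i j| <= k) ->
  `|bform A e h| <= n%:R ^+ 2 * k * `|e| * `|h|.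
Proof.
move=> k0 Ak; have -> : n%:R ^+ 2 * k * `|e| * `|h| =
    \sum_(i < n) \sum_(j < n) k * (`|e| * `|h|).
  rewrite !(sumr_const, card_ord) -[RHS]mulr_natl -[X in _ = _ * X]mulr_natl.
  by ring.
apply: le_trans (ler_norm_sum _ _ _) _; apply: ler_sum => i _.
apply: le_trans (ler_norm_sum _ _ _) _; apply: ler_sum => j _.
by rewrite normrM normrM !ler_pM ?mulr_ge0 ?coord_le_norm.
Qed.

Lemma Ck_quad k A c : Ck k (quad A c).
Proof.
have Cl i : Ck k (fun x : 'rV[R]_n => (x - c) 0 i).
  rewrite (_ : (fun x => _) = fun x : 'rV[R]_n => x 0 i + (- c 0 i)).
    by apply: CkD; [exact: Ck_coord|exact: (Ck_cst k n (- c 0 i))].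
  by apply/funext => x; rewrite !mxE.
apply: Ck_sum => i; apply: Ck_sum => j.
apply: (CkM (Ck_cst k n (A i j))); exact: (CkM (Cl i) (Cl j)).
Qed.

Lemma derive_quad A c u x : 'D_u (quad A c) x = bform A (x - c) u + bform A u (x - c).
Proof.
pose l i x : R := (x - c) 0 i.
have Dl i : 'D_u (l i) x = u 0 i.
  by apply: derive_affine => t; rewrite /l !mxE -addrA.
have dl i : derivable (l i) x u.
  apply: diff_derivable; rewrite (_ : l i = fun x : 'rV[R]_n => x 0 i + (- c 0 i)).
    apply: differentiableD; [exact: differentiable_coord|exact: differentiable_cst].
  by apply/funext => y; rewrite /l !mxE.
have -> : quad A c = \sum_i \sum_j (A i j \*: (l i * l j)).
  apply/funext => y; rewrite /quad /bform fct_sumE; apply: eq_bigr => i _.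
  by rewrite fct_sumE; apply: eq_bigr => j _.
have dll i j : derivable (A i j \*: (l i * l j)) x u by apply: derivableZ; exact: derivableM.
rewrite derive_sum => [|i]; last exact: derivable_sum.
rewrite /bform -big_split /=; apply: eq_bigr => i _.
rewrite derive_sum // -big_split /=; apply: eq_bigr => j _.
rewrite deriveZ; last exact: derivableM.
rewrite deriveM // !Dl -mulrDr; congr (_ * _).
by rewrite [l j x *: _]mulrC.
Qed.

Lemma bformDl A e e' h : bform A (e + e') h = bform A e h + bform A e' h.
Proof.
rewrite /bform -big_split /=; apply: eq_bigr => i _; rewrite -big_split /=.
by apply: eq_bigr => j _; rewrite mxE; ring.
Qed.

Lemma bformDr A e h h' : bform A e (h + h') = bform A e h + bform A e h'.
Proof.
rewrite /bform -big_split /=; apply: eq_bigr => i _; rewrite -big_split /=.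
by apply: eq_bigr => j _; rewrite mxE; ring.
Qed.

Lemma bformZl A t e h : bform A (t *: e) h = t * bform A e h.
Proof.
rewrite /bform mulr_sumr; apply: eq_bigr => i _; rewrite mulr_sumr.
by apply: eq_bigr => j _; rewrite mxE; ring.
Qed.

Lemma bformZr A t e h : bform A e (t *: h) = t * bform A e h.
Proof.
rewrite /bform mulr_sumr; apply: eq_bigr => i _; rewrite mulr_sumr.
by apply: eq_bigr => j _; rewrite mxE; ring.
Qed.

Lemma derive2_quad A c u w x : 'D_w ('D_u (quad A c)) x = bform A w u + bform A u w.
Proof.
apply: derive_affine => t; rewrite !derive_quad.
have -> : t *: w + x - c = t *: w + (x - c) by rewrite addrA.
by rewrite (bformDl A (t *: w) (x - c) u) (bformDr A u (t *: w) (x - c))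
  bformZl bformZr [t *: _]mulrDr addrACA.
Qed.

Lemma bform0l A h : bform A 0 h = 0.
Proof. by rewrite -(scale0r 0) bformZl mul0r. Qed.

Lemma bform0r A h : bform A h 0 = 0.
Proof. by rewrite -(scale0r 0) bformZr mul0r. Qed.

Lemma dotE p (a b : 'rV[R]_p) : dot a b = \sum_i a 0 i * b 0 i.
Proof. by rewrite /dot mxE; apply: eq_bigr => i _; rewrite mxE. Qed.

Lemma bform_outer (s t : R) (a b : 'rV[R]_n) e h :
  bform (\matrix_(i, j) (s * (a 0 i * b 0 j) + t * (b 0 i * b 0 j))) e h =
  s * (dot a e * dot b h) + t * (dot b e * dot b h).
Proof.
rewrite !dotE !big_distrlr /= !mulr_sumr -big_split /=; apply: eq_bigr => i _.
rewrite !mulr_sumr -big_split /=; apply: eq_bigr => j _; rewrite mxE; ring.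
Qed.

End Quadratic.

Section EuclideanNorm.
Context {R : realType}.

Lemma enorm_le p q (A : 'M[R]_(p, q)) c : 0 <= c -> (forall i j, `|A i j| <= c) ->
  enorm A <= (p * q)%:R * c.
Proof.
move=> c0 Ac; have pc : 0 <= (p * q)%:R * c by rewrite mulr_ge0.
rewrite -(ger0_norm pc) -sqrtr_sqr /enorm ler_sqrt ?exprn_ge0 //.
apply: (@le_trans _ _ (\sum_(i < p) \sum_(j < q) c ^+ 2)).
  apply: ler_sum => i _; apply: ler_sum => j _.
  by rewrite -(real_normK (num_real (A i j))) ler_sqr ?nnegrE.
rewrite !(sumr_const, card_ord) -[leLHS]mulr_natl
  -[X in _ * X <= _]mulr_natl mulrA -natrM exprMn.
rewrite ler_wpM2r ?exprn_ge0 // -natrX ler_nat.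
by case: (p * q)%N => // k; rewrite leq_pmulr.
Qed.

Lemma norm_le_enorm p (u : 'rV[R]_p) : `|u| <= enorm u.
Proof.
apply: norm_le_coord => [|j]; first exact: sqrtr_ge0.
rewrite -sqrtr_sqr ler_sqrt; last first.
  by apply: sumr_ge0 => i _; apply: sumr_ge0 => k _; exact: sqr_ge0.
rewrite big_ord1 (bigD1 j) //= lerDl.
by apply: sumr_ge0 => k _; exact: sqr_ge0.
Qed.

Lemma enorm_le_norm p (u : 'rV[R]_p) : enorm u <= p%:R * `|u|.
Proof.
by rewrite -[p in p%:R]mul1n; apply: enorm_le => // i j; rewrite ord1 coord_le_norm.
Qed.

Lemma enorm0 p q : enorm (0 : 'M[R]_(p, q)) = 0.
Proof.
rewrite /enorm big1 ?sqrtr0 // => i _; rewrite big1 // => j _.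
by rewrite mxE expr0n.
Qed.

End EuclideanNorm.

Section SmallPerturbation.
Context {R : realType} {n m : nat} {I J : finType}.
Implicit Types (A : 'M[R]_n) (c x : 'rV[R]_n).

(** The composition with l covers at once quadratic forms of x and the same
    forms as functions of (x, y). *)
Lemma quad_comp_bound p (l : {linear 'rV[R]_p -> 'rV[R]_n}) A c k rho z :
  (forall j, `|l 'e_j| <= 1) -> 0 <= k -> (forall i j, `|A i j| <= k) -> `|l z - c| <= rho ->
  [/\ `|quad A c (l z)| <= n%:R ^+ 2 * k * rho ^+ 2,
      enorm (grad (quad A c \o l) z) <= p%:R * (2 * n%:R ^+ 2 * k * rho) &
      enorm (hess (quad A c \o l) z) <= (p * p)%:R * (2 * n%:R ^+ 2 * k)].
Proof.
move=> l1 k0 Ak zr; have r0 : 0 <= rho by apply: le_trans zr.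
have N0 : 0 <= n%:R ^+ 2 * k :> R by rewrite mulr_ge0 // exprn_ge0.
have DE j y : 'D_('e_j) (quad A c \o l) y = 'D_(l 'e_j) (quad A c) (l y).
  by apply: derive_along => t; rewrite linearD linearZ.
have BB e h a b : `|e| <= a -> `|h| <= b -> 
    `|bform A e h| <= n%:R ^+ 2 * k * (a * b).
  move=> ea hb; apply: le_trans (bform_bound _ _ k0 Ak) _.
  by rewrite -mulrA ler_wpM2l // ler_pM.
split.
- by rewrite /quad expr2; exact: BB.
- rewrite -[p in p%:R]mul1n; apply: enorm_le => [|i j].
    by rewrite mulr_ge0 // -mulrA mulr_ge0.
  rewrite mxE DE derive_quad; apply: le_trans (ler_normD _ _) _.
  have := BB _ _ _ _ zr (l1 j); have := BB _ _ _ _ (l1 j) zr.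
  rewrite mulr1 mul1r; lra.
apply: enorm_le => [|i j]; first by rewrite -mulrA mulr_ge0.
rewrite mxE (_ : 'D_('e_j) (quad A c \o l) = 'D_(l 'e_j) (quad A c) \o l); last first.
  by apply/funext => y; rewrite DE.
rewrite (@derive_along _ _ _ _ ('D_(l 'e_j) (quad A c)) l z 'e_i (l 'e_i)) => [|t].
  rewrite derive2_quad; apply: le_trans (ler_normD _ _) _.
  have := BB _ _ _ _ (l1 i) (l1 j); have := BB _ _ _ _ (l1 j) (l1 i).
  rewrite mulr1; lra.
by rewrite linearD linearZ.
Qed.

Lemma norm_delta_le p (j : 'I_p) : `|'e_j : 'rV[R]_p| <= 1.
Proof.
by apply: norm_le_coord => // i; rewrite mxE; case: (_ && _); rewrite ?normr1 ?normr0.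
Qed.

Lemma norm_lsubmx_le (u : 'rV[R]_(n + m)) : `|lsubmx u| <= `|u|.
Proof. by apply: norm_le_coord => // i; rewrite mxE coord_le_norm. Qed.

Lemma quad_small (v : J -> 'rV[R]_m -> R) (delta rho : R) c : 0 < delta -> 0 < rho ->
  exists2 k, 0 < k & forall A (Ai : I -> 'M[R]_n),
    (forall a b, `|A a b| <= k) -> (forall i a b, `|Ai i a b| <= k) ->
    small_pert v delta (eball c rho) (quad A c) (fun i x _ => quad (Ai i) c x).
Proof.
move=> d0 rho0; pose N := n%:R ^+ 2 : R; pose p := (n + m)%N.
pose T := N * rho ^+ 2 + p%:R * (2 * N * rho) + (p * p)%:R * (2 * N).
have N0 : 0 <= N by rewrite exprn_ge0.
have [T1 T2 T3] : [/\ 0 <= N * rho ^+ 2, 0 <= p%:R * (2 * N * rho) & 0 <= (p * p)%:R * (2 * N)].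
  by rewrite !mulr_ge0 // ?exprn_ge0 // ?mulr_ge0 // ltW.
have T0 : 0 <= T by rewrite !addr_ge0.
have [k k0 kT] : exists2 k, 0 < k & T * k <= delta / 2.
  exists (delta / (2 * (T + 1))); first by rewrite divr_gt0 // mulr_gt0 // ltr_wpDl.
  rewrite mulrA ler_pdivrMr ?mulr_gt0 ?ltr_wpDl // (_ : delta / 2 * _ = (T + 1) * delta).
    by rewrite ler_wpM2r ?(ltW d0) // lerDl.
  by field.
have [k0' rho0'] := (ltW k0, ltW rho0).
exists k => // A Ai Ak Aik.
have bound q (l : {linear 'rV[R]_q -> 'rV[R]_n}) (B : 'M[R]_n) z : (q <= p)%N ->
    (forall j, `|l 'e_j| <= 1) -> (forall a b, `|B a b| <= k) -> eball c rho (l z) ->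
    Num.max `|quad B c (l z)| (Num.max (enorm (grad (quad B c \o l) z))
      (enorm (hess (quad B c \o l) z))) <= delta / 2.
  move=> qp l1 Bk zc.
  have zr : `|l z - c| <= rho by apply: le_trans (norm_le_enorm _) (ltW zc).
  have [h1 h2 h3] := quad_comp_bound l1 (ltW k0) Bk zr.
  have qpR : (q%:R : R) <= p%:R by rewrite ler_nat.
  have qqR : ((q * q)%:R : R) <= (p * p)%:R by rewrite ler_nat leq_mul.
  have [K1 K2 K3] : [/\ 0 <= N * rho ^+ 2 * k, 0 <= p%:R * (2 * N * rho) * k
      & 0 <= (p * p)%:R * (2 * N) * k].
    by rewrite !(mulr_ge0 _ (ltW k0)).
  apply: le_trans kT; rewrite !ge_max; apply/and3P; split.
  - by apply: le_trans h1 _; rewrite /T -/N; lra.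
  - apply: le_trans h2 _; apply: (@le_trans _ _ (p%:R * (2 * N * k * rho))).
      apply: ler_wpM2r qpR.
      by rewrite !mulr_ge0.
    by rewrite /T; lra.
  apply: le_trans h3 _; apply: (@le_trans _ _ ((p * p)%:R * (2 * N * k))).
    apply: ler_wpM2r qqR.
      by rewrite !mulr_ge0.
  by rewrite /T; lra.
have jE i : joint (fun x (_ : 'rV[R]_m) => quad (Ai i) c x) = quad (Ai i) c \o lsubmx by [].
split.
- exact: Ck_quad.
- by move=> i; rewrite jE; apply: Ck_comp_linear; exact: Ck_quad.
apply: (@le_lt_trans _ _ (delta / 2)%:E); last first.
  by rewrite lte_fin ltr_pdivrMr // ltr_pMr // ltr1n.
rewrite /pert_norm ge_max; apply/andP; split.
  apply: ge_ereal_sup => _ [x xc <-]; rewrite lee_fin.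
  apply: (bound n idfun A x) => //; first exact: leq_addr.
  by move=> j; exact: norm_delta_le.
apply: bigmax_le => [|i _]; first exact: leNye.
apply: ge_ereal_sup => _ [x xc <-]; apply: ge_ereal_sup => _ [y _ <-]; rewrite lee_fin.
have := bound p lsubmx (Ai i) (row_mx x y) (leqnn _).
rewrite /= row_mxKl; apply => // j.
exact: le_trans (norm_lsubmx_le _) (norm_delta_le _).
Qed.

End SmallPerturbation.

(** * Calmness at a strongly stable stationary point *)

Section Calmness.
Context {R : realType} {n m : nat} {I J : finType}.
Implicit Types (f : 'rV[R]_n -> R) (g : I -> 'rV[R]_n -> 'rV[R]_m -> R).
Implicit Types (v : J -> 'rV[R]_m -> R) (x z : 'rV[R]_n).

(** A term that does not depend on y changes neither the derivatives of the
    Lagrangian in y nor the constraints. *)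
Lemma regular_shift (gi gi' : 'rV[R]_n -> 'rV[R]_m -> R) v x y (c : R) :
  (forall y', gi' x y' = gi x y' + c) -> regular gi v x y -> regular gi' v x y.
Proof.
move=> E [licq [mu [[Yy G mu0 cs] sc so]]].
have LE (nu : J -> R) : (fun z : 'rV[R]_m => Lagr gi' v x z nu) =
    fun z : 'rV[R]_m => Lagr gi v x z nu + c.
  by apply/funext => z; rewrite /Lagr E addrAC.
have DE (nu : J -> R) (d : 'rV[R]_m) : 
    'D_d (fun z : 'rV[R]_m => Lagr gi' v x z nu) =
    'D_d (fun z : 'rV[R]_m => Lagr gi v x z nu).
  by apply/funext => z; rewrite LE derive_addc.
split; first exact: licq.
exists mu; split; [|exact: sc|].
  split; [exact: Yy| |exact: mu0|exact: cs].
  by rewrite -[RHS]G; apply/rowP => j; rewrite mxE [RHS]mxE; have := congr1 (@^~ y) (DE mu 'e_j).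
have hE : hess (fun z : 'rV[R]_m => Lagr gi' v x z mu) y =
    hess (fun z : 'rV[R]_m => Lagr gi v x z mu) y.
  apply/matrixP => i j; rewrite mxE [RHS]mxE.
  by rewrite (DE mu 'e_j).
by move=> d dn0 dv; rewrite hE; exact: so.
Qed.

(** A perturbation q_i of g_i by a function of x leaves the maximisers of the
    lower-level problem unchanged.  Hence the perturbed active set is {sol i}
    or empty, and in the second case sig i = 0. *)
Lemma stationary_perturbed f g v x (ft : 'rV[R]_n -> R) (q : I -> 'rV[R]_n -> R)
    (sol : I -> 'rV[R]_m) (sig : I -> R) :
  differentiable f x -> differentiable ft x ->
  (forall i y, differentiable (g i ^~ y) x) -> (forall i, differentiable (q i) x) ->
  (forall i, Yset v (sol i)) -> (forall i y, Yset v y -> g i x y <= g i x (sol i)) ->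
  (forall i y, Yset v y -> g i x y = g i x (sol i) -> y = sol i) ->
  (forall i, regular (g i) v x (sol i)) ->
  (forall i, 0 <= sig i) -> (forall i, g i x (sol i) + q i x <= 0) ->
  (forall i, sig i * (g i x (sol i) + q i x) = 0) ->
  (forall j, 'D_('e_j) f x + 'D_('e_j) ft x +
     \sum_i sig i * ('D_('e_j) (g i ^~ (sol i)) x + 'D_('e_j) (q i) x) = 0) ->
  stationary (fun x => f x + ft x) (fun i x y => g i x y + q i x) v x.
Proof.
move=> df dft dg dq Ysol max uniq reg sig0 feas compl stat.
have Y0sol i y : Y0 (fun i x y => g i x y + q i x) v i x y ->
    y = sol i /\ g i x (sol i) + q i x = 0.
  move=> [Yy gy]; have gm : g i x y = g i x (sol i).
    by apply/eqP; rewrite eq_le max //=; have := feas i; rewrite -gy; lra.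
  by split; [exact: uniq|rewrite -gm].
split.
- move=> i y Yy; apply: le_trans (feas i); have := max i y Yy; lra.
- move=> i y /Y0sol [-> _].
  by apply: (@regular_shift (g i) _ v x (sol i) (q i x)).
exists (fun i y => sig i); split => //.
apply/rowP => j; rewrite !mxE summxE -[RHS](stat j).
rewrite deriveD; [|exact: diff_derivable|exact: diff_derivable].
congr (_ + _); apply: eq_bigr => i _.
have [g0|gn0] := eqVneq (g i x (sol i) + q i x) 0.
  have -> : Y0 (fun i x y => g i x y + q i x) v i x = [set sol i].
    apply/seteqP; split => [y /Y0sol [-> _] //|y ->].
    by split.
  rewrite fsbig_set1 !mxE deriveD //; exact: diff_derivable.
have -> : Y0 (fun i x y => g i x y + q i x) v i x = set0.
  by apply/seteqP; split => [y /Y0sol [_ /eqP]|//]; rewrite (negPf gn0).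
rewrite fsbig_set0 mxE; have /eqP := compl i.
by rewrite mulf_eq0 (negPf gn0) orbF => /eqP ->; rewrite mul0r.
Qed.

(** To first order at x nothing has changed, so the old multipliers serve. *)
Lemma stationary_perturbed0 f g v x (ft : 'rV[R]_n -> R) (q : I -> 'rV[R]_n -> R) :
  differentiable f x -> differentiable ft x ->
  (forall i y, differentiable (g i ^~ y) x) -> (forall i, differentiable (q i) x) ->
  (forall i, q i x = 0) -> (forall i j, 'D_('e_j) (q i) x = 0) ->
  (forall j, 'D_('e_j) ft x = 0) -> stationary f g v x ->
  stationary (fun x => f x + ft x) (fun i x y => g i x y + q i x) v x.
Proof.
move=> df dft dg dq q0 dq0 dft0 [feas reg [lam [lam0 stat]]].
have Y0E i : Y0 (fun i x y => g i x y + q i x) v i x = Y0 g v i x.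
  by rewrite /Y0 /= q0; apply/seteqP; split => y /=; rewrite addr0.
split.
- by move=> i y Yy; rewrite q0 addr0; exact: feas.
- move=> i y; rewrite Y0E => Y0y.
  exact: (@regular_shift (g i) _ v x y (q i x)) (reg i y Y0y).
exists lam; split => [i y|]; first by rewrite Y0E; exact: lam0.
rewrite -[RHS]stat; congr (_ + _).
  apply/rowP => j; rewrite !mxE deriveD ?dft0 ?addr0 //; exact: diff_derivable.
apply: eq_bigr => i _; rewrite Y0E; apply: eq_fsbigr => y _; congr (_ *: _).
apply/rowP => j; rewrite !mxE deriveD ?dq0 ?addr0 //; exact: diff_derivable.
Qed.

Lemma dot_sq_ge (u : 'rV[R]_n) : `|u| ^+ 2 <= dot u u.
Proof.
have [->|un0] := eqVneq u 0.
  by rewrite normr0 expr0n /= dotE sumr_ge0 // => i _; rewrite -expr2 sqr_ge0.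
have D0 : 0 <= dot u u by rewrite dotE sumr_ge0 // => i _; rewrite -expr2 sqr_ge0.
rewrite -[dot u u]sqr_sqrtr // ler_sqr ?nnegrE ?sqrtr_ge0 //.
apply: norm_le_coord => [|j]; first exact: sqrtr_ge0.
rewrite -sqrtr_sqr ler_sqrt // dotE (bigD1 j) //= -expr2 lerDl.
by apply: sumr_ge0 => i _; rewrite -expr2 sqr_ge0.
Qed.

Lemma dot_norm_le (u w : 'rV[R]_n) : `|dot u w| <= n%:R * (`|u| * `|w|).
Proof.
rewrite dotE; apply: le_trans (ler_norm_sum _ _ _) _.
apply: (@le_trans _ _ (\sum_(i < n) `|u| * `|w|)).
  by apply: ler_sum => i _; rewrite normrM ler_pM ?coord_le_norm.
by rewrite sumr_const card_ord -[leLHS]mulr_natl.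
Qed.

Lemma dot_delta (u : 'rV[R]_n) j : dot u 'e_j = u 0 j.
Proof.
rewrite dotE (bigD1 j) //= big1 ?mxE ?eqxx ?mulr1 ?addr0 // => i /negPf ij.
by rewrite mxE ij andbF mulr0.
Qed.

(** At displacement u, the first term gives the quadratic form a gradient w
    plus a multiple of u, and the second term removes this multiple; see
    derive_tilt. *)
Definition tilt (u w : 'rV[R]_n) : 'M[R]_n :=
  \matrix_(i, j) ((dot u u)^-1 * (w 0 i * u 0 j)
    + - (2^-1 * dot w u * (dot u u)^-2) * (u 0 i * u 0 j)).

(** Its quadratic form takes the value s at displacement u, see quad_bump. *)
Definition bump (u : 'rV[R]_n) (s : R) : 'M[R]_n :=
  \matrix_(i, j) ((s * (dot u u)^-2) * (u 0 i * u 0 j)).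

Lemma bform_tilt u w e h : bform (tilt u w) e h =
  (dot u u)^-1 * (dot w e * dot u h) +
  - (2^-1 * dot w u * (dot u u)^-2) * (dot u e * dot u h).
Proof. exact: bform_outer. Qed.

Lemma bform_bump u s e h : bform (bump u s) e h =
  s * (dot u u)^-2 * (dot u e * dot u h).
Proof.
have := @bform_outer R n 0 (s * (dot u u)^-2) 0 u e h.
rewrite mul0r add0r => <-; rewrite /bform; apply: eq_bigr => i _; apply: eq_bigr => j _.
by rewrite !mxE mul0r add0r.
Qed.

Section AtDisplacement.
Variable u : 'rV[R]_n.
Hypothesis u_neq0 : u != 0.

Let U0 : 0 < `|u|. Proof. by rewrite normr_gt0. Qed.
Let D0 : 0 < dot u u.
Proof. by apply: lt_le_trans (dot_sq_ge u); rewrite exprn_gt0. Qed.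

Lemma invdot_le : (dot u u)^-1 * `|u| ^+ 2 <= 1.
Proof. by rewrite mulrC ler_pdivrMr // mul1r dot_sq_ge. Qed.

Lemma tilt_bound w i j : `|tilt u w i j| <= (1 + n%:R) * (`|w| / `|u|).
Proof.
rewrite mxE; set t := (dot u u)^-1.
have t0 : 0 < t by rewrite invr_gt0.
have tU : t * `|u| ^+ 2 <= 1 := invdot_le.
have wU0 : 0 <= `|w| / `|u| by rewrite divr_ge0.
have tUU : t * (`|w| * `|u|) <= `|w| / `|u|.
  have -> : t * (`|w| * `|u|) = (t * `|u| ^+ 2) * (`|w| / `|u|).
    by field; rewrite gt_eqF.
  by rewrite ler_piMl.
apply: le_trans (ler_normD _ _) _; rewrite mulrDl mul1r; apply: lerD.
  rewrite !normrM (gtr0_norm t0); apply: le_trans tUU.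
  by rewrite ler_pM2l // ler_pM ?coord_le_norm.
rewrite -exprVn -/t normrM normrN [`|_ * t ^+ 2|]normrM [`|2^-1 * _|]normrM.
rewrite [`|u 0 i * _|]normrM [`|2^-1|]ger0_norm ?invr_ge0 //.
have t2 : 0 <= t ^+ 2 by rewrite exprn_ge0 // ltW.
rewrite (ger0_norm t2).
have B1 : `|dot w u| <= n%:R * (`|w| * `|u|) := dot_norm_le w u.
have B2 : `|u 0 i| * `|u 0 j| <= `|u| * `|u| by rewrite ler_pM ?coord_le_norm.
apply: (@le_trans _ _ (n%:R * (`|w| * `|u|) * t ^+ 2 * (`|u| * `|u|))).
  apply: ler_pM => //; first by rewrite (mulr_ge0 _ t2) // mulr_ge0 ?invr_ge0.
  rewrite ler_wpM2r //; apply: le_trans B1; rewrite ler_piMl //.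
  by rewrite invf_le1 // ler1n.
have -> : n%:R * (`|w| * `|u|) * t ^+ 2 * (`|u| * `|u|) =
   n%:R * ((t * (`|w| * `|u|)) * (t * `|u| ^+ 2)) by ring.
rewrite ler_wpM2l //; apply: le_trans tUU; rewrite ler_piMr //.
by rewrite (mulr_ge0 (ltW t0)) // mulr_ge0.
Qed.

Lemma bump_bound s i j : `|bump u s i j| <= `|s| / `|u| ^+ 2.
Proof.
rewrite mxE -exprVn; set t := (dot u u)^-1.
have t0 : 0 < t by rewrite invr_gt0.
have tU : t * `|u| ^+ 2 <= 1 := invdot_le.
rewrite normrM [`|_ * t ^+ 2|]normrM [`|u 0 i * _|]normrM.
have t2 : 0 <= t ^+ 2 by rewrite exprn_ge0 // ltW.
rewrite (ger0_norm t2).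
have B2 : `|u 0 i| * `|u 0 j| <= `|u| * `|u| by rewrite ler_pM ?coord_le_norm.
apply: (@le_trans _ _ (`|s| * t ^+ 2 * (`|u| * `|u|))).
  by rewrite ler_wpM2l // mulr_ge0.
have -> : `|s| * t ^+ 2 * (`|u| * `|u|) =
    (`|s| / `|u| ^+ 2) * (t * `|u| ^+ 2) ^+ 2 by field; rewrite gt_eqF.
rewrite ler_piMr ?divr_ge0 ?exprn_ge0 //.
by rewrite exprn_ile1 // (mulr_ge0 (ltW t0)) // exprn_ge0.
Qed.

Lemma derive_tilt c w j : 'D_('e_j) (quad (tilt u w) c) (u + c) = w 0 j.
Proof.
rewrite derive_quad addrK !bform_tilt !dot_delta.
by field; rewrite gt_eqF.
Qed.

Lemma quad_bump c s : quad (bump u s) c (u + c) = s.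
Proof. by rewrite /quad addrK bform_bump; field; rewrite gt_eqF. Qed.

Lemma derive_bump c s j :
  'D_('e_j) (quad (bump u s) c) (u + c) = 2 * s * (dot u u)^-1 * u 0 j.
Proof.
rewrite derive_quad addrK !bform_bump !dot_delta.
by field; rewrite gt_eqF.
Qed.

Lemma derive_bump_bound c s j :
  `|'D_('e_j) (quad (bump u s) c) (u + c)| <= 2 * (`|s| / `|u|).
Proof.
rewrite derive_bump !normrM (ger0_norm (ler0n _ 2)) [`|_^-1|]gtr0_norm ?invr_gt0 //.
rewrite -!mulrA ler_pM2l // ler_wpM2l //.
apply: (@le_trans _ _ ((dot u u)^-1 * `|u|)).
  by rewrite ler_pM2l ?invr_gt0 // coord_le_norm.
by rewrite -[leRHS]mul1r ler_pdivlMr // -mulrA -expr2 invdot_le.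
Qed.

End AtDisplacement.

(** If z is not xs, bumps make the constraints exact at z, and a tilt cancels
    the remaining gradient.  Their matrices are bounded by a multiple of k,
    because the errors in the constraints are at most k |z - xs|^2 and the
    error in the gradient at most k |z - xs|; for small k the perturbation is
    admissible.  Both z and xs are then stationary for the perturbed problem,
    against uniqueness. *)
Lemma stable_calm f g v xs (Lam : R) :
  Ck 2 f -> (forall i, Ck 3 (joint (g i))) -> strongly_stable f g v xs -> 0 <= Lam ->
  exists k rho, [/\ 0 < k, 0 < rho & forall z (eta : I -> 'rV[R]_m) (sig s : I -> R),
    `|z - xs| < rho ->
    (forall i, Yset v (eta i)) -> (forall i y, Yset v y -> g i z y <= g i z (eta i)) ->
    (forall i y, Yset v y -> g i z y = g i z (eta i) -> y = eta i) ->
    (forall i, regular (g i) v z (eta i)) ->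
    (forall i, 0 <= sig i <= Lam) -> (forall i, g i z (eta i) + s i <= 0) ->
    (forall i, sig i * (g i z (eta i) + s i) = 0) ->
    (forall i, `|s i| <= k * `|z - xs| ^+ 2) ->
    (forall j, `|'D_('e_j) f z + \sum_i sig i * 'D_('e_j) (g i ^~ (eta i)) z|
                 <= k * `|z - xs|) ->
    z = xs].
Proof.
move=> fC gC [stat [es es0 H]] Lam0.
have ees : 0 < es <= es by rewrite es0 lexx.
have [delta delta0 {}H] := H es ees.
have [k0 k00 small] := @quad_small R n m I J v delta es xs delta0 es0.
pose Z := (1 + n%:R) * (1 + 2 * #|I|%:R * Lam).
have Z1 : 1 <= Z.
  rewrite /Z -[1 in leLHS]mulr1 ler_pM // ?lerDl //.
  by rewrite !mulr_ge0.
have Z0 : 0 < Z by exact: lt_le_trans Z1.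
exists (k0 / Z), (es / (n%:R + 1)).
split; [by rewrite divr_gt0|by rewrite divr_gt0 // ltr_wpDl|].
move=> z eta sig s zr Yeta emax euniq ereg sig01 feas compl sk res.
have [->//|zx] := eqVneq z xs; pose u := z - xs.
have u0 : u != 0 by rewrite subr_eq0.
have U0 : 0 < `|u| by rewrite normr_gt0.
have uz : u + xs = z by rewrite /u subrK.
pose q i : 'rV[R]_n -> R := quad (bump u (s i)) xs.
pose w : 'rV[R]_n := \row_j - ('D_('e_j) f z +
  \sum_i sig i * ('D_('e_j) (g i ^~ (eta i)) z + 'D_('e_j) (q i) z)).
pose ft : 'rV[R]_n -> R := quad (tilt u w) xs.
pose M := 1 + 2 * #|I|%:R * Lam.
have M0 : 0 < M by rewrite ltr_wpDr // !mulr_ge0.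
have ZM : Z = (1 + n%:R) * M by [].
have wle : `|w| <= k0 / Z * M * `|u|.
  apply: norm_le_coord => [|j]; first by rewrite !mulr_ge0 ?invr_ge0 ?(ltW k00) ?(ltW Z0) ?(ltW M0).
  rewrite mxE normrN; under eq_bigr => i _ do rewrite mulrDr.
  rewrite big_split addrA; apply: le_trans (ler_normD _ _) _.
  have qle : `|\sum_i sig i * 'D_('e_j) (q i) z| <= \sum_(i : I) Lam * (2 * (k0 / Z * `|u|)).
    apply: le_trans (ler_norm_sum _ _ _) _; apply: ler_sum => i _.
    have /andP[s0 sL] := sig01 i.
    rewrite normrM ger0_norm // ler_pM // -uz.
    apply: le_trans (derive_bump_bound u0 _ _ _) _; rewrite ler_pM2l //.
    by rewrite ler_pdivrMr //; have := sk i; rewrite expr2 mulrA.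
  apply: le_trans (lerD (res j) qle) _; rewrite sumr_const -[X in _ + X <= _]mulr_natl -/u.
  rewrite (_ : k0 / Z * `|u| + _ = k0 / Z * M * `|u|) //.
  by rewrite /M; ring.
have Ak i j : `|tilt u w i j| <= k0.
  apply: le_trans (tilt_bound u0 w i j) _.
  have : `|w| / `|u| <= k0 / Z * M by rewrite ler_pdivrMr.
  rewrite -(ler_pM2l (_ : 0 < 1 + n%:R)); last by rewrite ltr_pwDl.
  move/le_trans; apply; rewrite mulrCA mulrAC -ZM mulrC.
  by rewrite mulrC mulfK ?gt_eqF.
have Aik i a b : `|bump u (s i) a b| <= k0.
  apply: le_trans (bump_bound u0 _ _ _) _; rewrite ler_pdivrMr ?exprn_gt0 //.
  apply: le_trans (sk i) _; rewrite ler_wpM2r ?exprn_ge0 //.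
  by rewrite ler_pdivrMr // ler_peMr // ltW.
have [xt [_ _ uniq _]] := H ft _ (small _ _ Ak Aik).
have df x : differentiable f x := Ck_diff x fC.
have dg i y x : differentiable (g i ^~ y) x := Ck_diff x (Ck_joint_l y (gC i)).
have dft x : differentiable ft x := Ck_diff x (Ck_quad 1 _ _).
have dq i x : differentiable (q i) x := Ck_diff x (Ck_quad 1 _ _).
have sx : xs = xt.
  apply: uniq; first by rewrite /eball /= subrr enorm0.
  apply: (@stationary_perturbed0 f g v xs ft q) => //.
  - by move=> i; rewrite /q /quad subrr bform0l.
  - by move=> i j; rewrite derive_quad subrr bform0l bform0r addr0.
  by move=> j; rewrite derive_quad subrr bform0l bform0r addr0.
have sz : z = xt.
  apply: uniq.
    rewrite /eball /=; apply: le_lt_trans (enorm_le_norm _) _.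
    apply: (@le_lt_trans _ _ ((n%:R + 1) * `|u|)); first by rewrite ler_wpM2r // lerDl.
    by rewrite mulrC -ltr_pdivlMr // ltr_wpDl.
  have qz i : q i z = s i by rewrite -uz; exact: quad_bump.
  apply: (@stationary_perturbed f g v z ft q eta sig) => //.
  - by move=> i; have /andP[] := sig01 i.
  - by move=> i; rewrite qz.
  - by move=> i; rewrite qz.
  move=> j; have -> : 'D_('e_j) ft z = w 0 j by rewrite -uz; exact: derive_tilt.
  by rewrite mxE; ring.
by rewrite sz sx.
Qed.

End Calmness.

(** * The defect of one step *)

Section OneStep.
Context {R : realType} {n m : nat} {I J : finType}.
Variables (f : 'rV[R]_n -> R) (g : I -> 'rV[R]_n -> 'rV[R]_m -> R) (v : J -> 'rV[R]_m -> R).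

(** The multipliers of the cuts of index i and of the approximate constraint
    gb i are lumped into sig i and attached to the maximiser eta i.  Testing
    stationarity with the EMFCQ direction xi bounds their sum by 2 B.  A
    positive sig i certifies that g_i(z, eta i) is at least -C h^4, through an
    active cut or through gb i = 0; feasibility for gb i bounds it above, so
    the correction s i has size at most C h^4. *)
Lemma approx_KKT_defect (Yf : set 'rV[R]_m) (gb : I -> 'rV[R]_n -> R) (z xi : 'rV[R]_n)
    (eta : I -> 'rV[R]_m) (C h B : R) :
  finite_set Yf -> Yf `<=` Yset v -> 0 <= C ->
  differentiable f z -> (forall i y, differentiable (g i ^~ y) z) ->
  (forall i, lower_sol (g i) v z (eta i)) ->
  (forall i, model_accurate (g i) v xi z (gb i) (eta i) C h) ->
  'D_xi f z <= B ->
  approx_KKT f g Yf [set: I] gb z ->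
  exists sig s : I -> R,
    [/\ forall i, 0 <= sig i <= 2 * B, forall i, g i z (eta i) + s i <= 0,
        forall i, sig i * (g i z (eta i) + s i) = 0, forall i, `|s i| <= C * h ^+ 4
      & forall j, `|'D_('e_j) f z + \sum_i sig i * 'D_('e_j) (g i ^~ (eta i)) z|
          <= #|I|%:R * (2 * B) * (C ^+ 2 + C) * h ^+ 2].
Proof.
move=> Yfin YfY C0 df dg sol acc DfB.
have max i y : Yset v y -> g i z y <= g i z (eta i) by have [_] := sol i; exact.
have dgb i : differentiable (gb i) z by have [] := acc i.
have Egb i : `|gb i z - g i z (eta i)| <= C * h ^+ 4 by have [_ []] := acc i.
have EDgb i (u : 'rV[R]_n) : `|'D_u (gb i) z - 'D_u (g i ^~ (eta i)) z| <= C * `|u| * h ^+ 2.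
  by have [_ [_]] := acc i; exact.
have Dxigb i : 'D_xi (gb i) z <= - 2^-1 by have [] := acc i.
have cut i y (Yy : Yset v y) (gy : g i z y = 0) :
    [/\ `|y - eta i| ^+ 2 <= C * g i z (eta i),
        forall u, `|'D_u (g i ^~ y) z - 'D_u (g i ^~ (eta i)) z| <= C * `|u| * `|y - eta i|
      & 'D_xi (g i ^~ y) z <= - 2^-1] by have [_ _ _ _] := acc i; exact.
move=> [feasY feasb [lam [nu [lamP nuP stat]]]].
have [S Suniq YfS] : exists2 S : seq 'rV[R]_m, uniq S & Yf = [set` S].
  have /finite_seqP [r Yr] := Yfin; exists (undup r); first exact: undup_uniq.
  by rewrite Yr; apply/seteqP; split => y /=; rewrite mem_undup.
have inS y : y \in S -> Yf y by rewrite YfS.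
have statj j : 'D_('e_j) f z + \sum_i (\sum_(y <- S) lam i y * 'D_('e_j) (g i ^~ y) z
    + nu i * 'D_('e_j) (gb i) z) = 0.
  have := congr1 (fun w : 'rV[R]_n => w 0 j) stat.
  rewrite YfS (_ : [set: I] = [set` index_enum I]); last first.
    by apply/seteqP; split => i //=; rewrite mem_index_enum.
  rewrite -fsbig_seq ?index_enum_uniq // !mxE !summxE => E.
  rewrite -[RHS]E -addrA big_split /=; congr (_ + (_ + _)).
    apply: eq_bigr => i _; rewrite -fsbig_seq // summxE.
    by apply: eq_bigr => y _; rewrite !mxE.
  by apply: eq_bigr => i _; rewrite !mxE.
have {}stat u : 'D_u f z + \sum_i (\sum_(y <- S) lam i y * 'D_u (g i ^~ y) z
    + nu i * 'D_u (gb i) z) = 0.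
  have E0 : \sum_(j < n) u 0 j * 0 = 0 :> R by rewrite big1 // => j _; rewrite mulr0.
  rewrite -[RHS]E0; under [RHS]eq_bigr => j _ do rewrite -(statj j) mulrDr mulr_sumr.
  rewrite [RHS]big_split /= [X in _ = _ + X]exchange_big /= (derive_sum_coord _ df).
  congr (_ + _).
  apply: eq_bigr => i _; rewrite (derive_sum_coord _ (dgb i)).
  under [RHS]eq_bigr => j _ do rewrite mulrDr mulr_sumr.
  rewrite [RHS]big_split [X in _ = X + _]exchange_big /=; congr (_ + _).
    apply: eq_bigr => y _; rewrite (derive_sum_coord _ (dg i y)) mulr_sumr.
    by apply: eq_bigr => j _; rewrite mulrCA.
  by rewrite mulr_sumr; apply: eq_bigr => j _; rewrite mulrCA.
have lam0 i y : y \in S -> 0 <= lam i y by move=> /inS /(lamP i) [].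
have nu0 i : 0 <= nu i by have [] := nuP i Logic.I.
have lamg i y : y \in S -> lam i y != 0 -> Yset v y /\ g i z y = 0.
  move=> /inS Yy ln0; split; first exact: YfY.
  by have [_ /eqP] := lamP i y Yy; rewrite mulf_eq0 (negPf ln0) => /eqP.
pose sig i := \sum_(y <- S) lam i y + nu i.
have sig0 i : 0 <= sig i.
  by rewrite addr_ge0 // big_seq sumr_ge0 // => y; exact: lam0.
have sigB i : sig i <= 2 * B.
  suff : \sum_i sig i <= 2 * B.
    by apply: le_trans; rewrite (bigD1 i) //= lerDl sumr_ge0.
  have : \sum_i (\sum_(y <- S) lam i y * 'D_xi (g i ^~ y) z + nu i * 'D_xi (gb i) z)
      <= \sum_i - 2^-1 * sig i.
    apply: ler_sum => k _; rewrite mulrDr; apply: lerD; last first.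
      by rewrite mulrC ler_wpM2r.
    rewrite mulr_sumr big_seq [leRHS]big_seq; apply: ler_sum => y yS.
    have [->|ln0] := eqVneq (lam k y) 0; first by rewrite mul0r mulr0.
    have [Yy gy] := lamg k y yS ln0.
    by rewrite mulrC ler_wpM2r ?lam0 //; have [] := cut k y Yy gy.
  rewrite -mulr_sumr; have := stat xi; lra.
pose G i := g i z (eta i).
have Gle i : G i <= C * h ^+ 4.
  have := feasb i Logic.I; have := Egb i; rewrite -/(G i) ler_norml => /andP[]; lra.
have Gge i : sig i != 0 -> - (C * h ^+ 4) <= G i.
  have h4 : 0 <= C * h ^+ 4 by rewrite mulr_ge0 // (_ : 4 = 2 * 2)%N // exprM sqr_ge0.
  have [nu00|nun0] := eqVneq (nu i) 0; last first.
    move=> _; have [_ /eqP] := nuP i Logic.I.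
    rewrite mulf_eq0 (negPf nun0) => /eqP gb0.
    by have := Egb i; rewrite gb0 -/(G i) ler_norml => /andP[]; lra.
  rewrite /sig nu00 addr0 => sn0.
  have : has (fun y => lam i y != 0) S.
    apply: contraNT sn0 => /hasPn all0; rewrite big_seq big1 // => y yS.
    by have := all0 y yS; rewrite negbK => /eqP.
  move=> /hasP [y yS ln0]; have [Yy gy] := lamg i y yS ln0.
  have := max i y Yy; rewrite gy -/(G i); lra.
(* an inactive constraint is only corrected where it is violated *)
pose s i := if sig i == 0 then - Num.max 0 (G i) else - G i.
exists sig, s; split.
- by move=> i; rewrite sig0 sigB.
- move=> i; rewrite -/(G i) /s; case: ifP => _; last by rewrite subrr.
  by rewrite subr_le0 le_max lexx orbT.
- move=> i; rewrite -/(G i) /s; case: ifPn => [/eqP ->|_]; first by rewrite mul0r.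
  by rewrite subrr mulr0.
- have h4 : 0 <= C * h ^+ 4 by rewrite mulr_ge0 // (_ : 4 = 2 * 2)%N // exprM sqr_ge0.
  move=> i; rewrite /s; case: ifPn => [_|sn0]; rewrite normrN.
    by rewrite ger0_norm ?le_max ?lexx // ge_max h4 Gle.
  by rewrite ler_norml Gge // Gle.
move=> j; pose e : 'rV[R]_n := 'e_j.
have e1 : `|e| <= 1 := norm_delta_le j.
have -> : 'D_e f z + \sum_i sig i * 'D_e (g i ^~ (eta i)) z =
  \sum_i (\sum_(y <- S) lam i y * ('D_e (g i ^~ (eta i)) z - 'D_e (g i ^~ y) z) +
    nu i * ('D_e (g i ^~ (eta i)) z - 'D_e (gb i) z)).
  rewrite (_ : \sum_i sig i * _ =
    \sum_i (\sum_(y <- S) lam i y * ('D_e (g i ^~ (eta i)) z - 'D_e (g i ^~ y) z) +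
      nu i * ('D_e (g i ^~ (eta i)) z - 'D_e (gb i) z)) +
    \sum_i (\sum_(y <- S) lam i y * 'D_e (g i ^~ y) z + nu i * 'D_e (gb i) z)).
    by rewrite addrCA stat addr0.
  rewrite -big_split /=; apply: eq_bigr => i _.
  rewrite addrACA -mulrDr subrK -big_split /=.
  rewrite /sig mulrDl mulr_suml; congr (_ + _); apply: eq_bigr => y _.
  by rewrite -mulrDr subrK.
have h2 : 0 <= h ^+ 2 := sqr_ge0 h.
have Ch2 : 0 <= C ^+ 2 * h ^+ 2 by rewrite mulr_ge0 // sqr_ge0.
have Ch2' : 0 <= C * h ^+ 2 by rewrite mulr_ge0.
have -> : #|I|%:R * (2 * B) * (C ^+ 2 + C) * h ^+ 2 =
    \sum_(i : I) (2 * B) * (C ^+ 2 * h ^+ 2 + C * h ^+ 2).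
  by rewrite sumr_const -[RHS]mulr_natl; ring.
apply: le_trans (ler_norm_sum _ _ _) _; apply: ler_sum => i _.
apply: (@le_trans _ _ (sig i * (C ^+ 2 * h ^+ 2 + C * h ^+ 2))); last first.
  by rewrite ler_wpM2r ?addr_ge0.
rewrite /sig mulrDl mulr_suml; apply: le_trans (ler_normD _ _) _; apply: lerD; last first.
  rewrite normrM ger0_norm // ler_wpM2l // distrC; apply: le_trans (EDgb i e) _.
  have : C * `|e| * h ^+ 2 <= C * h ^+ 2 by rewrite ler_wpM2r // ler_piMr.
  lra.
apply: le_trans (ler_norm_sum _ _ _) _; rewrite big_seq [leRHS]big_seq; apply: ler_sum => y yS.
have [->|ln0] := eqVneq (lam i y) 0; first by rewrite !mul0r normr0.
have [Yy gy] := lamg i y yS ln0.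
rewrite normrM (ger0_norm (lam0 i y yS)) ler_wpM2l ?lam0 // distrC.
have [Eg EDg _] := cut i y Yy gy; apply: le_trans (EDg e) _.
have ye : `|y - eta i| <= C * h ^+ 2.
  rewrite -ler_sqr ?nnegrE //; apply: le_trans Eg _.
  have -> : (C * h ^+ 2) ^+ 2 = C * (C * h ^+ 4) by ring.
  by rewrite ler_wpM2l // Gle.
apply: (@le_trans _ _ (C * 1 * (C * h ^+ 2))); last by rewrite mulr1 mulrA -expr2 lerDl.
by rewrite ler_pM ?mulr_ge0 // ler_wpM2l.
Qed.

End OneStep.

(** * Quadratic convergence *)

Lemma quADAPT_cuts (R : realType) (n m : nat) (I J : finType)
    (f : 'rV[R]_n -> R) (g : I -> 'rV[R]_n -> 'rV[R]_m -> R) (v : J -> 'rV[R]_m -> R)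
    x Yk y mu yf muf : quADAPT f g v x Yk y mu yf muf ->
  forall k, finite_set (Yk k) /\ Yk k `<=` Yset v.
Proof.
move=> run; elim=> [|k [fk sk]]; first exact: quADAPT_Y0 run.
rewrite (quADAPT_YS run); split.
  by rewrite finite_setU; split => //; exact/finite_image/finite_finset.
by rewrite subUset; split => // _ [i _ <-]; have [[]] := quADAPT_lower run k i.
Qed.

Theorem mainTheorem2 (R : realType) (n m : nat) (I J : finType)
    (f : 'rV[R]_n -> R) (g : I -> 'rV[R]_n -> 'rV[R]_m -> R)
    (v : J -> 'rV[R]_m -> R)
    (x : nat -> 'rV[R]_n) (Yk : nat -> set 'rV[R]_m)
    (y : nat -> I -> 'rV[R]_m) (mu : nat -> I -> J -> R)
    (yf : nat -> I -> 'rV[R]_n -> 'rV[R]_m)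
    (muf : nat -> I -> J -> 'rV[R]_n -> R)
    (xs : 'rV[R]_n)
    (Ycompact : compact (Yset v))
    (gC3 : forall i, Ck 3 (joint (g i)))
    (vC3 : forall j, Ck 3 (v j))
    (fC2 : Ck 2 f)
    (run : quADAPT f g v x Yk y mu yf muf)
    (Ibar_full : forall k, Ibar g v (x k) (y k) = [set: I])
    (xs_stable : strongly_stable f g v xs)
    (x_cvg : x @ \oo --> xs)
    (xs_EMFCQ : EMFCQ g v xs)
    (xs_RA : reduction_ansatz g v xs)
    (ys_unique : forall i, exists ys : 'rV[R]_m,
      [/\ lower_sol (g i) v xs ys,
          forall z, lower_sol (g i) v xs z -> z = ys
        & g i xs ys = 0]) :
  exists L : R, \forall k \near \oo,
    enorm (x k.+1 - xs) <= L * enorm (x k - xs) ^+ 2.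
Proof.
have [xi xiP] := xs_EMFCQ.
have dg i y' x' : differentiable (g i ^~ y') x' := Ck_diff x' (Ck_joint_l y' (gC3 i)).
have model i : exists p : R * R, [/\ 0 <= p.1, 0 < p.2 &
  forall x0 z y0 mu0 yf muf eta sig,
    `|x0 - xs| < p.2 -> `|z - xs| < p.2 ->
    lower_sol (g i) v x0 y0 -> lower_KKT (g i) v x0 y0 mu0 ->
    implicit_KKT (g i) v x0 y0 mu0 yf muf ->
    lower_sol (g i) v z eta -> lower_KKT (g i) v z eta sig ->
    model_accurate (g i) v xi z (gbar (g i) v x0 y0 mu0 yf muf) eta p.1 `|z - x0|].
  have [ys [sol uniq g0]] := ys_unique i.
  have Y0ys : Y0 g v i xs ys by split => //; have [] := sol.
  have Dxi : 'D_xi (g i ^~ ys) xs <= -1 by rewrite derive_grad //; exact: xiP.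
  have [C [d H]] := local_model (gC3 i) vC3 Ycompact g0 sol uniq (xs_RA i ys Y0ys) Dxi.
  by exists (C, d).
have {model} [p Hp] := choice model.
pose C := 1 + \sum_i (p i).1.
have p10 i : 0 <= (p i).1 by have [] := Hp i.
have C1 : 1 <= C by rewrite lerDl sumr_ge0.
have C0 : 0 <= C by lra.
have pC i : (p i).1 <= C.
  by rewrite /C (bigD1 i) //= addrCA lerDl addr_ge0 // sumr_ge0.
have [d [d0 dp]] : exists d, 0 < d /\ forall i, d <= (p i).2.
  have : \forall d \near 0^'+, forall i, d <= (p i).2.
    by apply: filter_forall => i; apply: nbhs0_right_le; have [] := Hp i.
  move=> H; have [d [d0 dp]] := @filter_ex _ _ (at_right_proper_filter _) _
    (filterI (nbhs_right_gt (0 : R)) H).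
  by exists d.
have [Cf [df [Cf0 df0 Hf]]] := derive_bound_near xs (CkW fC2).
pose B := Cf * `|xi|; have B0 : 0 <= B by rewrite mulr_ge0.
have B20 : 0 <= 2 * B by rewrite mulr_ge0.
have [k1 [rho [k10 rho0 calm]]] := stable_calm fC2 gC3 xs_stable B20.
pose K := C + #|I|%:R * (2 * B) * (C ^+ 2 + C).
have KI0 : 0 <= #|I|%:R * (2 * B) * (C ^+ 2 + C).
  by apply: mulr_ge0; [exact: mulr_ge0|rewrite addr_ge0 // exprn_ge0].
have K0 : 0 < K by rewrite /K; lra.
have [tau [tau0 tau1 tauK]] : exists tau : R, [/\ 0 < tau, tau <= 1 & K * tau <= k1].
  exists (Num.min 1 (k1 / K)); split; first by rewrite lt_min ltr01 divr_gt0.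
    by rewrite ge_min lexx.
  by rewrite mulrC -ler_pdivlMr // ge_min lexx orbT.
(* the bound tau / 4 allows the absorption of |z - xs|^2 at the end *)
pose r := Num.min (Num.min d df) (Num.min rho (tau / 4)).
have r0 : 0 < r by rewrite !lt_min d0 df0 rho0 divr_gt0.
have [rd rdf rrho rtau] : [/\ r <= d, r <= df, r <= rho & r <= tau / 4].
  by rewrite !ge_min !lexx ?orbT.
exists (n%:R * (4 / tau)).
have /cvgrPdist_lt/(_ r r0) [N _ HN] := x_cvg.
exists N => // k /= Nk.
set x0 := x k; set z := x k.+1.
have x0r : `|x0 - xs| < r by rewrite distrC; exact: HN.
have zr : `|z - xs| < r by rewrite distrC; apply: HN; rewrite /= (leq_trans Nk).
have ll i : forall q, q < r -> q < (p i).2.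
  by move=> q qr; apply: lt_le_trans qr (le_trans rd (dp i)).
have reg k' i : regular (g i) v (x k') (y k' i).
  by have : Ibar g v (x k') (y k') i by rewrite Ibar_full.
have sol i : lower_sol (g i) v z (y k.+1 i) by have [] := quADAPT_lower run k.+1 i.
have acc i : model_accurate (g i) v xi z
    (gbar (g i) v x0 (y k i) (mu k i) (yf k i) (muf k i)) (y k.+1 i) C `|z - x0|.
  have [_ _ H] := Hp i; have [sol0 kkt0] := quADAPT_lower run k i.
  have [_ kkt1] := quADAPT_lower run k.+1 i.
  apply: model_accurateW (pC i) (normr_ge0 _) (sol i) _.
  apply: (H x0 z _ _ _ _ _ _ (ll i _ x0r) (ll i _ zr) sol0 kkt0 _ (sol i) kkt1).
  by apply: (quADAPT_implicit run); rewrite Ibar_full.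
have kkt := quADAPT_next run k; rewrite Ibar_full in kkt.
have [Yfin YY] := quADAPT_cuts run k.+1.
have DfB : 'D_xi f z <= B.
  by apply: le_trans (ler_norm _) _; apply: Hf; exact: lt_le_trans rdf.
set h := `|z - x0|.
have h0 : 0 <= h := normr_ge0 _.
have [sig [s [sigB feas compl sle res]]] : exists sig s : I -> R,
    [/\ forall i, 0 <= sig i <= 2 * B, forall i, g i z (y k.+1 i) + s i <= 0,
        forall i, sig i * (g i z (y k.+1 i) + s i) = 0, forall i, `|s i| <= C * h ^+ 4
      & forall j, `|'D_('e_j) f z + \sum_i sig i * 'D_('e_j) (g i ^~ (y k.+1 i)) z|
          <= #|I|%:R * (2 * B) * (C ^+ 2 + C) * h ^+ 2].
  exact: (approx_KKT_defect Yfin YY C0 (Ck_diff z fC2) (fun i y' => dg i y' z) sol acc DfB kkt).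
(* otherwise the defect is small relative to |z - xs| and z = xs *)
have step : tau * `|z - xs| <= h ^+ 2.
  have [//|contra] := leP (tau * `|z - xs|) (h ^+ 2).
  suff E : z = xs by move: contra; rewrite E subrr normr0 mulr0 ltNge exprn_ge0.
  have H1 : h ^+ 2 <= tau * `|z - xs| := ltW contra.
  have Kr : K * (tau * `|z - xs|) <= k1 * `|z - xs| by rewrite mulrA ler_wpM2r.
  apply: (calm z (y k.+1) sig s) => //.
  - exact: lt_le_trans rrho.
  - by move=> i; have [] := sol i.
  - by move=> i; have [_] := sol i.
  - by move=> i; have [] := acc i.
  - by move=> i; exact: reg.
  - move=> i; apply: le_trans (sle i) _.
    have CK : C <= K by rewrite /K lerDl.
    have H2 : h ^+ 2 * h ^+ 2 <= (tau * `|z - xs|) * (1 * `|z - xs|).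
      rewrite ler_pM ?exprn_ge0 //; apply: le_trans H1 _; by rewrite ler_wpM2r.
    have -> : C * h ^+ 4 = C * (h ^+ 2 * h ^+ 2) by ring.
    apply: (@le_trans _ _ (K * ((tau * `|z - xs|) * (1 * `|z - xs|)))).
      by rewrite ler_pM // mulr_ge0 // exprn_ge0.
    by rewrite mul1r mulrA expr2 [k1 * _]mulrA ler_wpM2r.
  move=> j; apply: le_trans (res j) _; apply: le_trans Kr.
  rewrite ler_pM ?exprn_ge0 // /K; lra.
have hle : h <= `|z - xs| + `|x0 - xs|.
  by have := ler_normB (z - xs) (x0 - xs); rewrite opprB addrA subrK.
have final : `|z - xs| <= 4 / tau * `|x0 - xs| ^+ 2.
  rewrite -(ler_pM2l tau0) (_ : tau * (4 / tau * _) = 4 * `|x0 - xs| ^+ 2); last first.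
    by field; rewrite gt_eqF.
  set a := `|z - xs| in hle step *; set b := `|x0 - xs| in hle *.
  have a0 : 0 <= a := normr_ge0 _.
  have b0 : 0 <= b := normr_ge0 _.
  have hh : h ^+ 2 <= (a + b) ^+ 2 by rewrite ler_sqr ?nnegrE ?addr_ge0.
  have ab := sqr_ge0 (a - b).
  have aa : a ^+ 2 <= tau / 4 * a.
    by rewrite expr2 ler_wpM2r //; apply: le_trans rtau; exact: ltW.
  have sq1 : (a + b) ^+ 2 = a ^+ 2 + 2 * (a * b) + b ^+ 2 by ring.
  have sq2 : (a - b) ^+ 2 = a ^+ 2 - 2 * (a * b) + b ^+ 2 by ring.
  move: ab hh step aa; rewrite sq1 sq2; lra.
apply: le_trans (enorm_le_norm _) _; rewrite -mulrA ler_wpM2l //.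
apply: le_trans final _; rewrite ler_wpM2l ?divr_ge0 ?(ltW tau0) //.
by rewrite ler_sqr ?nnegrE ?sqrtr_ge0 // norm_le_enorm.
Qed.
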